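(* Let $G_n$ be the adjacency matrix of a $d(n)$-regular graph on $n$ vertices (deterministic or random), let $\theta\in\mathbb R$, and set $A_n=\frac{\theta G_n}{d(n)}$. Let $c_1,\dots,c_n$ be i.i.d. from a distribution $F$ on $\mathbb R$ with $\mathbb E_F\psi'(c_1)=0$, and given $c=(c_1,\dots,c_n)^\top$ and $G_n$ let $\boldsymbol\sigma$ be drawn from the quadratic interaction model with coupling matrix $A_n$, field vector $c$ and common base measure $\mu$. Assume $d(n)\gg n^{1/2}$ and $|\theta|<1$. Then, as $n\to\infty$, conditionally on $G_n$: (a) (Sample mean) $$\frac1{\sqrt n}\sum_{i=1}^n(\sigma_i-u_i)\,\Big|\,c\ \xrightarrow{d}\ N\Big(0,\frac{\mathbb E_F\psi''(c_1)}{1-\theta\,\mathbb E_F\psi''(c_1)}\Big),$$ $$\frac1{\sqrt n}\sum_{i=1}^n\sigma_i\ \xrightarrow{d}\ N\Big(0,\frac{\mathbb E_F\psi''(c_1)}{1-\theta\,\mathbb E_F\psi''(c_1)}+\frac{\mathbb E_F[\psi'(c_1)^2]}{(1-\theta\,\mathbb E_F\psi''(c_1))^2}\Big).$$ (b) (Contrasts) Suppose further that $q=q^{(n)}\in\mathbb R^n$ satisfies $\|q\|=1$, $\sum_{i=1}^nq_i=o(\sqrt{d(n)})$, $\|q\|_\infty\to0$, and that $$\big\|A_n-\theta\,n^{-1}\mathbf 1\mathbf 1^\top\big\|\lesssim d(n)^{-1/2}.$$ Then $$\sum_{i=1}^nq_i(\sigma_i-u_i)\,\Big|\,c\ \xrightarrow{d}\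 N\big(0,\mathbb E_F\psi''(c_1)\big),\qquad\sum_{i=1}^nq_i\sigma_i\ \xrightarrow{d}\ N\big(0,\mathbb E_F\psi''(c_1)+\mathbb E_F[\psi'(c_1)^2]\big).$$
   Context: Model: $\mu$ is a fixed non-degenerate probability measure supported on $[-1,1]$ with both $-1$ and $1$ in its support. The quadratic interaction model with coupling matrix $A_n$ (real symmetric, zero diagonal), field $c$ and base measure $\mu$ is the law on $[-1,1]^n$ with density $\frac1{Z_n}\exp(\frac12\boldsymbol\sigma^\top A_n\boldsymbol\sigma+c^\top\boldsymbol\sigma)$ with respect to $\mu^{\otimes n}$. Graphs are simple. The field $c$ is independent of $G_n$, $\mathbb E_F$ is expectation over $c$, and $q$ is deterministic. $\psi(\theta)=\log\int e^{\theta z}\,d\mu(z)$. For vectors $\|\cdot\|,\|\cdot\|_\infty$ are the $\ell_2$, $\ell_\infty$ norms; for matrices $\|\cdot\|$ is the $\ell_2$ operator norm; $\mathbf 1$ is the all-ones vector. $a_n\gg b_n$ means $b_n/a_n\to0$; $a_n\lesssim b_n$ means $a_n\le Cb_n$ with $C$ free of $n$. Mean-Field optimizer: $\phi:(-1,1)\to\mathbb R$ is the inverse of $\psi':\mathbb R\to(-1,1)$, $I(z)=z\phi(z)-\psi(\phi(z))$ (extended to $\pm1$ by its limits in $[0,\infty]$), and $u=u(A_n,c)$ is the unique maximizer over $[-1,1]^n$ of $z\mapsto\frac12z^\top A_nz+z^\top c-\sum_iI(z_i)$ (unique since $\|A_n\|=|\theta|<1$). Convergence: all statements are conditional on $G_n$,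 i.e. $(G_n)$ is treated as a fixed sequence. ''$X_n\mid c\xrightarrow{d}\nu$'' means that the Kolmogorov–Smirnov distance between the conditional law of $X_n$ given $c$ and $\nu$ tends to $0$ in probability; ''$X_n\xrightarrow{d}\nu$'' is convergence in distribution with $c$ averaged out. *)

(* Defs.v *)
From HB Require Import structures.
From mathcomp Require Import all_boot all_order all_algebra.
From mathcomp Require Import all_classical all_reals all_analysis.
From mathcomp Require Import measurable_realfun.

Set Implicit Arguments.
Unset Strict Implicit.
Unset Printing Implicit Defensive.

Import Order.TTheory GRing.Theory Num.Theory.
Import numFieldNormedType.Exports.

Local Open Scope classical_set_scope.
Local Open Scope ring_scope.

Section linear_algebra.
Context {R : realType}.

Definition col_of_tuple n (t : n.-tuple R) : 'cV[R]_n := \col_i tnth t i.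

Definition norm2 n (x : 'cV[R]_n) : R := Num.sqrt (\sum_i x i 0 ^+ 2).

Definition opnorm n (M : 'M[R]_n) : R :=
  sup [set norm2 (M *m x) | x in [set x : 'cV[R]_n | norm2 x <= 1]].

Definition quad_form n (A : 'M[R]_n) (c x : 'cV[R]_n) : R :=
  2^-1 * (x^T *m A *m x) 0 0 + (c^T *m x) 0 0.

Definition adj_mx n (e : rel 'I_n) : 'M[R]_n := \matrix_(i, j) (e i j)%:R.

End linear_algebra.

Definition regular_graph n (e : rel 'I_n) (d : nat) : Prop :=
  [/\ symmetric e, irreflexive e & forall i, #|[pred j | e i j]| = d].

Section iid.
Context {d : measure_display} {T : measurableType d} {R : realType}.

Definition cons_pair n (x : T * n.-tuple T) : n.+1.-tuple T :=
  [the n.+1.-tuple T of x.1 :: x.2].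

Lemma measurable_cons_pair n : measurable_fun [set: _] (@cons_pair n).
Proof. by apply: measurable_cons. Qed.

HB.instance Definition _ n :=
  isMeasurableFun.Build _ _ _ _ (@cons_pair n) (@measurable_cons_pair n).

(* the [n]-fold product of [P], characterized by [iid_law_box] *)
Fixpoint iid_law (P : probability T R) n : probability (n.-tuple T) R :=
  if n is m.+1 then distribution (P \x iid_law P m)%E (@cons_pair m)
  else dirac [tuple].

Lemma iid_law_box (P : probability T R) n (B : 'I_n -> set T) :
  (forall i, measurable (B i)) ->
  iid_law P n [set t | forall i, B i (tnth t i)] = (\prod_i P (B i))%E.
Proof.
elim: n B => [|n IH] B mB /=.
  rewrite big_ord0 (_ : [set _ | _] = setT) ?diracT//.
  by apply/seteqP; split=> // t _ [].
rewrite /distribution /pushforward big_ord_recl.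
rewrite (_ : _ @^-1` _ =
  B ord0 `*` [set t | forall i, B (lift ord0 i) (tnth t i)]); last first.
  apply/seteqP; split=> [[x t] /= H|[x t] /= [Bx H] i].
    by split=> [|i]; [exact: (H ord0)|have := H (lift ord0 i); rewrite tnthS].
  by case: (unliftP ord0 i) => [j ->|->]; rewrite ?tnthS.
rewrite product_measure1E//; last first.
  rewrite (_ : [set _ | _] = \bigcap_(i in [set: 'I_n])
    ((fun t : n.-tuple T => tnth t i) @^-1` B (lift ord0 i))); last first.
    by apply/seteqP; split=> t /= H i; [move=> _; exact: H|exact: H].
  apply: fin_bigcap_measurable => // i _.
  by rewrite -[X in measurable X]setTI; exact: measurable_tnth.
by congr (_ * _)%E; exact: IH.
Qed.

End iid.

Section exp_tilt.
Context {d : measure_display} {T : measurableType d} {R : realType}.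
Variables (P : probability T R) (f : {mfun T >-> R}).
Local Open Scope ereal_scope.

Definition exp_weight : set T -> \bar R :=
  fun B => \int[P]_(x in B) (expR (f x))%:E.

Let exp_weight0 : exp_weight set0 = 0.
Proof. exact: integral_set0. Qed.

Let exp_weight_ge0 B : 0 <= exp_weight B.
Proof. by apply: integral_ge0 => x _; rewrite lee_fin expR_ge0. Qed.

Let exp_weight_sigma_additive : semi_sigma_additive exp_weight.
Proof.
move=> F mF tF mUF; rewrite /exp_weight ge0_integral_bigcup//=.
- by apply: is_cvg_ereal_nneg_natsum_cond => n _ _; exact: exp_weight_ge0.
- by apply/measurable_EFinP/measurable_funTS/measurableT_comp.
Qed.

HB.instance Definition _ := isMeasure.Build _ _ _ exp_weight
  exp_weight0 exp_weight_ge0 exp_weight_sigma_additive.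

(* the probability with density [expR f / Z] with respect to [P], where [Z] is
   the normalizing constant; the last argument of [mnormalize] is a default for
   [Z = 0] or [Z = +oo], which do not occur when [f] is [P]-essentially
   bounded *)
Definition exp_tilt : probability T R := mnormalize exp_weight P.

End exp_tilt.

Section distances.
Context {R : realType}.
Implicit Types P Q : set R -> \bar R.

Definition cdf_of P (t : R) : R := fine (P `]-oo, t]%classic).

Definition ks_dist P Q : R :=
  sup (range (fun t => `|cdf_of P t - cdf_of Q t|)).

Definition cvg_in_law (P : nat -> set R -> \bar R) Q : Prop :=
  forall t, {for t, continuous (cdf_of Q)} ->
    cdf_of (P n) t @[n --> \oo] --> cdf_of Q t.

(* The outer measure [mu_ext] agrees with the measure on measurable sets; it is
   used so that the definition makes sense for arbitrary functions [X n]. *)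
Definition cvg0_in_prob (d : nat -> measure_display)
    (T : forall n, measurableType (d n)) (P : forall n, probability (T n) R)
    (X : forall n, T n -> R) : Prop :=
  forall e, 0 < e ->
    mu_ext (P n) [set w | e < `|X n w|] @[n --> \oo] --> 0%E.

(* [N(0, v)], for [v > 0] *)
Definition centered_normal (v : R) : set R -> \bar R :=
  normal_prob 0 (Num.sqrt v).

End distances.

Section base_measure.
Context {R : realType}.
Variable mu : probability (measurableTypeR R) R.

Definition topological_support : set R :=
  [set x | forall e, 0 < e -> (0 < mu `](x - e)%R, (x + e)%R[%classic)%E].

Definition base_measure : Prop :=
  [/\ mu (~` `[-1, 1]%classic) = 0%E,
      topological_support (-1), topological_support 1 &
      forall a, mu [set a] <> 1%E].

Definition psi (t : R) : R := ln (\int[mu]_z expR (t * z)).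

Definition psi1 : R -> R := (psi^`())%classic.

Definition psi2 : R -> R := (psi^`(2))%classic.

(* inverse function of [psi1] on [(-1, 1)] *)
Definition phi (z : R) : R := get [set t | psi1 t = z].

Definition rate_int (z : R) : R := z * phi z - psi (phi z).

(* extended to [-1] and [1] by its limits; the value [+oo] outside of [[-1, 1]]
   is never used *)
Definition rate (z : R) : \bar R :=
  if `|z| < 1 then (rate_int z)%:E
  else if z == 1 then lim ((rate_int x)%:E @[x --> 1^'-])
  else if z == -1 then lim ((rate_int x)%:E @[x --> (-1)^'+])
  else +oo%E.

Variable n : nat.
Implicit Types (A : 'M[R]_n) (c z : 'cV[R]_n).

Definition mf_objective A c z : \bar R :=
  ((quad_form A c z)%:E - \sum_i rate (z i 0%R))%E.

Definition cube : set 'cV[R]_n := [set z | forall i, -1 <= z i 0 <= 1].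

Definition is_mf_optimizer A c z : Prop :=
  cube z /\ forall w, cube w -> (mf_objective A c w <= mf_objective A c z)%E.

(* the maximizer is unique when the operator norm of [A] is less than 1 *)
Definition mf_optimizer A c : 'cV[R]_n := get (is_mf_optimizer A c).

Definition energy A c (x : n.-tuple (measurableTypeR R)) : R :=
  quad_form A c (col_of_tuple x).

Lemma measurable_energy A c : measurable_fun [set: _] (energy A c).
Proof.
rewrite /energy /quad_form.
apply: measurable_funD.
  apply: measurable_funM => //.
  rewrite [X in measurable_fun _ X](_ : _ = fun x : n.-tuple R =>
    \sum_j (\sum_i tnth x i * A i j) * tnth x j); last first.
    apply/funext => x; rewrite mxE; apply: eq_bigr => j _; rewrite !mxE.
    by congr (_ * _); apply: eq_bigr => i _; rewrite !mxE.
  apply: measurable_sum => j; apply: measurable_funM; last exact: measurable_tnth.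
  apply: measurable_sum => i; apply: measurable_funM => //.
  exact: measurable_tnth.
rewrite [X in measurable_fun _ X](_ : _ = fun x : n.-tuple R =>
  \sum_i c i 0 * tnth x i); last first.
  by apply/funext => x; rewrite mxE; apply: eq_bigr => i _; rewrite !mxE.
by apply: measurable_sum => i; apply: measurable_funM => //; exact: measurable_tnth.
Qed.

HB.instance Definition _ A c :=
  isMeasurableFun.Build _ _ _ _ (energy A c) (measurable_energy A c).

Definition gibbs A c : probability (n.-tuple (measurableTypeR R)) R :=
  exp_tilt (iid_law mu n) (energy A c).

(* the law of [sigma] when the entries of [c] are i.i.d. with law [F] and
   [sigma] given [c] has law [gibbs A c] *)
Definition annealed_gibbs (F : probability (measurableTypeR R) R) A :
    set (n.-tuple (measurableTypeR R)) -> \bar R :=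
  fun S => (\int[iid_law F n]_c gibbs A (col_of_tuple c) S)%E.

End base_measure.

(* Main.v *)
Require Import Defs.
From HB Require Import structures.
From mathcomp Require Import all_boot all_order all_algebra.
From mathcomp Require Import all_classical all_reals all_analysis.
From mathcomp Require Import measurable_realfun ring lra.

Set Implicit Arguments.
Unset Strict Implicit.
Unset Printing Implicit Defensive.

Import Order.TTheory GRing.Theory Num.Theory.
Import numFieldNormedType.Exports.

Local Open Scope classical_set_scope.
Local Open Scope ring_scope.

(** Replacing each spin by its truncation to [[-1, 1]] changes nothing almost
    surely and makes every function of the spins bounded.

    Quenched part. Let [q] be a unit vector with [A q = kappa q + e]. The
    derivative in [l] of the logarithmic moment generating function of
    [sum_i q_i sigma_i] is the Gibbs mean of that sum in the field [c + l q].
    Since the rows of [A] have absolute sum [|theta| < 1], Dobrushin's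
    contraction bounds the covariances, so the Gibbs means solve the mean-field
    equations [m = psi'(A m + c)] up to an l2 error of order
    [sqrt n * theta^2 / d]. Subtracting the equations in the fields [c] and
    [c + l q] and linearizing, the derivative is [sum_i q_i u_i + l V + o(1)]
    with [V = v / (1 - kappa v)], provided that a few polynomial statistics of
    [psi'(c)] and [psi''(c)] are small; their sum has small mean, so Markov's
    inequality applies. Convergence of moment generating functions on compact
    sets gives convergence of the means of polynomials, then of polynomials in
    [sin (x / M)], among which are approximate step functions; this is
    convergence of distribution functions.

    Annealed part. The same linearization gives
    [(1 - kappa v) sum_i q_i u_i = sum_i q_i psi'(c_i) + o(1)], so the annealed
    law is close to that of a normal variable of variance [V] plus an
    independent normalized sum of the centered [psi'(c_i)].

    In part (a), [q] is constant and [kappa = theta]; in part (b), [kappa = 0]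
    and [e = A q]. *)

(** * Bounded random variables *)

(** The obstacle is that [A xi], where [xi i] is psi'(c_i), is not small in l2: the available bound
    on the mean of its squared norm is theta^2 n / d, which may diverge. The sum of its fourth
    powers has mean at most 3 theta^4 n / d^2, which does vanish. So remainders quadratic in [A u]
    are paired with the unit vector [q] by Cauchy-Schwarz and cost only fourth powers, while terms
    linear in [u - xi] are paired with a vector ([e], or [A p] with [p i] equal to q_i (psi''(c_i) -
    E psi''(c_1))) that is small enough for the product of the two norms to vanish. This dictates
    the weights in [field_stat] and the last condition of [regime]. The estimates hold at fixed n
    with thresholds that do not depend on n, so that limits in n are taken only at the end. *)

Section bounded_measurable.
Context {d : measure_display} {T : measurableType d} {R : realType}.
Implicit Types f g h : T -> R.

(** Boundedness everywhere rather than almost everywhere: it is stable under sums, products and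
    exponentials, and it gives integrability under every probability at once. *)
Definition bm f := measurable_fun setT f /\ exists M : R, forall x, `|f x| <= M.

Lemma bm_cst (r : R) : bm (fun=> r).
Proof. by split; [exact: measurable_cst|exists `|r|]. Qed.

Lemma bmD f g : bm f -> bm g -> bm (fun x => f x + g x).
Proof.
move=> [mf [M fM]] [mg [N gN]]; split; first exact: measurable_funD.
by exists (M + N) => x; rewrite (le_trans (ler_normD _ _))// lerD.
Qed.

Lemma bmM f g : bm f -> bm g -> bm (fun x => f x * g x).
Proof.
move=> [mf [M fM]] [mg [N gN]]; split; first exact: measurable_funM.
by exists (M * N) => x; rewrite normrM ler_pM.
Qed.

Lemma bmN f : bm f -> bm (fun x => - f x).
Proof.
move=> [mf [M fM]]; split; first exact: measurable_funN.
by exists M => x; rewrite normrN.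
Qed.

Lemma bmB f g : bm f -> bm g -> bm (fun x => f x - g x).
Proof. by move=> bf bg; apply: bmD => //; exact: bmN. Qed.

Lemma bmX f k : bm f -> bm (fun x => f x ^+ k).
Proof.
move=> bf; elim: k => [|k IH]; first exact: bm_cst.
by under eq_fun do rewrite exprS; exact: bmM.
Qed.

Lemma bm_sum (I : Type) (s : seq I) (F : I -> T -> R) :
  (forall i, bm (F i)) -> bm (fun x => \sum_(i <- s) F i x).
Proof.
move=> bF; elim: s => [|i s IH].
  by under eq_fun do rewrite big_nil; exact: bm_cst.
by under eq_fun do rewrite big_cons; exact: bmD.
Qed.

Lemma bm_norm f : bm f -> bm (fun x => `|f x|).
Proof.
move=> [mf [M fM]]; split; first exact: measurableT_comp.
by exists M => x; rewrite normr_id.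
Qed.

Lemma bm_exp f : bm f -> bm (fun x => expR (f x)).
Proof.
move=> [mf [M fM]]; split; first exact: measurableT_comp.
exists (expR M) => x; rewrite ger0_norm ?expR_ge0// ler_expR.
exact: le_trans (ler_norm _) (fM x).
Qed.

Lemma bm_indic (A : set T) : measurable A -> bm (\1_A : T -> R).
Proof.
move=> mA; split; first exact: measurable_indic.
by exists 1 => x; rewrite indicE; case: (x \in A); rewrite ?normr1 ?normr0.
Qed.

Variable P : probability T R.

Lemma bm_integrable f : bm f -> P.-integrable setT (EFin \o f).
Proof.
move=> [mf [M fM]].
apply: measurable_bounded_integrable => //.
  by rewrite (le_lt_trans (probability_le1 _ _))// ltry.
exists M; split; first exact: num_real.
by move=> x Mx y _; exact: le_trans (fM y) (ltW Mx).
Qed.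
Hint Resolve bm_integrable : core.

Lemma ExD f g : bm f -> bm g ->
  \int[P]_x (f x + g x) = \int[P]_x f x + \int[P]_x g x.
Proof. by move=> bf bg; apply: RintegralD => //; exact: bm_integrable. Qed.

Lemma ExB f g : bm f -> bm g ->
  \int[P]_x (f x - g x) = \int[P]_x f x - \int[P]_x g x.
Proof. by move=> bf bg; apply: RintegralB => //; exact: bm_integrable. Qed.

Lemma ExZl r f : bm f -> \int[P]_x (r * f x) = r * \int[P]_x f x.
Proof. by move=> bf; apply: RintegralZl => //; exact: bm_integrable. Qed.

Lemma ExZr r f : bm f -> \int[P]_x (f x * r) = (\int[P]_x f x) * r.
Proof. by move=> bf; apply: RintegralZr => //; exact: bm_integrable. Qed.

Lemma Ex_cst r : \int[P]_x r = r.
Proof.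
rewrite Rintegral_cst//.
rewrite -[RHS]mulr1; congr (_ * _); rewrite -[RHS]/(fine 1%E); congr fine; exact: probability_setT.
Qed.

Lemma eq_Ex f g : f =1 g -> \int[P]_x f x = \int[P]_x g x.
Proof. by move=> fg; apply: eq_Rintegral => x _. Qed.

Lemma le_Ex f g : bm f -> bm g -> (forall x, f x <= g x) ->
  \int[P]_x f x <= \int[P]_x g x.
Proof. by move=> bf bg fg; apply: le_Rintegral => //; exact: bm_integrable. Qed.

Lemma Ex_ge0 f : (forall x, 0 <= f x) -> 0 <= \int[P]_x f x.
Proof. by move=> f0; apply: Rintegral_ge0. Qed.

Lemma Ex_sum (I : Type) (s : seq I) (F : I -> T -> R) : (forall i, bm (F i)) ->
  \int[P]_x (\sum_(i <- s) F i x) = \sum_(i <- s) \int[P]_x F i x.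
Proof.
move=> bF; elim: s => [|i s IH].
  by under eq_Ex do rewrite big_nil; rewrite Ex_cst big_nil.
under eq_Ex do rewrite big_cons.
by rewrite ExD// ?IH ?big_cons//; exact: bm_sum.
Qed.

Lemma norm_Ex_le f g : bm f -> bm g -> (forall x, `|f x| <= g x) ->
  `|\int[P]_x f x| <= \int[P]_x g x.
Proof.
move=> bf bg fg; rewrite ler_norml; apply/andP; split.
  rewrite -mulN1r -ExZl//; apply: le_Ex => // [|x].
    by apply: bmM => //; exact: bm_cst.
  by rewrite mulN1r; have := fg x; rewrite ler_norml => /andP[].
by apply: le_Ex => // x; exact: le_trans (ler_norm _) (fg x).
Qed.

Lemma Ex_gt0 f c : bm f -> 0 < c -> (forall x, c <= f x) -> 0 < \int[P]_x f x.
Proof.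
move=> bf c0 cf; apply: (lt_le_trans c0); rewrite -[leLHS]Ex_cst.
by apply: le_Ex => //; exact: bm_cst.
Qed.

Lemma Ex_exp_gt0 f : bm f -> 0 < \int[P]_x expR (f x).
Proof.
move=> bf; have [mf [M fM]] := bf.
apply: (@Ex_gt0 _ (expR (- M))) => [||x]; rewrite ?expR_gt0//.
  exact: bm_exp.
by rewrite ler_expR; have := fM x; rewrite ler_norml => /andP[].
Qed.

Lemma EFin_Ex f : bm f -> (\int[P]_x f x)%:E = (\int[P]_x (f x)%:E)%E.
Proof.
move=> bf; rewrite /Rintegral fineK//.
by apply: integrable_fin_num => //; exact: (bm_integrable bf).
Qed.

End bounded_measurable.

Ltac bmt := repeat first [assumption | apply: bm_cst | apply: bm_exp
  | apply: bmX | apply: bmN | apply: bmD | apply: bmM | apply: bm_norm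
  | (apply: bm_sum; move=> ?)].

Section differentiation.
Context {d : measure_display} {T : measurableType d} {R : realType}.
Variable P : probability T R.

Lemma bm_bound (f : T -> R) : bm f -> exists2 M : R, 0 < M & forall x, `|f x| <= M.
Proof.
move=> [_ [M fM]]; exists (`|M| + 1) => [|x]; first by rewrite ltr_wpDl.
by rewrite (le_trans (fM x))// (le_trans (ler_norm _))// lerDl.
Qed.

Lemma is_derive_Ex_exp (g X : T -> R) (t : R) : bm g -> bm X ->
  is_derive t 1 (fun t => \int[P]_x (g x * expR (t * X x)))
    (\int[P]_x (g x * X x * expR (t * X x))).
Proof.
move=> bg bX.
have [M M0 gM] := bm_bound bg; have [N N0 XN] := bm_bound bX.
pose f t x := g x * expR (t * X x).
have bmf s : bm (f s) by rewrite /f; bmt.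
have df (s : R) (x : T) : is_derive s 1 (f^~ x) (g x * X x * expR (s * X x)).
  rewrite /f; apply: is_derive_eq.
  rewrite /GRing.scale/= mulr0 add0r mulr1; ring.
have tI : `]t - 1, t + 1[%classic t by rewrite /= in_itv/=; lra.
have intf (s : R) : `]t - 1, t + 1[%classic s -> P.-integrable setT (EFin \o f s).
  by move=> _; exact: bm_integrable.
have derf (s : R) (x : T) : `]t - 1, t + 1[%classic s -> setT x -> derivable (f^~ x) s 1.
  by move=> _ _; have [] := df s x.
have d1E (s : R) (x : T) : partial1of2 f s x = g x * X x * expR (s * X x).
  by rewrite partial1of2E; exact: derive_val.
(* Dominates the derivative of the integrand for all [s] at distance less than 1 from [t], where
   [|s| <= |t| + 1]. *)
pose G := M * N * expR ((`|t| + 1) * N).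
have intG : P.-integrable setT (EFin \o (fun _ : T => G)).
  by apply: bm_integrable; exact: bm_cst.
have Gub (s : R) (x : T) : `]t - 1, t + 1[%classic s -> setT x -> `|partial1of2 f s x| <= G.
  rewrite /= in_itv/= => /andP[s1 s2] _.
  rewrite d1E !normrM ler_pM// ?mulr_ge0//; first by rewrite ler_pM.
  rewrite ger0_norm ?expR_ge0// ler_expR (le_trans (ler_norm _))// normrM ler_pM//.
  have : `|s| <= `|t| + `|s - t| by rewrite -{1}(subrKC t s) ler_normD.
  by have : `|s - t| <= 1; [rewrite ler_norml; lra|lra].
have G0 (y : T) : 0 <= G by rewrite /G !mulr_ge0 ?expR_ge0// ltW.
have := @derivable_under_integral R _ T P f setT measurableT t _ _ tI intf derf _ G0 intG Gub.
have := @differentiation_under_integral R _ T P f setT measurableT t _ _ tI intf derf _ G0 intG Gub.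
rewrite derive1E => dE dF; split => //; rewrite dE.
by apply: eq_Rintegral => x _; rewrite -d1E.
Qed.

End differentiation.

(** * Exponential tilts and cumulants *)

Section mean_value.
Context {R : realType}.
Implicit Types (f g : R -> R).

(** The intermediate point is a convex combination of [a] and [b], so that no order between them has
    to be assumed. *)
Lemma mvt_cst f g (a b : R) : (forall x, is_derive x (1 : R) f (g x)) ->
  exists2 t, 0 <= t <= 1 & f b - f a = g (a + t * (b - a)) * (b - a).
Proof.
move=> df.
have cf (x y : R) : {within `[x, y], continuous f}.
  by apply: derivable_within_continuous => z _; have [] := df z.
have [ab|ba|<-] := ltgtP a b; last first.
- by exists 0; rewrite ?lexx ?ler01// !subrr mulr0.
- have [c + E] := MVT ba (fun x _ => df x) (cf _ _).
  rewrite in_itv/= => /andP[bc ca].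
  have ab0 : a - b != 0 by rewrite subr_eq0 gt_eqF.
  exists ((a - c) / (a - b)).
    apply/andP; split; first by rewrite divr_ge0 ?subr_ge0 ?ltW.
    by rewrite ler_pdivrMr ?subr_gt0// mul1r; lra.
  have -> : a + (a - c) / (a - b) * (b - a) = c by field.
  by rewrite -(opprB a b) mulrN -E opprB.
- have [c + E] := MVT ab (fun x _ => df x) (cf _ _).
  rewrite in_itv/= => /andP[ac cb].
  have ba0 : b - a != 0 by rewrite subr_eq0 gt_eqF.
  exists ((c - a) / (b - a)).
    apply/andP; split; first by rewrite divr_ge0 ?subr_ge0 ?ltW.
    by rewrite ler_pdivrMr ?subr_gt0// mul1r; lra.
  have -> : a + (c - a) / (b - a) * (b - a) = c by field.
  exact: E.
Qed.

Lemma lip_of_derive f g K (a b : R) : (forall x, is_derive x (1 : R) f (g x)) ->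
  (forall x, `|g x| <= K) -> `|f b - f a| <= K * `|b - a|.
Proof.
by move=> df gK; have [t _ ->] := mvt_cst a b df; rewrite normrM ler_wpM2r.
Qed.

Lemma taylor1_of_derive f g K (a b : R) :
  (forall x, is_derive x (1 : R) f (g x)) ->
  (forall x y, `|g x - g y| <= K * `|x - y|) -> 0 <= K ->
  `|f b - f a - g a * (b - a)| <= K * (b - a) ^+ 2.
Proof.
move=> df gK K0; have [t /andP[t0 t1] ->] := mvt_cst a b df.
rewrite -mulrBl normrM -(real_normK (num_real (b - a))) expr2 mulrA ler_wpM2r//.
rewrite (le_trans (gK _ _))// ler_wpM2l// addrC addKr normrM ler_piMl//.
by rewrite ger0_norm.
Qed.

(** Once the tangent at [t] and the parabola are subtracted, the derivative has the sign opposite to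
    its argument, so the difference [h] is maximal at 0. *)
Lemma upper_of_derive f g (t s : R) : (forall x, is_derive x (1 : R) f (g x)) ->
  (forall x y, `|g x - g y| <= `|x - y|) ->
  f (t + s) <= f t + s * g t + s ^+ 2 / 2.
Proof.
move=> dfg glip; pose h x := f (t + x) - x * g t - x ^+ 2 / 2.
have dh x : is_derive x (1 : R) h (g (t + x) - g t - x).
  rewrite /h.
  have d1 : is_derive x (1 : R) (fun x => f (t + x)) (g (t + x)).
    have d0 : is_derive (t + x) (1 : R) f (g (t + x)) by exact: dfg.
    have ds : is_derive x (1 : R) (fun x => t + x) 1.
      rewrite -[X in is_derive _ _ _ X]add0r; exact: is_deriveD.
    by have := is_derive1_comp d0 ds; rewrite mulr1.
  by apply: is_derive_eq; rewrite /GRing.scale/=; field.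
have [c /andP[c0 c1]] := mvt_cst 0 s dh.
rewrite /h subr0 !add0r addr0 mul0r expr0n/= mul0r !subr0 => E.
have : (g (t + c * s) - g t - c * s) * s <= 0.
  have := glip (t + c * s) t.
  rewrite addrAC subrr add0r => lip.
  have [s0|s0] := leP 0 s.
    rewrite mulr_le0_ge0// subr_le0 (le_trans (ler_norm _))// (le_trans lip)//.
    by rewrite ger0_norm// mulr_ge0.
  rewrite mulr_ge0_le0 ?(ltW s0)// subr_ge0.
  have cs : c * s <= 0 by rewrite mulr_ge0_le0// ltW.
  by move: lip; rewrite (ler0_norm cs) ler_norml => /andP[+ _]; rewrite opprK.
by rewrite -E; lra.
Qed.

Lemma lower_of_derive f g (a b : R) : (forall x, is_derive x (1 : R) f (g x)) ->
  {homo g : x y / x <= y} -> f a + (b - a) * g a <= f b.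
Proof.
move=> dfg gm; have [t /andP[t0 t1] E] := mvt_cst a b dfg.
rewrite addrC -lerBrDr E mulrC.
have [ab|ba] := leP a b.
  by rewrite ler_wpM2r ?subr_ge0// gm// lerDl mulr_ge0// subr_ge0.
rewrite ler_wnM2r ?subr_le0 ?(ltW ba)// gm// gerDl.
by rewrite mulr_ge0_le0// subr_le0 ltW.
Qed.

Lemma homo_of_derive f g : (forall x, is_derive x (1 : R) f (g x)) ->
  (forall x, 0 <= g x) -> {homo f : x y / x <= y}.
Proof.
move=> dfg g0 x y xy; have [t _ E] := mvt_cst x y dfg.
by rewrite -subr_ge0 E mulr_ge0// subr_ge0.
Qed.

End mean_value.

Section tilt.
Context {d : measure_display} {T : measurableType d} {R : realType}.
Variable P : probability T R.
Implicit Types H f g X : T -> R.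

(** The mean of [f] under the law with density proportional to [expR H], kept as a quotient of
    integrals against [P] so that no new measure has to be built. *)
Definition tilt H f := (\int[P]_x (f x * expR (H x))) / \int[P]_x expR (H x).

Lemma eq_tilt H f g : f =1 g -> tilt H f = tilt H g.
Proof. by move=> fg; congr (_ / _); apply: eq_Ex => x; rewrite fg. Qed.

Section theory.
Variable H : T -> R.
Hypothesis bH : bm H.

Lemma tiltD f g : bm f -> bm g ->
  tilt H (fun x => f x + g x) = tilt H f + tilt H g.
Proof.
move=> bf bg; rewrite /tilt -mulrDl -ExD; [|by bmt..].
by congr (_ / _); apply: eq_Ex => x; rewrite mulrDl.
Qed.

Lemma tiltZ r f : bm f -> tilt H (fun x => r * f x) = r * tilt H f.
Proof.
move=> bf; rewrite /tilt mulrA -ExZl; last by bmt.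
by congr (_ / _); apply: eq_Ex => x; rewrite mulrA.
Qed.

Lemma tiltB f g : bm f -> bm g ->
  tilt H (fun x => f x - g x) = tilt H f - tilt H g.
Proof.
move=> bf bg; rewrite -[- tilt H g]mulN1r -tiltZ// -tiltD//; last by bmt.
by apply: eq_tilt => x; rewrite mulN1r.
Qed.

Lemma tilt_cst r : tilt H (fun=> r) = r.
Proof.
by rewrite /tilt ExZl ?mulfK//; [rewrite gt_eqF// Ex_exp_gt0|bmt].
Qed.

Lemma tilt_sum (I : Type) (s : seq I) (F : I -> T -> R) : (forall i, bm (F i)) ->
  tilt H (fun x => \sum_(i <- s) F i x) = \sum_(i <- s) tilt H (F i).
Proof.
move=> bF; rewrite /tilt -mulr_suml -Ex_sum; last by move=> i; bmt.
by congr (_ / _); apply: eq_Ex => x; rewrite mulr_suml.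
Qed.

Lemma tilt_ge0 f : (forall x, 0 <= f x) -> 0 <= tilt H f.
Proof.
move=> f0; rewrite /tilt divr_ge0//; apply: Ex_ge0 => x; rewrite ?expR_ge0//.
by rewrite mulr_ge0 ?expR_ge0.
Qed.

Lemma le_tilt f g : bm f -> bm g -> (forall x, f x <= g x) ->
  tilt H f <= tilt H g.
Proof.
move=> bf bg fg; rewrite -subr_ge0 -tiltB//; apply: tilt_ge0 => x.
by rewrite subr_ge0.
Qed.

Lemma norm_tilt_le f g : bm f -> bm g -> (forall x, `|f x| <= g x) ->
  `|tilt H f| <= tilt H g.
Proof.
move=> bf bg fg; rewrite ler_norml; apply/andP; split.
  rewrite -mulN1r -tiltZ//; apply: le_tilt => // [|x]; first by bmt.
  by rewrite mulN1r; have := fg x; rewrite ler_norml => /andP[].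
by apply: le_tilt => // x; exact: le_trans (ler_norm _) (fg x).
Qed.

Lemma norm_tilt_le_cst f K : bm f -> (forall x, `|f x| <= K) -> `|tilt H f| <= K.
Proof.
move=> bf fK; rewrite -[leRHS](tilt_cst K).
by apply: norm_tilt_le => //; exact: bm_cst.
Qed.

Definition cov f g := tilt H (fun x => f x * g x) - tilt H f * tilt H g.

Lemma covC f g : cov f g = cov g f.
Proof.
rewrite /cov [tilt H g * _]mulrC; congr (_ - _).
by apply: eq_tilt => x; rewrite mulrC.
Qed.

(** A covariance may be centered at arbitrary points; the correction term vanishes as soon as one of
    them is the mean. *)
Lemma covE f g a b : bm f -> bm g ->
  cov f g = tilt H (fun x => (f x - a) * (g x - b))
            - (tilt H f - a) * (tilt H g - b).
Proof.
move=> bf bg.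
have -> : tilt H (fun x => (f x - a) * (g x - b)) =
    tilt H (fun x => f x * g x) - b * tilt H f - a * tilt H g + a * b.
  rewrite -(tilt_cst (a * b)) -!tiltZ// -!tiltB; [|by bmt..].
  rewrite -tiltD; [|by bmt..].
  by apply: eq_tilt => x; ring.
by rewrite /cov; ring.
Qed.

Lemma cov_le1 f g : bm f -> bm g ->
  (forall x, `|f x| <= 1) -> (forall x, `|g x| <= 1) -> `|cov f g| <= 2.
Proof.
move=> bf bg f1 g1; rewrite /cov (le_trans (ler_normB _ _))//.
have -> : 2 = 1 + 1 * 1 :> R by rewrite mulr1.
rewrite lerD//; last by rewrite normrM ler_pM// norm_tilt_le_cst.
apply: norm_tilt_le_cst => [|x]; first by bmt.
by rewrite normrM -[leRHS]mul1r ler_pM.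
Qed.

Lemma var_ge0 f : bm f -> 0 <= cov f f.
Proof.
move=> bf; rewrite (covE (tilt H f) (tilt H f))// subrr mul0r subr0.
by apply: tilt_ge0 => x; rewrite -expr2 sqr_ge0.
Qed.

Lemma var_le f a : bm f -> cov f f <= tilt H (fun x => (f x - a) ^+ 2).
Proof.
move=> bf; rewrite (covE a a)// -expr2.
have -> : tilt H (fun x => (f x - a) ^+ 2) = tilt H (fun x => (f x - a) * (f x - a)).
  by apply: eq_tilt => x; rewrite expr2.
by rewrite lerBlDr lerDl sqr_ge0.
Qed.

Lemma var_le1 f : bm f -> (forall x, `|f x| <= 1) -> cov f f <= 1.
Proof.
move=> bf f1; apply: (le_trans (var_le 0 bf)); apply: le_trans (ler_norm _) _.
apply: norm_tilt_le_cst => [|x]; first by bmt.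
by rewrite subr0 normrX expr_le1.
Qed.

(** The linear term of the expansion at the mean averages to 0, so exchanging the mean with [f]
    costs only a multiple of the variance. *)
Lemma tilt_taylor (h : T -> R) (f : R -> R) (b K : R) (a := tilt H h) :
  bm h -> bm (fun x => f (h x)) ->
  (forall y, `|f y - f a - b * (y - a)| <= K * (y - a) ^+ 2) ->
  `|tilt H (fun x => f (h x)) - f a| <= K * cov h h.
Proof.
move=> bh bf fT.
have -> : tilt H (fun x => f (h x)) - f a =
    tilt H (fun x => f (h x) - f a - b * (h x - a)).
  rewrite tiltB; [|by bmt..].
  rewrite tiltB; [|by bmt..].
  rewrite tiltZ; [|by bmt..].
  rewrite tiltB; [|by bmt..].
  by rewrite !tilt_cst -/a subrr mulr0 subr0.
rewrite (covE a a)// subrr mul0r subr0 -tiltZ; last by bmt.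
apply: norm_tilt_le => [||x]; [by bmt|by bmt|].
by rewrite -expr2.
Qed.

(** Centering [F \o X] at the value of [F] at the mean of [X], instead of at its own mean, lets the
    Lipschitz bound produce [L] times the variance of [X]. *)
Lemma cov_comp_lip X (F : R -> R) L : bm X -> bm (F \o X) -> 0 <= L ->
  (forall x, `|X x| <= 1) -> (forall a b, `|F a - F b| <= L * `|a - b|) ->
  `|cov X (F \o X)| <= L.
Proof.
move=> bX bF L0 X1 FL; pose a := tilt H X.
rewrite (covE a (F a))// subrr mul0r subr0.
apply: (@le_trans _ _ (tilt H (fun x => L * (X x - a) ^+ 2))).
  apply: norm_tilt_le => [||x]; [by bmt| by bmt|].
  rewrite normrM -(real_normK (num_real (X x - a))) expr2 [leRHS]mulrCA.
  by rewrite ler_wpM2l//= FL.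
rewrite tiltZ; last by bmt.
rewrite ler_piMr// (le_trans _ (var_le1 bX X1))// (covE a a)// subrr mul0r subr0.
by rewrite le_eqVlt; apply/orP; left; apply/eqP/eq_tilt => x; rewrite expr2.
Qed.

Lemma cov_sum (I J : Type) (r : seq I) (s : seq J) (F : I -> T -> R)
    (G : J -> T -> R) : (forall i, bm (F i)) -> (forall j, bm (G j)) ->
  cov (fun x => \sum_(i <- r) F i x) (fun x => \sum_(j <- s) G j x) =
  \sum_(i <- r) \sum_(j <- s) cov (F i) (G j).
Proof.
move=> bF bG; rewrite /cov !tilt_sum// mulr_suml.
under eq_tilt do rewrite mulr_suml.
rewrite tilt_sum; last by move=> i; bmt.
rewrite -sumrB; apply: eq_bigr => i _.
under eq_tilt do rewrite mulr_sumr.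
rewrite tilt_sum; last by move=> j; bmt.
by rewrite mulr_sumr -sumrB.
Qed.

Lemma covZl r f g : bm f -> bm g -> cov (fun x => r * f x) g = r * cov f g.
Proof.
move=> bf bg.
have E : tilt H (fun x => r * f x * g x) = r * tilt H (fun x => f x * g x).
  rewrite -tiltZ; last by bmt.
  by apply: eq_tilt => x; rewrite mulrA.
rewrite /cov E tiltZ//; set a := tilt H _; set b := tilt H _; set c := tilt H _.
by ring.
Qed.

End theory.

Lemma is_derive_tilt H X f t : bm H -> bm X -> bm f ->
  is_derive t (1 : R) (fun t : R => tilt (fun x => H x + t * X x) f)
    (cov (fun x => H x + t * X x) f X).
Proof.
move=> bH bX bf.
pose g (f : T -> R) x := f x * expR (H x).
have bg f' : bm f' -> bm (g f') by move=> bf'; rewrite /g; bmt.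
have tE t' : tilt (fun x => H x + t' * X x) f =
    \int[P]_x (g f x * expR (t' * X x)) / \int[P]_x (g (fun=> 1) x * expR (t' * X x)).
  by congr (_ / _); apply: eq_Ex => x; rewrite /g expRD; ring.
have Z0 : \int[P]_x (g (fun=> 1) x * expR (t * X x)) != 0.
  rewrite gt_eqF//.
  rewrite (_ : Rintegral _ _ _ = \int[P]_x expR (H x + t * X x)).
    by apply: Ex_exp_gt0; bmt.
  by apply: eq_Ex => x; rewrite /g expRD; ring.
have d1 := is_derive_Ex_exp P t (bg _ bf) bX.
have d2 := is_derive_Ex_exp P t (bg _ (bm_cst 1)) bX.
rewrite (_ : (fun _ => _) = fun t' => \int[P]_x (g f x * expR (t' * X x)) /
   \int[P]_x (g (fun=> 1) x * expR (t' * X x))); last by apply/funext.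
have d3 := is_deriveV Z0 d2.
apply: is_derive_eq.
rewrite /cov /tilt /GRing.scale/=.
have E1 : \int[P]_x (f x * X x * expR (H x + t * X x)) =
   \int[P]_x (g f x * X x * expR (t * X x)).
  by apply: eq_Ex => x; rewrite /g expRD; ring.
have E2 : \int[P]_x (X x * expR (H x + t * X x)) =
   \int[P]_x (g (fun=> 1) x * X x * expR (t * X x)).
  by apply: eq_Ex => x; rewrite /g expRD; ring.
have E3 : \int[P]_x (f x * expR (H x + t * X x)) =
   \int[P]_x (g f x * expR (t * X x)).
  by apply: eq_Ex => x; rewrite /g expRD; ring.
have E4 : \int[P]_x (expR (H x + t * X x)) =
   \int[P]_x (g (fun=> 1) x * expR (t * X x)).
  by apply: eq_Ex => x; rewrite /g expRD; ring.
rewrite E1 E2 E3 E4.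
by field.
Qed.

Lemma is_derive_ln_Ex H X t : bm H -> bm X ->
  is_derive t (1 : R) (fun t : R => ln (\int[P]_x expR (H x + t * X x)))
    (tilt (fun x => H x + t * X x) X).
Proof.
move=> bH bX.
have bg : bm (fun x => expR (H x)) by bmt.
have E t' : \int[P]_x expR (H x + t' * X x) =
    \int[P]_x (expR (H x) * expR (t' * X x)).
  by apply: eq_Ex => x; rewrite expRD.
have Z0 : 0 < \int[P]_x expR (H x + t * X x) by apply: Ex_exp_gt0; bmt.
have d2 := is_derive_Ex_exp P t bg bX.
rewrite (_ : (fun _ => _) = @ln R \o (fun t' =>
   \int[P]_x (expR (H x) * expR (t' * X x)))); last first.
  by apply/funext => s /=; rewrite E.
have d1 : is_derive (\int[P]_x (expR (H x) * expR (t * X x))) (1 : R) (@ln R)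
    (\int[P]_x (expR (H x) * expR (t * X x)))^-1.
  by apply: is_derive1_ln; rewrite -E.
apply: is_derive_eq.
rewrite /GRing.scale/= /tilt E; rewrite mulrC; congr (_ * _).
by apply: eq_Ex => x; rewrite expRD; ring.
Qed.

End tilt.

Section cumulant.
Context {d : measure_display} {T : measurableType d} {R : realType}.
Variables (P : probability T R) (X : T -> R).
Hypothesis bX : bm X.
Hypothesis X1 : forall x, `|X x| <= 1.

Definition cumH (t : R) (x : T) : R := t * X x.

Definition cum t := ln (\int[P]_x expR (cumH t x)).

Definition cum1 t := tilt P (cumH t) X.

Definition cum2 t := cov P (cumH t) X X.

(** The third cumulant, in the form given by differentiating E X^2 - (E X)^2. The bound 4 used
    throughout is 2 for the covariance plus 2 for the second term. *)
Definition cum3 t := cov P (cumH t) (fun x => X x ^+ 2) X - 2 * cum1 t * cum2 t.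

Lemma bm_cumH t : bm (cumH t).
Proof. by apply: bmM => //; exact: bm_cst. Qed.
Hint Resolve bm_cumH : core.

Lemma is_derive_tilt_cumH t f : bm f ->
  is_derive t (1 : R) (fun t => tilt P (cumH t) f) (cov P (cumH t) f X).
Proof.
move=> bf; have := is_derive_tilt P t (bm_cst 0) bX bf.
have E s : (fun x => 0 + s * X x) = cumH s by apply/funext => x; rewrite add0r.
rewrite E; have -> // : (fun t => tilt P (fun x => 0 + t * X x) f) =
  fun t => tilt P (cumH t) f by apply/funext => s; rewrite E.
Qed.

Lemma is_derive_cum t : is_derive t (1 : R) cum (cum1 t).
Proof.
have := is_derive_ln_Ex P t (bm_cst 0) bX.
have E s : (fun x => 0 + s * X x) = cumH s by apply/funext => x; rewrite add0r.
rewrite E; have -> // : (fun t => ln (\int[P]_x expR (0 + t * X x))) = cum.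
by apply/funext => s; congr (ln _); apply: eq_Ex => x; rewrite add0r.
Qed.

Lemma is_derive_cum1 t : is_derive t (1 : R) cum1 (cum2 t).
Proof. exact: is_derive_tilt_cumH. Qed.

Lemma is_derive_cum2 t : is_derive t (1 : R) cum2 (cum3 t).
Proof.
have -> : cum2 = fun t => tilt P (cumH t) (fun x => X x ^+ 2) - cum1 t ^+ 2.
  apply/funext => s; rewrite /cum2 /cov /cum1 expr2.
  by congr (_ - _); apply: eq_tilt => x; rewrite expr2.
have d1 := is_derive_tilt_cumH t (bmX 2 bX).
have d2 := is_derive_cum1 t.
apply: is_derive_eq; rewrite /cum3; congr (_ - _).
by rewrite /GRing.scale/=; ring.
Qed.

Lemma cum2_ge0 t : 0 <= cum2 t.
Proof. exact: var_ge0. Qed.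

Lemma cum2_le1 t : cum2 t <= 1.
Proof. exact: var_le1. Qed.

Lemma cum1_norm t : `|cum1 t| <= 1.
Proof. exact: norm_tilt_le_cst. Qed.

Lemma cum3_le t : `|cum3 t| <= 4.
Proof.
rewrite /cum3 (le_trans (ler_normB _ _))//.
have -> : 4 = 2 + 2 * 1 * 1 :> R by ring.
apply: lerD.
  by apply: cov_le1 => //; [exact: bmX|move=> x; rewrite normrX exprn_ile1].
have h1 := cum1_norm t; have h2 := cum2_le1 t; have h3 := cum2_ge0 t.
move: (cum1 t) (cum2 t) h1 h2 h3 => y z h1 h2 h3.
rewrite !normrM (ger0_norm (ler0n _ 2)) (ger0_norm h3).
by apply: ler_pM; rewrite ?mulr_ge0// ler_pM2l.
Qed.

Lemma cum1_lip a b : `|cum1 a - cum1 b| <= `|a - b|.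
Proof.
rewrite -[leRHS]mul1r; apply: (lip_of_derive _ _ is_derive_cum1).
by move=> x; rewrite ger0_norm ?cum2_ge0// cum2_le1.
Qed.

Lemma cum2_lip a b : `|cum2 a - cum2 b| <= 4 * `|a - b|.
Proof. by apply: (lip_of_derive _ _ is_derive_cum2) => x; exact: cum3_le. Qed.

Lemma cum1_taylor a b : `|cum1 b - cum1 a - cum2 a * (b - a)| <= 4 * (b - a) ^+ 2.
Proof.
by apply: (taylor1_of_derive _ _ is_derive_cum1 cum2_lip); rewrite ler0n.
Qed.

(** For a centered variable, the derivative of the cumulant generating function minus its parabola
    is a second-order Taylor remainder at 0; one mean value step adds the third factor [|t|]. *)
Lemma cum_cubic t : \int[P]_x X x = 0 ->
  `|cum t - (\int[P]_x X x ^+ 2) * (t ^+ 2 / 2)| <= 4 * `|t| ^+ 3.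
Proof.
move=> X0; set w := \int[P]_x _.
have e0 f : bm f -> tilt P (cumH 0) f = \int[P]_x f x.
  move=> bf; rewrite /tilt.
  have E g : \int[P]_x (g x * expR (cumH 0 x)) = \int[P]_x g x.
    by apply: eq_Ex => x; rewrite /cumH mul0r expR0 mulr1.
  rewrite E (_ : Rintegral P setT (fun x => expR (cumH 0 x)) = 1) ?divr1//.
  rewrite -[RHS](Ex_cst P).
  by apply: eq_Ex => x; rewrite /cumH mul0r expR0.
have c0 : cum 0 = 0.
  rewrite /cum -[RHS]ln1; congr (ln _); rewrite -[RHS](Ex_cst P).
  by apply: eq_Ex => x; rewrite /cumH mul0r expR0.
have c1 : cum1 0 = 0 by rewrite /cum1 e0.
have c2 : cum2 0 = w.
  rewrite /cum2 /cov -/(cum1 0) c1 mul0r subr0 e0; last by bmt.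
  by apply: eq_Ex => x; rewrite expr2.
pose g s := cum s - w * (s ^+ 2 / 2).
have dg s : is_derive s (1 : R) g (cum1 s - s * w).
  have dc := is_derive_cum s.
  have d3 : is_derive s (1 : R) (fun s => w * (s ^+ 2 / 2)) (s * w).
    by apply: is_derive_eq; rewrite /GRing.scale/=; field.
  exact: is_deriveB.
have [s /andP[s0 s1] E] := mvt_cst 0 t dg.
have g0 : g 0 = 0 by rewrite /g c0 expr0n/= mul0r mulr0 subr0.
rewrite -/(g t); move: E; rewrite g0 !subr0 add0r => ->.
rewrite normrM exprSr mulrA ler_wpM2r//.
have := cum1_taylor 0 (s * t); rewrite c1 c2 !subr0 [w * _]mulrC => /le_trans; apply.
rewrite ler_wpM2l// -(real_normK (num_real (s * t))) lerXn2r ?nnegrE//.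
by rewrite normrM ler_piMl// ger0_norm.
Qed.

End cumulant.

(** * The cumulant generating function of the base measure *)

Section clip.
Context {R : realType}.

Definition clip (x : R) : R := Num.max (-1) (Num.min x 1).

Lemma clip_norm x : `|clip x| <= 1.
Proof.
by rewrite /clip ler_norml le_max lexx/= ge_max ge_min lexx orbT andbT; lra.
Qed.

Lemma clip_id x : -1 <= x <= 1 -> clip x = x.
Proof. by move=> /andP[h1 h2]; rewrite /clip min_l// max_r. Qed.

Lemma measurable_clip : measurable_fun setT clip.
Proof. by apply: measurable_maxr => //; exact: measurable_minr. Qed.

Lemma bm_clip : bm (clip : measurableTypeR R -> R).
Proof. by split; [exact: measurable_clip|exists 1 => x; exact: clip_norm]. Qed.

End clip.

Lemma ivt_between {R : realType} (f : R -> R) a b z : continuous f ->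
  f a <= z <= f b -> exists t, f t = z.
Proof.
move=> cf /andP[az zb].
have cf' (x y : R) : {within `[x, y], continuous f} by exact: continuous_subspaceT.
have [ab|ba] := leP a b.
  have [|c _ <-] := @IVT R f _ _ z ab (cf' _ _); last by exists c.
  by rewrite ge_min az le_max zb orbT.
have [|c _ <-] := @IVT R f _ _ z (ltW ba) (cf' _ _); last by exists c.
by rewrite ge_min az orbT le_max zb.
Qed.

Section positivity.
Context {d : measure_display} {T : measurableType d} {R : realType}.
Variable P : probability T R.

Lemma Ex_indic (A : set T) : measurable A -> \int[P]_x \1_A x = fine (P A).
Proof. by move=> mA; rewrite /Rintegral integral_indic// setIT. Qed.

Lemma Ex_gt0_on (f : T -> R) c (A : set T) : bm f -> (forall x, 0 <= f x) ->
  0 < c -> measurable A -> (0 < P A)%E -> (forall x, A x -> c <= f x) ->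
  0 < \int[P]_x f x.
Proof.
move=> bf f0 c0 mA PA cf; apply: (@lt_le_trans _ _ (c * fine (P A))).
  rewrite mulr_gt0// fine_gt0// PA/= (le_lt_trans (probability_le1 _ _))//.
  by rewrite ltry.
rewrite -Ex_indic// -ExZl; last exact: bm_indic.
apply: le_Ex => // [|x]; first by apply: bmM; [exact: bm_cst|exact: bm_indic].
rewrite indicE; case: (boolP (x \in A)) => [|_]; rewrite ?mulr0//.
by rewrite mulr1 inE => /cf.
Qed.

Lemma measurable_gt_cst (f : T -> R) a : measurable_fun setT f ->
  measurable [set x | a < f x].
Proof.
move=> mf; rewrite (_ : [set _ | _] = setT `&` f @^-1` `]a, +oo[%classic).
  by apply: mf => //; exact: measurable_itv.
by rewrite setTI; apply/seteqP; split => x /=; rewrite in_itv/= andbT.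
Qed.

(** For large [t] the tilt concentrates where [Y] is close to its supremum: the part below 1 - e/2
    weighs at most exp(t (1 - e/2)), against a partition function of at least p exp(t (1 - e/4)). *)
Lemma tilt_near_max (Y : T -> R) (e : R) : bm Y -> (forall x, `|Y x| <= 1) ->
  (forall e, 0 < e -> (0 < P [set x | 1 - e < Y x]%R)%E) -> 0 < e ->
  exists t, 1 - e < tilt P (fun x => t * Y x) Y.
Proof.
move=> bY Y1 supY e0; pose A := [set x | 1 - e / 4 < Y x].
have mA : measurable A by apply: measurable_gt_cst; case: bY.
have PA0 : (0 < P A)%E by apply: supY; lra.
pose p := fine (P A).
have p0 : 0 < p.
  by rewrite fine_gt0// PA0/= (le_lt_trans (probability_le1 _ _))// ltry.
(* Chosen so that [t * e / 4] equals [4 / (e * p)]; then 1 + x <= exp x already makes the ratio of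
   the two weights small enough. *)
pose t := 4 / e * (4 / (e * p)).
have t0 : 0 < t by rewrite /t !mulr_gt0 ?invr_gt0 ?mulr_gt0.
exists t.
have tY : bm (fun x => t * Y x) by bmt.
pose Z := \int[P]_x expR (t * Y x).
have Z0 : 0 < Z by exact: Ex_exp_gt0.
have ZA : p * expR (t * (1 - e / 4)) <= Z.
  rewrite /p -Ex_indic// -ExZr; last exact: bm_indic.
  apply: le_Ex => [||x]; [|by bmt|].
    by apply: bmM; [exact: bm_indic|exact: bm_cst].
  rewrite indicE; case: (boolP (x \in A)) => [|_]; rewrite ?mul0r ?expR_ge0//.
  by rewrite mul1r inE /A/= => /ltW h; rewrite ler_expR ler_pM2l.
have key : \int[P]_x ((1 - Y x) * expR (t * Y x)) <=
    e / 2 * Z + 2 * expR (t * (1 - e / 2)).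
  rewrite -[X in _ + X](Ex_cst P) -ExZl; last by bmt.
  rewrite -ExD; [|by bmt..].
  apply: le_Ex => [||x]; [by bmt|by bmt|].
  have := Y1 x; rewrite ler_norml => /andP[Y1x Y2x].
  have := expR_gt0 (t * Y x); have := expR_gt0 (t * (1 - e / 2)) => h1 h2.
  have [Yx|Yx] := leP (1 - e / 2) (Y x).
    apply: (@le_trans _ _ (e / 2 * expR (t * Y x))); last by lra.
    by rewrite ler_pM2r//; lra.
  have h3 : expR (t * Y x) <= expR (t * (1 - e / 2)).
    by rewrite ler_expR ler_pM2l// ltW.
  have h4 : 0 <= e / 2 * expR (t * Y x) by rewrite mulr_ge0// ?ltW//; lra.
  have h5 : (1 - Y x) * expR (t * Y x) <= 2 * expR (t * (1 - e / 2)).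
    by apply: ler_pM; rewrite ?expR_ge0//; lra.
  by rewrite (le_trans h5)// lerDr.
have tl : tilt P (fun x => t * Y x) Y =
    1 - (\int[P]_x ((1 - Y x) * expR (t * Y x))) / Z.
  have := tiltB P tY (bm_cst 1) bY; rewrite tilt_cst// => E.
  by rewrite -[LHS](subKr 1) -E.
rewrite tl ltrD2l ltrN2 ltr_pdivrMr//.
apply: (le_lt_trans key).
have : 2 * expR (t * (1 - e / 2)) < e / 2 * (p * expR (t * (1 - e / 4))).
  have -> : t * (1 - e / 4) = t * (1 - e / 2) + t * e / 4 by field.
  rewrite expRD.
  have h := expR_gt0 (t * (1 - e / 2)).
  have h2 : 4 / (e * p) < expR (t * e / 4).
    apply: lt_le_trans (expR_ge1Dx _).
    have -> : t * e / 4 = 4 / (e * p) by rewrite /t; field; rewrite !gt_eqF.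
    by rewrite ltrDr.
  rewrite [ltRHS](_ : _ = expR (t * (1 - e / 2)) *
     (e * p / 2 * expR (t * e / 4))); last by ring.
  rewrite mulrC ltr_pM2l//.
  apply: (@le_lt_trans _ _ (e * p / 2 * (4 / (e * p)))).
    by rewrite le_eqVlt; apply/orP; left; apply/eqP; field; rewrite !gt_eqF.
  by rewrite ltr_pM2l// !mulr_gt0.
have : e / 2 * (p * expR (t * (1 - e / 4))) <= e / 2 * Z.
  by rewrite ler_pM2l//; lra.
by set a := e / 2 * (p * _); lra.
Qed.

End positivity.

Section psi.
Context {R : realType}.
Variable mu : probability (measurableTypeR R) R.
Hypothesis hmu : base_measure mu.

Lemma integral_clip (f : R -> R) : measurable_fun setT f ->
  (\int[mu]_z (f z)%:E = \int[mu]_z (f (clip z))%:E)%E.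
Proof.
move=> mf; have [mu0 _ _ _] := hmu.
apply: ae_eq_integral => //.
- exact/measurable_EFinP.
- apply/measurable_EFinP; apply: (measurableT_comp mf); exact: measurable_clip.
- exists (~` `[-1, 1]%classic); split => //.
    by apply: measurableC; exact: measurable_itv.
  move=> x /= h hx; apply: h => _; rewrite clip_id//.
Qed.

Definition psiH : R -> measurableTypeR R -> R := cumH clip.

Lemma bm_psiH t : bm (psiH t).
Proof. by apply: bm_cumH; exact: bm_clip. Qed.

Lemma psiE : psi mu = cum mu clip.
Proof.
apply/funext => t.
rewrite /psi /Rintegral (integral_clip (f := fun z => expR (t * z)))//.
by apply: measurableT_comp => //; exact: measurable_funM.
Qed.

Definition tm t := tilt mu (psiH t).

Let is_derive_psi t : is_derive t (1 : R) (psi mu) (cum1 mu clip t).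
Proof. by rewrite psiE; apply: is_derive_cum; exact: bm_clip. Qed.

Lemma psi1_cum : psi1 mu = cum1 mu clip.
Proof.
by apply/funext => t; rewrite /psi1 derive1E; have [_ ->] := is_derive_psi t.
Qed.

Lemma psi1E t : psi1 mu t = tm t clip.
Proof. by rewrite psi1_cum. Qed.

Lemma psi2_cum : psi2 mu = cum2 mu clip.
Proof.
apply/funext => t; rewrite /psi2 derive1nS derive1n1 -/(psi1 mu) psi1_cum derive1E.
by have [_ ->] := is_derive_cum1 mu bm_clip t.
Qed.

Lemma psi2E t : psi2 mu t = cov mu (psiH t) clip clip.
Proof. by rewrite psi2_cum. Qed.

Lemma is_derive_psi' t : is_derive t (1 : R) (psi mu) (psi1 mu t).
Proof. by rewrite psi1_cum. Qed.

Lemma is_derive_psi1' t : is_derive t (1 : R) (psi1 mu) (psi2 mu t).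
Proof. by rewrite psi1_cum psi2_cum; exact: (is_derive_cum1 mu bm_clip). Qed.

Lemma is_derive_psi2 t : is_derive t (1 : R) (psi2 mu) (cum3 mu clip t).
Proof. by rewrite psi2_cum; exact: (is_derive_cum2 mu bm_clip). Qed.

Lemma psi2_ge0 t : 0 <= psi2 mu t.
Proof. by rewrite psi2_cum; exact: (cum2_ge0 mu bm_clip). Qed.

Lemma psi2_le1 t : psi2 mu t <= 1.
Proof. by rewrite psi2_cum; exact: (cum2_le1 mu bm_clip (@clip_norm R)). Qed.

Lemma psi1_norm t : `|psi1 mu t| <= 1.
Proof. by rewrite psi1_cum; exact: (cum1_norm mu bm_clip (@clip_norm R)). Qed.

Lemma psi1_lip a b : `|psi1 mu a - psi1 mu b| <= `|a - b|.
Proof. by rewrite psi1_cum; exact: (cum1_lip mu bm_clip (@clip_norm R)). Qed.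

Lemma psi2_lip a b : `|psi2 mu a - psi2 mu b| <= 4 * `|a - b|.
Proof. by rewrite psi2_cum; exact: (cum2_lip mu bm_clip (@clip_norm R)). Qed.

Lemma psi1_taylor a b :
  `|psi1 mu b - psi1 mu a - psi2 mu a * (b - a)| <= 4 * (b - a) ^+ 2.
Proof.
by rewrite psi1_cum psi2_cum; exact: (cum1_taylor mu bm_clip (@clip_norm R)).
Qed.

Lemma continuous_psi1 : continuous (psi1 mu).
Proof.
move=> x; apply: differentiable_continuous; apply/derivable1_diffP.
by have [] := is_derive_psi1' x.
Qed.

Lemma continuous_psi2 : continuous (psi2 mu).
Proof.
move=> x; apply: differentiable_continuous; apply/derivable1_diffP.
by have [] := is_derive_psi2 x.
Qed.

Lemma bm_psi1 : bm (psi1 mu : measurableTypeR R -> R).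
Proof.
split; first by apply: continuous_measurable_fun; exact: continuous_psi1.
by exists 1 => x; exact: psi1_norm.
Qed.

Lemma bm_psi2 : bm (psi2 mu : measurableTypeR R -> R).
Proof.
split; first by apply: continuous_measurable_fun; exact: continuous_psi2.
by exists 1 => x; rewrite ger0_norm ?psi2_ge0// psi2_le1.
Qed.

Lemma mu_gt e : 0 < e -> (0 < mu [set x | 1 - e < clip x]%R)%E.
Proof.
move=> e0; have [_ _ s1 _] := hmu.
(* The radius is cut at 1 to keep the interval to the right of 0, where the lower truncation at -1
   does not act. *)
apply: (lt_le_trans (s1 (Num.min e 1) _)); first by rewrite lt_min e0 ltr01.
apply: le_measure; rewrite ?inE; first exact: measurable_itv.
  by apply: measurable_gt_cst; exact: measurable_clip.
move=> x /=; rewrite in_itv/= => /andP[h1 h2].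
have : Num.min e 1 <= e by rewrite ge_min lexx.
have : Num.min e 1 <= 1 by rewrite ge_min lexx orbT.
rewrite /clip => h3 h4.
have [x1|x1] := leP x 1.
  rewrite max_r; lra.
by rewrite max_r; lra.
Qed.

Lemma mu_lt e : 0 < e -> (0 < mu [set x | 1 - e < - clip x]%R)%E.
Proof.
move=> e0; have [_ s1 _ _] := hmu.
apply: (lt_le_trans (s1 (Num.min e 1) _)); first by rewrite lt_min e0 ltr01.
apply: le_measure; rewrite ?inE; first exact: measurable_itv.
  by apply: measurable_gt_cst; have [] := bmN (@bm_clip R).
move=> x /=; rewrite in_itv/= => /andP[h1 h2].
have : Num.min e 1 <= e by rewrite ge_min lexx.
have : Num.min e 1 <= 1 by rewrite ge_min lexx orbT.
rewrite /clip => h3 h4.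
rewrite min_l; last by lra.
by have [x1|x1] := leP (-1) x; lra.
Qed.

Lemma tm_gt0 t f c (A : set R) : bm (f : measurableTypeR R -> R) ->
  (forall x, 0 <= f x) -> 0 < c -> measurable (A : set (measurableTypeR R)) ->
  (0 < mu A)%E -> (forall x, A x -> c <= f x) -> 0 < tm t f.
Proof.
move=> bf f0 c0 mA PA cf; rewrite /tm /tilt divr_gt0//; last first.
  by apply: Ex_exp_gt0; exact: bm_psiH.
apply: (@Ex_gt0_on _ (measurableTypeR R) _ mu
  (fun x => f x * expR (psiH t x)) (c * expR (- `|t|)) A) => //.
- by apply: bmM => //; apply: bm_exp; exact: bm_psiH.
- by move=> x; rewrite mulr_ge0 ?expR_ge0.
- by rewrite mulr_gt0 ?expR_gt0.
- move=> x Ax; apply: ler_pM; [exact: ltW|exact: expR_ge0|exact: cf|].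
  rewrite ler_expR /psiH lerNl (le_trans (ler_norm _))// normrN normrM.
  by rewrite ler_piMr// clip_norm.
Qed.

(** Both endpoints carry mass, and whatever the sign of the mean [a], the endpoint on the other side
    has a neighbourhood of positive mass at distance at least 1/2 from [a]. *)
Lemma psi2_gt0 t : 0 < psi2 mu t.
Proof.
have bX := @bm_clip R.
rewrite psi2E; set a := tilt mu (psiH t) clip.
rewrite (covE _ (bm_psiH t) a a)// subrr mul0r subr0.
have [a0|a0] := leP a 0.
  apply: (tm_gt0 _ (c := 1 / 4) (A := [set x | 1 - 1 / 2 < clip x])).
  - by bmt.
  - by move=> x; rewrite -expr2 sqr_ge0.
  - by lra.
  - by apply: measurable_gt_cst; case: bX.
  - by apply: mu_gt; lra.
  - by move=> x /= h; nra.
apply: (tm_gt0 _ (c := 1 / 4) (A := [set x | 1 - 1 / 2 < - clip x])).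
- by bmt.
- by move=> x; rewrite -expr2 sqr_ge0.
- by lra.
- by apply: measurable_gt_cst; have [] := bmN bX.
- by apply: mu_lt; lra.
- by move=> x /= h; nra.
Qed.

Lemma psi1_lt1 t : psi1 mu t < 1.
Proof.
have bX := @bm_clip R.
rewrite -subr_gt0 psi1E /tm -[X in X - _](tilt_cst mu (bm_psiH t)).
rewrite -tiltB; [|exact: bm_psiH|by bmt..].
apply: (tm_gt0 _ (c := 1) (A := [set x | 1 - 1 < - clip x])).
- by bmt.
- by move=> x; have := clip_norm x; rewrite ler_norml subr_ge0 => /andP[].
- by [].
- by apply: measurable_gt_cst; have [] := bmN bX.
- exact: mu_lt.
- by move=> x /= h; lra.
Qed.

Lemma psi1_gtN1 t : -1 < psi1 mu t.
Proof.
have bX := @bm_clip R.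
rewrite -subr_gt0 psi1E /tm -[X in _ - X](tilt_cst mu (bm_psiH t)).
rewrite -tiltB; [|exact: bm_psiH|by bmt..].
apply: (tm_gt0 _ (c := 1) (A := [set x | 1 - 1 < clip x])).
- by bmt.
- by move=> x; have := clip_norm x; rewrite ler_norml subr_ge0 => /andP[].
- by [].
- by apply: measurable_gt_cst; case: bX.
- exact: mu_gt.
- by move=> x /= h; lra.
Qed.

(** Strong tilts towards the two endpoints push the mean beyond [|z|] and below [- |z|]; the
    intermediate value theorem does the rest. *)
Lemma psi1_surj z : `|z| < 1 -> exists t, psi1 mu t = z.
Proof.
move=> z1; have e0 : 0 < 1 - `|z| by rewrite subr_gt0.
have [t ht] := tilt_near_max bm_clip (@clip_norm R) mu_gt e0.
have Nc x : `|- clip x| <= 1 :> R by rewrite normrN clip_norm.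
have [s hs] := tilt_near_max (bmN bm_clip) Nc mu_lt e0.
have ht' : `|z| < psi1 mu t by move: ht; rewrite subKr psi1E.
have hs' : psi1 mu (- s) < - `|z|.
  have bX := @bm_clip R.
  move: hs; rewrite subKr.
  have -> : tilt mu (fun x => s * - clip x) (fun x => - clip x) = - psi1 mu (- s).
    rewrite psi1E /tm (_ : psiH (- s) = fun x => s * - clip x); last first.
      by apply/funext => x; rewrite /psiH/cumH mulrN mulNr.
    rewrite -mulN1r -tiltZ; [|by bmt..].
    by apply: eq_tilt => x; rewrite mulN1r.
  by rewrite ltrNr.
have zb : psi1 mu (- s) <= z <= psi1 mu t.
  rewrite (le_trans (ltW hs'))/=; last by rewrite lerNl -normrN ler_norm.
  by rewrite (le_trans (ler_norm z))// ltW.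
exact: (ivt_between continuous_psi1 zb).
Qed.

Lemma psi_upper t s : psi mu (t + s) <= psi mu t + s * psi1 mu t + s ^+ 2 / 2.
Proof. exact: (upper_of_derive _ _ is_derive_psi' psi1_lip). Qed.

Lemma psi1_homo : {homo psi1 mu : x y / x <= y}.
Proof. exact: (homo_of_derive is_derive_psi1' psi2_ge0). Qed.

Lemma psi_lower a b : psi mu a + (b - a) * psi1 mu a <= psi mu b.
Proof. exact: (lower_of_derive _ _ is_derive_psi' psi1_homo). Qed.

End psi.

(** * Contractions *)

Section vectors.
Context {R : realType}.

Lemma mx_norm_le m n (x : 'M[R]_(m, n)) e : 0 <= e ->
  (forall i j, `|x i j| <= e) -> `|x| <= e.
Proof.
move=> e0 xe; rewrite [`|x|]mx_normrE.
by apply: bigmax_le => // -[i j] _; exact: xe.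
Qed.

Lemma le_mx_norm m n (x : 'M[R]_(m, n)) i j : `|x i j| <= `|x|.
Proof.
rewrite [leRHS]mx_normrE.
exact: (le_bigmax _ (fun ij : 'I_m * 'I_n => `|x ij.1 ij.2|) (i, j)).
Qed.

Definition nrm n (x : 'I_n -> R) : R := Num.sqrt (\sum_i x i ^+ 2).

Lemma nrm_ge0 n (x : 'I_n -> R) : 0 <= nrm x.
Proof. exact: sqrtr_ge0. Qed.

Lemma sumsq_ge0 n (x : 'I_n -> R) : 0 <= \sum_i x i ^+ 2.
Proof. by apply: sumr_ge0 => i _; exact: sqr_ge0. Qed.

Lemma nrm_sqr n (x : 'I_n -> R) : nrm x ^+ 2 = \sum_i x i ^+ 2.
Proof. by rewrite sqr_sqrtr// sumsq_ge0. Qed.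

Lemma cauchy_schwarz n (x y : 'I_n -> R) :
  (\sum_i x i * y i) ^+ 2 <= (\sum_i x i ^+ 2) * (\sum_i y i ^+ 2).
Proof.
set C := \sum_i _ * _; set X := \sum_i _; set Y := \sum_i _.
have Y0 : 0 <= Y by exact: sumsq_ge0.
have : 0 <= Y * (Y * X - C ^+ 2).
  have -> : Y * (Y * X - C ^+ 2) = \sum_i (Y * x i - C * y i) ^+ 2.
    rewrite (eq_bigr (fun i => Y ^+ 2 * (x i ^+ 2) - 2 * Y * C * (x i * y i)
      + C ^+ 2 * y i ^+ 2)); last by move=> i _; ring.
    rewrite big_split/= sumrB -!mulr_sumr -/X -/Y -/C; ring.
  exact: sumsq_ge0.
have [Ygt|Yle] := ltP 0 Y; first by rewrite pmulr_rge0// subr_ge0 mulrC.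
move=> _; have Y00 : Y = 0 by apply/eqP; rewrite eq_le Yle Y0.
have y0 i : y i = 0.
  have /eqP := Y00; rewrite psumr_eq0; last by move=> j _; exact: sqr_ge0.
  by move=> /allP/(_ i (mem_index_enum i)); rewrite implyTb sqrf_eq0 => /eqP.
by rewrite /C big1 ?expr0n ?mulr_ge0 ?sumsq_ge0// => i _; rewrite y0 mulr0.
Qed.

Lemma norm_sum_le n (x y : 'I_n -> R) : `|\sum_i x i * y i| <= nrm x * nrm y.
Proof.
rewrite -(@ler_pXn2r _ 2)// ?nnegrE ?normr_ge0 ?mulr_ge0 ?nrm_ge0//.
by rewrite real_normK ?num_real// exprMn !nrm_sqr cauchy_schwarz.
Qed.

Lemma nrm_le n (x : 'I_n -> R) b : 0 <= b -> \sum_i x i ^+ 2 <= b ^+ 2 -> nrm x <= b.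
Proof. by move=> b0 h; rewrite -(ger0_norm b0) -sqrtr_sqr ler_wsqrtr. Qed.

Lemma sumsq_sq_le n (x : 'I_n -> R) B : (forall i, x i ^+ 2 <= B) ->
  \sum_i x i ^+ 2 <= n%:R * B.
Proof.
move=> xB; apply: (@le_trans _ _ (\sum_(i < n) B)); first exact: ler_sum.
by rewrite sumr_const card_ord mulr_natl.
Qed.

End vectors.

Section contraction.
Context {R : realType} (n : nat) (A : 'I_n -> 'I_n -> R) (rho : R).
Hypothesis symA : forall i j, A i j = A j i.
Hypothesis rowA : forall i, \sum_j `|A i j| <= rho.
Hypothesis rho0 : 0 <= rho.
Hypothesis rho1 : rho < 1.
Implicit Types b y : 'I_n -> R.

Definition app (x : 'I_n -> R) i := \sum_j A i j * x j.

Lemma app_le x i : `|app x i| <= \sum_j `|A i j| * `|x j|.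
Proof.
by rewrite (le_trans (ler_norm_sum _ _ _))// ler_sum// => j _; rewrite normrM.
Qed.

Lemma app_sym x y : \sum_i x i * app y i = \sum_i app x i * y i.
Proof.
rewrite /app; under eq_bigr do rewrite mulr_sumr.
rewrite exchange_big/=; apply: eq_bigr => i _; rewrite mulr_suml.
by apply: eq_bigr => j _; rewrite symA; ring.
Qed.

(** Jensen's inequality for the square, with weight [1 - rho] on [|b i| / (1 - rho)] and weights
    [|A i j|] on [|y j|]. The weights sum to at most 1 only, hence the argument by completing
    squares around [m]. *)
Lemma jensen_sq b y i : `|y i| <= `|b i| + \sum_j `|A i j| * `|y j| ->
  y i ^+ 2 <= b i ^+ 2 / (1 - rho) + \sum_j `|A i j| * y j ^+ 2.
Proof.
set s := \sum_j _ => yi; set m := `|b i| + s.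
have s0 : 0 <= s by apply: sumr_ge0 => j _; rewrite mulr_ge0.
have r1 : 0 < 1 - rho by rewrite subr_gt0.
apply: (@le_trans _ _ (m ^+ 2)).
  by rewrite -(real_normK (num_real (y i))) ler_pXn2r// nnegrE ?normr_ge0// addr_ge0.
have h1 : 2 * m * s - rho * m ^+ 2 <= \sum_j `|A i j| * y j ^+ 2.
  apply: (@le_trans _ _ (2 * m * s - (\sum_j `|A i j|) * m ^+ 2)).
    by rewrite lerD2l lerN2 ler_wpM2r// sqr_ge0.
  rewrite /s mulr_sumr mulr_suml -sumrB; apply: ler_sum => j _.
  rewrite -(real_normK (num_real (y j))) -subr_ge0.
  rewrite (_ : _ - _ = `|A i j| * (`|y j| - m) ^+ 2); last by ring.
  by rewrite mulr_ge0// sqr_ge0.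
have h2 : 2 * m * `|b i| - (1 - rho) * m ^+ 2 <= b i ^+ 2 / (1 - rho).
  rewrite -(real_normK (num_real (b i))) -subr_ge0.
  rewrite (_ : _ - _ = (`|b i| - (1 - rho) * m) ^+ 2 / (1 - rho)).
    by rewrite divr_ge0 ?sqr_ge0// ltW.
  by field; rewrite gt_eqF.
have -> : m ^+ 2 = (2 * m * `|b i| - (1 - rho) * m ^+ 2) + (2 * m * s - rho * m ^+ 2).
  by rewrite /m; ring.
exact: lerD.
Qed.

Lemma sum_row_le y : (forall j, 0 <= y j) ->
  \sum_i \sum_j `|A i j| * y j <= rho * \sum_j y j.
Proof.
move=> y0; rewrite exchange_big/= mulr_sumr; apply: ler_sum => j _.
rewrite -mulr_suml ler_wpM2r//.
by under eq_bigr do rewrite symA.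
Qed.

(** By symmetry the columns of [|A|] also sum to at most [rho], so summing [jensen_sq] over the
    sites lets the right-hand sum be absorbed. The hypothesis is a pointwise domination, which suits
    nonlinear fixed points. *)
Lemma contraction_sq b y :
  (forall i, `|y i| <= `|b i| + \sum_j `|A i j| * `|y j|) ->
  \sum_i y i ^+ 2 <= (\sum_i b i ^+ 2) / (1 - rho) ^+ 2.
Proof.
move=> yb; have r1 : 0 < 1 - rho by rewrite subr_gt0.
have : \sum_i y i ^+ 2 <= (\sum_i b i ^+ 2) / (1 - rho) + rho * \sum_i y i ^+ 2.
  apply: (@le_trans _ _ (\sum_i (b i ^+ 2 / (1 - rho) + \sum_j `|A i j| * y j ^+ 2))).
    by apply: ler_sum => i _; exact: jensen_sq.
  rewrite big_split/= -mulr_suml lerD2l sum_row_le// => j.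
  exact: sqr_ge0.
rewrite -lerBlDr -{1}[\sum_i y i ^+ 2]mul1r -mulrBl mulrC -ler_pdivlMr//.
by rewrite expr2 invfM mulrA.
Qed.

(** By [jensen_sq] the squares of [y] obey a recursion of the same form, with source
    [b i ^+ 2 / (1 - rho)]; the l2 bound is applied to them. *)
Lemma contraction_pow4 b y :
  (forall i, `|y i| <= `|b i| + \sum_j `|A i j| * `|y j|) ->
  \sum_i y i ^+ 4 <= (\sum_i b i ^+ 4) / (1 - rho) ^+ 4.
Proof.
move=> yb; have r1 : 0 < 1 - rho by rewrite subr_gt0.
have h := @contraction_sq (fun i => b i ^+ 2 / (1 - rho)) (fun i => y i ^+ 2).
have E i (z : 'I_n -> R) : z i ^+ 4 = (z i ^+ 2) ^+ 2 by rewrite -exprM.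
under eq_bigr do rewrite E.
apply: (le_trans (h _)) => [i|].
  rewrite ger0_norm ?sqr_ge0// ger0_norm; last by rewrite divr_ge0 ?sqr_ge0// ltW.
  rewrite (le_trans (jensen_sq (yb i)))// lerD2l; apply: ler_sum => j _.
  by rewrite [`|y j ^+ 2|]ger0_norm ?sqr_ge0.
under eq_bigr do rewrite exprMn -exprM exprVn.
rewrite -mulr_suml -mulrA -invfM -exprD.
by [].
Qed.

(** At a coordinate where [|y|] is maximal, the sum is at most [rho] times that maximum. *)
Lemma contraction_sup b y B : (forall i, `|b i| <= B) ->
  (forall i, `|y i| <= `|b i| + \sum_j `|A i j| * `|y j|) ->
  forall i, `|y i| <= B / (1 - rho).
Proof.
move=> bB yb i; have r1 : 0 < 1 - rho by rewrite subr_gt0.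
have [k _ hk] := @arg_maxP _ _ _ i predT (fun j => `|y j|) isT.
apply: (le_trans (hk i isT)); rewrite /= in hk *.
rewrite ler_pdivlMr// mulrC mulrBl mul1r lerBlDr.
apply: (le_trans (yb k)); rewrite lerD//.
apply: (@le_trans _ _ (\sum_j `|A k j| * `|y k|)).
  by apply: ler_sum => j _; rewrite ler_wpM2l//; exact: hk.
by rewrite -mulr_suml ler_wpM2r.
Qed.

End contraction.

(** * The mean-field optimizer *)

HB.instance Definition _ (R : realType) (m n : nat) :=
  Complete.on 'M[R]_(m, n).

Section fixpoint.
Context {R : realType} (n : nat) (A : 'I_n -> 'I_n -> R) (rho : R).
Hypothesis rowA : forall i, \sum_j `|A i j| <= rho.
Hypothesis rho0 : 0 <= rho.
Hypothesis rho1 : rho < 1.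

(** In the sup norm the map contracts by the factor [rho], since [f] is 1-Lipschitz, and Banach's
    theorem applies. *)
Lemma meanfield_fixpoint (f : R -> R) (c : 'I_n -> R) :
  (forall a b, `|f a - f b| <= `|a - b|) ->
  exists u : 'I_n -> R, forall i, u i = f (app A u i + c i).
Proof.
move=> fl.
pose T (z : 'cV[R]_n) : 'cV[R]_n := \col_i f (app A (fun j => z j 0) i + c i).
pose F : {fun [set: 'cV[R]_n] >-> [set: 'cV[R]_n]} := [fun of totalfun T].
have ctr : is_contraction F.
  exists (NngNum rho0); split => //= -[x y] /= _.
  apply: mx_norm_le => [|i j]; first by rewrite mulr_ge0.
  rewrite !mxE; apply: (le_trans (fl _ _)).
  rewrite opprD addrACA subrr addr0 /app -sumrB.
  apply: (@le_trans _ _ (\sum_k `|A i k| * `|x - y|)).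
    rewrite (le_trans (ler_norm_sum _ _ _))// ler_sum// => k _.
    rewrite -mulrBr normrM ler_wpM2l//.
    by have := le_mx_norm (x - y) k 0; rewrite !mxE.
  by rewrite -mulr_suml ler_wpM2r.
have [p _ pE] := banach_fixed_point ctr (@closedT _) (ex_intro _ (0 : 'cV[R]_n) I).
exists (fun i => p i 0) => i.
by rewrite {1}pE mxE.
Qed.

End fixpoint.

Section optimizer.
Context {R : realType}.
Variable mu : probability (measurableTypeR R) R.
Hypothesis hmu : base_measure mu.

Lemma rate_intE z : rate_int mu z = z * phi mu z - psi mu (phi mu z).
Proof. by []. Qed.

Lemma psi1_phi z : `|z| < 1 -> psi1 mu (phi mu z) = z.
Proof. by move=> /(psi1_surj hmu) h; exact: (@getPex _ [set t | psi1 mu t = z]). Qed.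

Opaque psi psi1 psi2 phi rate_int.

(** The Fenchel-Young inequality: the convex function [psi] lies above its tangent at [phi z]. *)
Lemma le_rate_int z t : `|z| < 1 -> t * z - psi mu t <= rate_int mu z.
Proof.
move=> /psi1_phi zE; have := psi_lower hmu (phi mu z) t.
rewrite zE rate_intE.
by move: (psi mu (phi mu z)) (phi mu z) (psi mu t) => a b e; lra.
Qed.

Lemma rate_int_psi1 t : rate_int mu (psi1 mu t) = psi1 mu t * t - psi mu t.
Proof.
have z1 : `|psi1 mu t| < 1 by rewrite ltr_norml psi1_gtN1// psi1_lt1.
apply/eqP; rewrite eq_le; apply/andP; split; last first.
  by rewrite mulrC; exact: le_rate_int.
have := psi_lower hmu t (phi mu (psi1 mu t)); rewrite rate_intE.
move: (psi mu (phi mu (psi1 mu t))) (phi mu (psi1 mu t)) (psi1 mu t) (psi mu t).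
by move=> a b e f; lra.
Qed.

(** The monotonicity serves to show that the one-sided limit defining [rate] at 1 exists; the next
    lemma does the same at -1. *)
Lemma rate_int_homo x y : psi1 mu 0 < x -> x <= y -> y < 1 ->
  rate_int mu x <= rate_int mu y.
Proof.
move=> x0 xy y1; have := psi1_gtN1 hmu 0 => h.
have ax : `|x| < 1 by rewrite ltr_norml; lra.
have ay : `|y| < 1 by rewrite ltr_norml; lra.
have p0 : 0 <= phi mu x.
  rewrite leNgt; apply/negP => /ltW /(psi1_homo hmu); rewrite psi1_phi//; lra.
by have := le_rate_int (phi mu x) ay; rewrite [rate_int mu x]rate_intE; nra.
Qed.

Lemma rate_int_nhomo x y : -1 < x -> x <= y -> y < psi1 mu 0 ->
  rate_int mu y <= rate_int mu x.
Proof.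
move=> x1 xy y0; have := psi1_lt1 hmu 0 => h.
have ax : `|x| < 1 by rewrite ltr_norml; lra.
have ay : `|y| < 1 by rewrite ltr_norml; lra.
have p0 : phi mu y <= 0.
  rewrite leNgt; apply/negP => /ltW /(psi1_homo hmu); rewrite psi1_phi//; lra.
by have := le_rate_int (phi mu y) ax; rewrite [rate_int mu y]rate_intE; nra.
Qed.

Lemma le_rate z t : -1 <= z <= 1 -> ((t * z - psi mu t)%:E <= rate mu z)%E.
Proof.
move=> /andP[z1 z2]; rewrite /rate; case: ifPn => [zl|zl].
  by rewrite lee_fin; exact: le_rate_int.
have lin (s : R) : {for s, continuous (fun x : R => (t * x - psi mu t)%:E)}.
  apply: cvg_EFin; first exact: nearW.
  by apply: cvgB; [apply: cvgM; [exact: cvg_cst|exact: cvg_id]|exact: cvg_cst].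
case: ifPn => [/eqP ->|nz1].
  have cv : cvg ((rate_int mu x)%:E @[x --> (1 : R)^'-]).
    (* The reflection x -> -x turns the left limit at 1 into a right limit at -1, to which monotone
       convergence is applied. *)
    suff /cvg_ex[l hl] : cvg ((rate_int mu (- x))%:E @[x --> (-1 : R)^'+]).
      by apply/cvg_ex; exists l; exact/cvg_at_leftNP.
    apply: (@nonincreasing_at_right_is_cvge _ (fun x => (rate_int mu (- x))%:E)).
    near=> x => y1 y2; rewrite !in_itv/= => /andP[y1l y1u] /andP[y2l y2u] y12.
    have xp : x <= - psi1 mu 0.
      by near: x; apply: nbhs_right_le; rewrite ltrN2 psi1_lt1.
    by rewrite lee_fin; apply: rate_int_homo; lra.
  have cl := cvg_at_left_filter (lin 1).
  apply: (lee_cvg_to cl cv).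
  near=> x; rewrite lee_fin; apply: le_rate_int; rewrite ltr_norml.
  have h1 : x < 1 by near: x; exact: nbhs_left_lt.
  have h2 : 0 < x by near: x; apply: nbhs_left_gt; exact: ltr01.
  by apply/andP; split; lra.
case: ifPn => [/eqP ->|nzN1]; last by rewrite leey.
have cv : cvg ((rate_int mu x)%:E @[x --> (-1 : R)^'+]).
  apply: (@nonincreasing_at_right_is_cvge _ (fun x => (rate_int mu x)%:E)).
  near=> x => y1 y2; rewrite !in_itv/= => /andP[y1l y1u] /andP[y2l y2u] y12.
  have xp : x <= psi1 mu 0.
    by near: x; apply: nbhs_right_le; rewrite psi1_gtN1.
  by rewrite lee_fin; apply: rate_int_nhomo; lra.
have cl := cvg_at_right_filter (lin (-1)).
apply: (lee_cvg_to cl cv).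
near=> x; rewrite lee_fin; apply: le_rate_int; rewrite ltr_norml.
have h1 : -1 < x by near: x; exact: nbhs_right_gt.
have h2 : x < 0 by near: x; apply: nbhs_right_lt; lra.
by apply/andP; split; lra.
Unshelve. all: by end_near. Qed.

Lemma rate_psi1 t : rate mu (psi1 mu t) = (psi1 mu t * t - psi mu t)%:E.
Proof.
have z1 : `|psi1 mu t| < 1 by rewrite ltr_norml psi1_gtN1// psi1_lt1.
by rewrite /rate z1 rate_int_psi1.
Qed.

(* strong convexity of the rate function, from [psi'' <= 1] *)
Lemma le_rate_sq z t : -1 <= z <= 1 ->
  ((t * z - psi mu t + (z - psi1 mu t) ^+ 2 / 2)%:E <= rate mu z)%E.
Proof.
move=> z1; apply: le_trans (le_rate (t + (z - psi1 mu t)) z1).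
rewrite lee_fin; have := psi_upper hmu t (z - psi1 mu t).
by set p := psi1 mu t; set q := psi mu (t + _); lra.
Qed.

Lemma quad_formE n (A : 'M[R]_n) (c z : 'cV[R]_n) :
  quad_form A c z = 2^-1 * \sum_i z i 0 * app A (fun j => z j 0) i
                    + \sum_i c i 0 * z i 0.
Proof.
rewrite /quad_form; congr (_ * _ + _).
  rewrite mxE; under eq_bigr do rewrite mxE mulr_suml.
  rewrite exchange_big/=; apply: eq_bigr => i _.
  by rewrite /app mulr_sumr; apply: eq_bigr => j _; rewrite mxE; ring.
by rewrite mxE; apply: eq_bigr => i _; rewrite mxE.
Qed.

Variables (n : nat) (A : 'M[R]_n) (rho : R).
Hypothesis symA : forall i j, A i j = A j i.
Hypothesis rowA : forall i, \sum_j `|A i j| <= rho.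
Hypothesis rho0 : 0 <= rho.
Hypothesis rho1 : rho < 1.

(** Schur's test: each product is bounded by the half-sum of the squares, and rows and columns of
    [|A|] sum to at most [rho]. *)
Lemma form_le (x : 'I_n -> R) : \sum_i x i * app A x i <= rho * \sum_i x i ^+ 2.
Proof.
have h : \sum_i x i * app A x i <= \sum_i \sum_j `|A i j| * ((x i ^+ 2 + x j ^+ 2) / 2).
  apply: ler_sum => i _; rewrite /app mulr_sumr; apply: ler_sum => j _.
  rewrite (le_trans (ler_norm _))// !normrM mulrCA ler_wpM2l//.
  rewrite -[x i ^+ 2](real_normK (num_real _)) -[x j ^+ 2](real_normK (num_real _)).
  have := sqr_ge0 (`|x i| - `|x j|).
  rewrite sqrrB; set a := `|x i|; set b := `|x j|; rewrite -mulr_natr; lra.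
apply: (le_trans h).
have -> : \sum_i \sum_j `|A i j| * ((x i ^+ 2 + x j ^+ 2) / 2) =
    (\sum_i \sum_j `|A i j| * x i ^+ 2) / 2 + (\sum_i \sum_j `|A i j| * x j ^+ 2) / 2.
  rewrite -mulrDl -big_split/= mulr_suml; apply: eq_bigr => i _.
  by rewrite -big_split/= mulr_suml; apply: eq_bigr => j _; ring.
have h2 := sum_row_le symA rowA (y := fun i => x i ^+ 2) (fun j => sqr_ge0 _).
have h1 : \sum_i \sum_j `|A i j| * x i ^+ 2 <= rho * \sum_i x i ^+ 2.
  rewrite mulr_sumr; apply: ler_sum => i _.
  by rewrite -mulr_suml ler_wpM2r ?sqr_ge0.
by lra.
Qed.

Variable c : 'cV[R]_n.

(** At a solution of the mean-field equations the first-order terms cancel; strong convexity of the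
    rate gains half of the squared distance and the quadratic form loses at most [rho] times that
    half. *)
Lemma mf_optimizer_unique (u z : 'cV[R]_n) :
  (forall i, u i 0 = psi1 mu (app A (fun j => u j 0) i + c i 0)) -> cube z ->
  (mf_objective mu A c z <=
   mf_objective mu A c u - ((1 - rho) / 2 * \sum_i (z i 0 - u i 0) ^+ 2)%:E)%E.
Proof.
move=> uE zc; pose t i := app A (fun j => u j 0) i + c i 0.
rewrite {2}/mf_objective.
under eq_bigr => i _ do rewrite uE rate_psi1 -/(t i) -uE.
rewrite sumEFin -!EFinB.
have : ((\sum_i (t i * z i 0 - psi mu (t i) + (z i 0 - u i 0) ^+ 2 / 2))%:E <=
    \sum_i rate mu (z i 0%R))%E.
  rewrite -sumEFin; apply: lee_sum => i _; rewrite uE; exact: le_rate_sq.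
rewrite /mf_objective; case: (\sum_i rate mu (z i 0%R))%E => [s|_|]; last 2 first.
- by rewrite leNye.
- by [].
rewrite -EFinB !lee_fin => hs.
rewrite !quad_formE.
have := form_le (fun i => z i 0 - u i 0).
rewrite (_ : \sum_i (z i 0 - u i 0) * app A (fun i => z i 0 - u i 0) i =
  \sum_i z i 0 * app A (fun j => z j 0) i - 2 * \sum_i z i 0 * app A (fun j => u j 0) i
  + \sum_i u i 0 * app A (fun j => u j 0) i); last first.
  have -> : app A (fun i => z i 0 - u i 0) =
     fun i => app A (fun j => z j 0) i - app A (fun j => u j 0) i.
    apply/funext => i; rewrite /app -sumrB.
    by apply: eq_bigr => j _; rewrite mulrBr.
  have e : \sum_i u i 0 * app A (fun j => z j 0) i =
      \sum_i z i 0 * app A (fun j => u j 0) i.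
    rewrite (app_sym symA (fun i => u i 0) (fun i => z i 0)).
    by apply: eq_bigr => i _; rewrite mulrC.
  rewrite (eq_bigr (fun i => z i 0 * app A (fun j => z j 0) i
     - z i 0 * app A (fun j => u j 0) i - u i 0 * app A (fun j => z j 0) i
     + u i 0 * app A (fun j => u j 0) i)); last by move=> i _; ring.
  by rewrite big_split/= !sumrB e; ring.
move=> hf.
have e1 : \sum_i (t i * z i 0 - psi mu (t i) + (z i 0 - u i 0) ^+ 2 / 2) =
  \sum_i z i 0 * app A (fun j => u j 0) i + \sum_i c i 0 * z i 0
  - \sum_i psi mu (t i) + (\sum_i (z i 0 - u i 0) ^+ 2) / 2.
  rewrite mulr_suml -big_split/= -sumrB -big_split/=.
  by apply: eq_bigr => i _; rewrite /t; ring.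
have e2 : \sum_i (u i 0 * t i - psi mu (t i)) =
  \sum_i u i 0 * app A (fun j => u j 0) i + \sum_i c i 0 * u i 0
  - \sum_i psi mu (t i).
  rewrite -big_split/= -sumrB.
  by apply: eq_bigr => i _; rewrite /t; ring.
move: hs; rewrite e1 e2.
move: hf; set S := \sum_i (z i 0 - u i 0) ^+ 2.
set X1 := \sum_i _; set X2 := \sum_i _; set X3 := \sum_i _; set X4 := \sum_i _.
by set X5 := \sum_i _; lra.
Qed.

(** The fixed point is a maximizer, and the quadratic gap forces the maximizer picked by [get] to
    coincide with it. *)
Lemma mf_optimizerE (u := mf_optimizer mu A c) i :
  u i 0 = psi1 mu (app A (fun j => u j 0) i + c i 0).
Proof.
have [v vE] := meanfield_fixpoint rowA rho0 rho1 (fun j => c j 0) (psi1_lip hmu).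
pose w : 'cV[R]_n := \col_j v j.
have wv : (fun j => w j 0) = v by apply/funext => j; rewrite mxE.
have wE j : w j 0 = psi1 mu (app A (fun j => w j 0) j + c j 0).
  by rewrite wv mxE.
have wc : cube w.
  move=> j; rewrite wE; have := psi1_norm hmu (app A (fun k => w k 0) j + c j 0).
  by rewrite ler_norml.
have wopt : is_mf_optimizer mu A c w.
  split=> // z zc; apply: (le_trans (mf_optimizer_unique wE zc)).
  rewrite -[leRHS]adde0 leeD2l// lee_fin oppr_le0 mulr_ge0 ?sumsq_ge0// divr_ge0// subr_ge0.
  exact: ltW.
suff -> : u = w by [].
have [uc uopt] : is_mf_optimizer mu A c u by apply: getPex; exists w.
have := le_trans (uopt w wc) (mf_optimizer_unique wE uc).
have -> : mf_objective mu A c w = (quad_form A c w - \sum_i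
    (w i 0 * (app A (fun j => w j 0) i + c i 0) -
     psi mu (app A (fun j => w j 0) i + c i 0)))%:E.
  rewrite /mf_objective EFinB -sumEFin; congr (_ - _)%E.
  by apply: eq_bigr => j _; rewrite wE rate_psi1 -wE.
rewrite -EFinB lee_fin lerBrDr gerDl pmulr_rle0; last by rewrite divr_gt0// subr_gt0.
move=> S0; have /eqP : \sum_i (u i 0 - w i 0) ^+ 2 = 0.
  by apply/eqP; rewrite eq_le S0 sumsq_ge0.
rewrite psumr_eq0; last by move=> j _; exact: sqr_ge0.
move=> /allP h; apply/matrixP => j k; rewrite ord1; apply/eqP.
by have := h j (mem_index_enum j); rewrite implyTb sqrf_eq0 subr_eq0.
Qed.

End optimizer.

(** * Product measures *)

Section bm_product.
Context {d1 d2 : measure_display} {T1 : measurableType d1}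
  {T2 : measurableType d2} {R : realType}.

Lemma bm_comp (f : T2 -> R) (g : T1 -> T2) : bm f -> measurable_fun setT g ->
  bm (fun x => f (g x)).
Proof.
move=> [mf [M fM]] mg; split; first exact: measurableT_comp.
by exists M => x.
Qed.

End bm_product.

Section bm_Ex2.
Context {d1 d2 : measure_display} {T1 : measurableType d1}
  {T2 : measurableType d2} {R : realType}.
Variables (P : probability T1 R) (Q : probability T2 R).

Lemma bm_Ex2 (f : T1 * T2 -> R) : bm f -> bm (fun x => \int[Q]_y f (x, y)).
Proof.
move=> bf; have [mf [M fM]] := bf.
have bx x : bm (fun y => f (x, y)).
  exact: (bm_comp (g := pair x) bf (pair1_measurable x)).
split; last first.
  exists M => x; rewrite -[leRHS](Ex_cst Q).
  by apply: norm_Ex_le => //; exact: bm_cst.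
have mF := measurable_fubini_F (bm_integrable (P \x Q)%E bf).
apply/measurable_EFinP; rewrite (_ : _ \o _ = fubini_F Q (EFin \o f))//.
by apply/funext => x; rewrite /fubini_F/= EFin_Ex.
Qed.

Lemma Ex_prod12 (f : T1 * T2 -> R) : bm f ->
  \int[(P \x Q)%E]_z f z = \int[P]_x \int[Q]_y f (x, y).
Proof.
move=> bf.
have bx x : bm (fun y => f (x, y)).
  exact: (bm_comp (g := pair x) bf (pair1_measurable x)).
rewrite /Rintegral -(integral12_prod_meas1 (bm_integrable (P \x Q)%E bf)).
congr fine; apply: eq_integral => x _.
by rewrite /fubini_F/= EFin_Ex.
Qed.
End bm_Ex2.

Section bm_product_swap.
Context {d1 d2 : measure_display} {T1 : measurableType d1}
  {T2 : measurableType d2} {R : realType}.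
Variables (P : probability T1 R) (Q : probability T2 R).

Lemma Ex_prod21 (f : T1 * T2 -> R) : bm f ->
  \int[(P \x Q)%E]_z f z = \int[Q]_y \int[P]_x f (x, y).
Proof.
move=> bf.
have bx y : bm (fun x => f (x, y)).
  exact: (bm_comp (g := pair^~ y) bf (pair2_measurable y)).
rewrite /Rintegral -(integral21_prod_meas1 (bm_integrable (P \x Q)%E bf)).
congr fine; apply: eq_integral => y _.
by rewrite /fubini_G/= EFin_Ex.
Qed.

Lemma Ex_swap (f : T1 * T2 -> R) : bm f ->
  \int[P]_x \int[Q]_y f (x, y) = \int[Q]_y \int[P]_x f (x, y).
Proof. by move=> bf; rewrite -Ex_prod12// Ex_prod21. Qed.

End bm_product_swap.

Section iid.
Context {d : measure_display} {T : measurableType d} {R : realType}.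
Variable P : probability T R.

Lemma Ex_cons n (f : n.+1.-tuple T -> R) : bm f ->
  \int[iid_law P n.+1]_s f s =
  \int[P]_x \int[iid_law P n]_t f [tuple of x :: t].
Proof.
move=> bf; have bc : bm (fun z => f (cons_pair z)).
  exact: (bm_comp bf (@measurable_cons_pair _ _ _)).
rewrite -(Ex_prod12 P (iid_law P n) bc) /Rintegral; congr fine.
rewrite /= integral_distribution//.
  by apply/measurable_EFinP; case: bf.
exact: (bm_integrable (P \x iid_law P n)%E bc).
Qed.

Definition ins n (i : 'I_n.+1) (x : T) (t : n.-tuple T) : n.+1.-tuple T :=
  [tuple if unlift i k is Some j then tnth t j else x | k < n.+1].

Lemma tnth_ins_id n (i : 'I_n.+1) x (t : n.-tuple T) : tnth (ins i x t) i = x.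
Proof. by rewrite tnth_mktuple unlift_none. Qed.

Lemma tnth_ins_lift n (i : 'I_n.+1) j x (t : n.-tuple T) :
  tnth (ins i x t) (lift i j) = tnth t j.
Proof. by rewrite tnth_mktuple liftK. Qed.

Lemma measurable_ins n (i : 'I_n.+1) :
  measurable_fun setT (fun xt : T * n.-tuple T => ins i xt.1 xt.2).
Proof.
apply/measurable_fun_tnthP => k.
case: (unliftP i k) => [j ->|->].
  rewrite (_ : _ \o _ = (fun t => tnth t j) \o snd).
    by apply: measurableT_comp => //; exact: measurable_tnth.
  by apply/funext => -[x t] /=; rewrite tnth_ins_lift.
rewrite (_ : _ \o _ = fst)//.
by apply/funext => -[x t] /=; rewrite tnth_ins_id.
Qed.

Lemma ins0 n x (t : n.-tuple T) : ins ord0 x t = [tuple of x :: t].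
Proof.
apply: eq_from_tnth => k; case: (unliftP ord0 k) => [j ->|->].
  by rewrite tnth_ins_lift tnthS.
by rewrite tnth_ins_id.
Qed.

Lemma ins_cons n (i : 'I_n.+1) x y (t : n.-tuple T) :
  ins (lift ord0 i) x [tuple of y :: t] = [tuple of y :: ins i x t].
Proof.
apply: eq_from_tnth => k; case: (unliftP ord0 k) => [j ->|->].
  rewrite tnthS; case: (unliftP i j) => [l ->|->].
    rewrite tnth_ins_lift.
    have -> : lift ord0 (lift i l) = lift (lift ord0 i) (lift ord0 l).
      by apply: val_inj; rewrite /= /bump /= !add1n ltnS addnS.
    by rewrite tnth_ins_lift tnthS.
  by rewrite !tnth_ins_id.
have -> : @ord0 n.+1 = lift (lift ord0 i) ord0 by apply: val_inj.
by rewrite tnth_ins_lift.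
Qed.

(** Any site, not only the first, can be integrated separately; the induction moves the chosen
    coordinate past the first one by Fubini. *)
Lemma Ex_ins n (i : 'I_n.+1) (f : n.+1.-tuple T -> R) : bm f ->
  \int[iid_law P n.+1]_s f s = \int[P]_x \int[iid_law P n]_t f (ins i x t).
Proof.
elim: n i f => [|n IH] i f bf.
  rewrite (Ex_cons bf); apply: eq_Ex => x; apply: eq_Ex => t.
  by rewrite (ord1 i) ins0.
have bi j y : bm (fun t => f (ins j y t)).
  apply: (bm_comp (g := fun t => ins j y t) bf).
  exact: (measurableT_comp (measurable_ins j) (pair1_measurable y)).
case: (unliftP ord0 i) => [j ->|->]; last first.
  by rewrite (Ex_cons bf); apply: eq_Ex => x; apply: eq_Ex => t; rewrite ins0.
rewrite (Ex_cons bf).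
transitivity (\int[P]_y \int[P]_x \int[iid_law P n]_t f [tuple of y :: ins j x t]).
  apply: eq_Ex => y; apply: (IH j (fun s => f [tuple of y :: s])).
  have mg : measurable_fun setT (fun s : n.+1.-tuple T => cons_pair (y, s)).
    exact: (measurableT_comp (@measurable_cons_pair _ _ _) (pair1_measurable y)).
  exact: (bm_comp bf mg).
have b3 : bm (fun z : (T * T) * n.-tuple T => f [tuple of z.1.1 :: ins j z.1.2 z.2]).
  have mg : measurable_fun setT (fun z : (T * T) * n.-tuple T =>
      cons_pair (z.1.1, ins j z.1.2 z.2)).
    apply: (measurableT_comp (@measurable_cons_pair _ _ _)).
    apply/measurable_fun_pair; first exact: measurableT_comp.
    apply: (measurableT_comp (measurable_ins j)
      (g := fun z : (T * T) * n.-tuple T => (z.1.2, z.2))).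
    by apply/measurable_fun_pair => //; exact: measurableT_comp.
  exact: (bm_comp bf mg).
rewrite (Ex_swap P P (bm_Ex2 (P \x P)%E (iid_law P n) b3)).
apply: eq_Ex => x; rewrite Ex_cons//.
by apply: eq_Ex => y; apply: eq_Ex => t; rewrite ins_cons.
Qed.

End iid.

(** * The Gibbs measure of the truncated spins *)

Section hamiltonian.
Context {R : realType}.
Local Notation tup n := (n.-tuple (measurableTypeR R)).

Definition Xc n (i : 'I_n) (s : tup n) : R := clip (tnth s i).

Lemma Xc_norm n (i : 'I_n) s : `|Xc i s| <= 1.
Proof. exact: clip_norm. Qed.

Lemma bm_Xc n (i : 'I_n) : bm (Xc i).
Proof. exact: (bm_comp bm_clip (measurable_tnth i)). Qed.
Hint Resolve bm_Xc : core.

Definition lin n (a : 'I_n -> R) (s : tup n) : R := \sum_i a i * Xc i s.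

Lemma bm_lin n (a : 'I_n -> R) : bm (lin a).
Proof. by rewrite /lin; bmt; exact: bm_Xc. Qed.
Hint Resolve bm_lin : core.

Definition Ham n (A : 'I_n -> 'I_n -> R) (c : 'I_n -> R) (s : tup n) : R :=
  2^-1 * (\sum_i Xc i s * \sum_j A i j * Xc j s) + lin c s.

Lemma bm_Ham n (A : 'I_n -> 'I_n -> R) c : bm (Ham A c).
Proof. by rewrite /Ham; bmt; rewrite ?/lin; bmt; exact: bm_Xc. Qed.
Hint Resolve bm_Ham : core.

Lemma Ham_field n (A : 'I_n -> 'I_n -> R) c a (y : R) (s : tup n) :
  Ham A (fun i => c i + y * a i) s = Ham A c s + y * lin a s.
Proof.
rewrite /Ham -addrA; congr (_ + _); rewrite /lin mulr_sumr -big_split/=.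
by apply: eq_bigr => i _; ring.
Qed.

End hamiltonian.

Ltac bmg := repeat first [assumption | apply: bm_cst | exact: bm_Ham
  | exact: bm_Xc | exact: bm_lin | apply: bm_exp
  | apply: bmX | apply: bmN | apply: bmD | apply: bmM | apply: bm_norm
  | (apply: bm_sum; move=> ?)].

Section gibbs.
Context {R : realType}.
Variable mu : probability (measurableTypeR R) R.
Local Notation tup n := (n.-tuple (measurableTypeR R)).

Definition gE n (A : 'I_n -> 'I_n -> R) c (f : tup n -> R) : R :=
  tilt (iid_law mu n) (Ham A c) f.

Definition gcov n (A : 'I_n -> 'I_n -> R) c (f g : tup n -> R) : R :=
  cov (iid_law mu n) (Ham A c) f g.

Lemma is_derive_gE n (A : 'I_n -> 'I_n -> R) c a f (y : R) : bm f ->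
  is_derive y (1 : R) (fun y => gE A (fun i => c i + y * a i) f)
    (gcov A (fun i => c i + y * a i) f (lin a)).
Proof.
move=> bf; have E y' : Ham A (fun i => c i + y' * a i) =
    fun s => Ham A c s + y' * lin a s by apply/funext => s; rewrite Ham_field.
rewrite (_ : (fun _ => _) = fun y' =>
   tilt (iid_law mu n) (fun s => Ham A c s + y' * lin a s) f); last first.
  by apply/funext => y'; rewrite /gE E.
rewrite /gcov E; exact: (is_derive_tilt _ _ (bm_Ham A c) (bm_lin a) bf).
Qed.

(** The system with site [i] removed: [subA] holds its couplings, [subc] its field, and [sub_col]
    the couplings between [i] and the other sites. *)
Definition subA n (i : 'I_n.+1) (A : 'I_n.+1 -> 'I_n.+1 -> R) (j k : 'I_n) :=
  A (lift i j) (lift i k).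

Definition subc n (i : 'I_n.+1) (c : 'I_n.+1 -> R) (j : 'I_n) := c (lift i j).

Definition sub_col n (i : 'I_n.+1) (A : 'I_n.+1 -> 'I_n.+1 -> R) (j : 'I_n) :=
  A i (lift i j).

Lemma Xc_ins_lift n (i : 'I_n.+1) j x (t : tup n) :
  Xc (lift i j) (ins i x t) = Xc j t.
Proof. by rewrite /Xc tnth_ins_lift. Qed.

Lemma Xc_ins n (i : 'I_n.+1) x (t : tup n) : Xc i (ins i x t) = clip x.
Proof. by rewrite /Xc tnth_ins_id. Qed.

Lemma lin_ins n (i : 'I_n.+1) a x (t : tup n) :
  lin a (ins i x t) = a i * clip x + lin (subc i a) t.
Proof.
rewrite /lin (bigD1_ord i)//= Xc_ins; congr (_ + _).
by apply: eq_bigr => j _; rewrite Xc_ins_lift.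
Qed.

(** The spin at [i] acts on the other sites as an additional field along its row of [A]; each pair
    containing [i] occurs twice, which cancels the factor 1/2. *)
Lemma Ham_ins n (i : 'I_n.+1) (A : 'I_n.+1 -> 'I_n.+1 -> R) c x (t : tup n) :
  (forall j k, A j k = A k j) -> A i i = 0 ->
  Ham A c (ins i x t) =
  Ham (subA i A) (fun j => subc i c j + clip x * sub_col i A j) t + c i * clip x.
Proof.
move=> sA A0; rewrite Ham_field /Ham lin_ins.
have -> : \sum_j Xc j (ins i x t) * (\sum_k A j k * Xc k (ins i x t)) =
  2 * clip x * lin (sub_col i A) t +
  \sum_j Xc j t * (\sum_k subA i A j k * Xc k t).
  have E j : \sum_k A j k * Xc k (ins i x t) = lin (A j) (ins i x t) by [].
  under eq_bigr do rewrite E lin_ins.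
  rewrite (bigD1_ord i)//= Xc_ins A0 mul0r add0r.
  under [X in _ + X = _]eq_bigr do rewrite Xc_ins_lift mulrDr.
  rewrite big_split/= addrA; congr (_ + _).
  rewrite (_ : \sum_(j < n) _ = clip x * lin (sub_col i A) t).
    by rewrite (_ : subc i (A i) = sub_col i A)//; ring.
  rewrite /lin mulr_sumr; apply: eq_bigr => j _.
  by rewrite /sub_col sA; ring.
by field.
Qed.

Section disintegration.
Variables (n : nat) (i : 'I_n.+1) (A : 'I_n.+1 -> 'I_n.+1 -> R) (c : 'I_n.+1 -> R).
Hypothesis sA : forall j k, A j k = A k j.
Hypothesis A0 : A i i = 0.

Definition cond_field (y : R) (j : 'I_n) := subc i c j + y * sub_col i A j.

Definition condE (f : tup n -> R) (y : R) := gE (subA i A) (cond_field y) f.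

Definition lnZ (y : R) : R :=
  ln (\int[iid_law mu n]_t expR (Ham (subA i A) (cond_field y) t)).

Lemma is_derive_lnZ y : is_derive y (1 : R) lnZ (condE (lin (sub_col i A)) y).
Proof.
have E y' : Ham (subA i A) (cond_field y') =
    fun s => Ham (subA i A) (subc i c) s + y' * lin (sub_col i A) s.
  by apply/funext => s; rewrite Ham_field.
rewrite (_ : lnZ = fun y' => ln (\int[iid_law mu n]_s
   expR (Ham (subA i A) (subc i c) s + y' * lin (sub_col i A) s))); last first.
  by apply/funext => y'; rewrite /lnZ E.
rewrite /condE /gE E.
exact: (is_derive_ln_Ex _ _ (bm_Ham (subA i A) (subc i c)) (bm_lin (sub_col i A))).
Qed.

Lemma bm_derive_clip (f g : R -> R) K : (forall y, is_derive y (1 : R) f (g y)) ->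
  (forall y, `|g y| <= K) -> bm (fun x : measurableTypeR R => f (clip x)).
Proof.
move=> df gK; split.
  apply: (measurableT_comp (f := f)); last exact: measurable_clip.
  apply: continuous_measurable_fun => x; apply: differentiable_continuous.
  by apply/derivable1_diffP; have [] := df x.
exists (`|f 0| + K) => x.
rewrite -(subrK (f 0) (f _)) addrC (le_trans (ler_normD _ _))// lerD2l.
rewrite (le_trans (lip_of_derive 0 (clip x) df gK))// subr0 ler_piMr ?clip_norm//.
exact: le_trans (gK 0).
Qed.

(** Up to a constant, the logarithm of the density with respect to [mu] of the marginal law of the
    spin at [i]: its own field plus the free energy of the other sites given that spin. *)
Definition H1 (x : measurableTypeR R) : R := c i * clip x + lnZ (clip x).

Lemma bm_H1 : bm H1.
Proof.
apply: bmD; first by apply: bmM; [exact: bm_cst|exact: bm_clip].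
have [M M0 hM] := bm_bound (bm_lin (sub_col i A)).
apply: (bm_derive_clip is_derive_lnZ (K := M)) => y.
exact: (norm_tilt_le_cst _ (bm_Ham _ _) (bm_lin _) hM).
Qed.

Lemma expR_lnZ y :
  expR (lnZ y) = \int[iid_law mu n]_t expR (Ham (subA i A) (cond_field y) t).
Proof. by rewrite lnK// posrE; exact: (Ex_exp_gt0 _ (bm_Ham _ _)). Qed.

Lemma gE_disintegrate (f : tup n.+1 -> R) : bm f ->
  gE A c f = tilt mu H1 (fun x => condE (fun t => f (ins i x t)) (clip x)).
Proof.
move=> bf.
have key (g : tup n.+1 -> R) : bm g ->
    \int[iid_law mu n.+1]_s (g s * expR (Ham A c s)) =
    \int[mu]_x (condE (fun t => g (ins i x t)) (clip x) * expR (H1 x)).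
  move=> bg; rewrite (Ex_ins _ i); last by bmg.
  apply: eq_Ex => x; rewrite /H1 expRD expR_lnZ.
  rewrite /condE /gE /tilt mulrCA -mulrA mulVf ?mulr1; last first.
    by rewrite gt_eqF// (Ex_exp_gt0 _ (bm_Ham _ _)).
  have bgx : bm (fun t => g (ins i x t)).
    apply: (bm_comp (g := fun t => ins i x t) bg).
    exact: (measurableT_comp (measurable_ins i) (pair1_measurable x)).
  rewrite -ExZl; last bmg.
  by apply: eq_Ex => t; rewrite Ham_ins// expRD; ring.
rewrite /gE /tilt key//; congr (_ / _).
transitivity (\int[iid_law mu n.+1]_s (1 * expR (Ham A c s))).
  by apply: eq_Ex => s; rewrite mul1r.
rewrite (key (fun=> 1)); last exact: bm_cst.
by apply: eq_Ex => x; rewrite /condE /gE tilt_cst ?mul1r//; exact: bm_Ham.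
Qed.

End disintegration.

(** The entries of the partial Neumann sum of [|C| ^ k] over k < m. Each conditioning step removes
    one site, so that depth [n] suffices for [n] sites. *)
Fixpoint nb (m n : nat) (C : 'I_n -> 'I_n -> R) : 'I_n -> 'I_n -> R :=
  if m is p.+1 then fun i j => (i == j)%:R + \sum_k `|C i k| * nb p C k j
  else fun _ _ => 0.

Lemma nb_ge0 m n (C : 'I_n -> 'I_n -> R) i j : 0 <= nb m C i j.
Proof.
elim: m i j => [|m IH] i j //=.
by rewrite addr_ge0// sumr_ge0// => k _; rewrite mulr_ge0.
Qed.

(** The entries count weighted paths with nonnegative weights; removing a site only discards the
    paths through it. *)
Lemma nb_sub m n (i : 'I_n.+1) (C : 'I_n.+1 -> 'I_n.+1 -> R) j k :
  nb m (subA i C) j k <= nb m C (lift i j) (lift i k).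
Proof.
elim: m j k => [|m IH] j k //=.
rewrite (inj_eq lift_inj) lerD2l (bigD1_ord i)//=.
rewrite -[leLHS]add0r lerD// ?mulr_ge0// ?nb_ge0//.
by apply: ler_sum => l _; rewrite /subA ler_wpM2l// IH.
Qed.

Lemma nb_row m n (C : 'I_n -> 'I_n -> R) rho i : 0 <= rho -> rho < 1 ->
  (forall i, \sum_j `|C i j| <= rho) -> \sum_j nb m C i j <= (1 - rho)^-1.
Proof.
move=> r0 r1 hC; have r1' : 0 < 1 - rho by rewrite subr_gt0.
elim: m i => [|m IH] i /=; first by rewrite big1// invr_ge0 ltW.
rewrite big_split/= exchange_big/= (bigD1 i)//= eqxx big1 ?addr0; last first.
  by move=> j ji; rewrite eq_sym (negbTE ji).
apply: (@le_trans _ _ (1 + rho * (1 - rho)^-1)).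
  rewrite lerD2l; apply: (@le_trans _ _ (\sum_k `|C i k| * (1 - rho)^-1)).
    by apply: ler_sum => k _; rewrite -mulr_sumr ler_wpM2l.
  by rewrite -mulr_suml ler_wpM2r// invr_ge0 ltW.
by rewrite le_eqVlt; apply/orP; left; apply/eqP; field; rewrite gt_eqF.
Qed.

(* Dobrushin-type bound: conditioning on the spin at [i], the conditional mean
   of [Xc j] is a Lipschitz function of that spin, with a constant controlled by
   the covariances of the system without the site [i] *)
Lemma gcov_le n (A : 'I_n -> 'I_n -> R) c i j :
  (forall j k, A j k = A k j) -> (forall j, A j j = 0) ->
  `|gcov A c (Xc i) (Xc j)| <= nb n A i j.
Proof.
elim: n A c i j => [|n IH] A c i j sA A0; first by case: i.
have [->|ij] := eqVneq i j.
  apply: (@le_trans _ _ 1).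
    rewrite ger0_norm; last exact: (var_ge0 _ (bm_Ham _ _) (bm_Xc _)).
    by apply: (var_le1 _ (bm_Ham _ _) (bm_Xc _)) => s; exact: Xc_norm.
  rewrite /= eqxx lerDl sumr_ge0// => k _.
  by rewrite mulr_ge0// nb_ge0.
case: (unliftP i j) ij => [l ->|->]; last by rewrite eqxx.
move=> _ ; pose F (y : R) := condE i A c (Xc l) y.
have dF (y : R) : is_derive y (1 : R) F (gcov (subA i A) (cond_field i A c y) (Xc l)
    (lin (sub_col i A))).
  exact: (is_derive_gE _ _ _ _ (bm_Xc l)).
pose L := \sum_k `|A i (lift i k)| * nb n (subA i A) k l.
have FL (y : R) : `|gcov (subA i A) (cond_field i A c y) (Xc l) (lin (sub_col i A))| <= L.
  rewrite /gcov covC /lin.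
  have -> : cov (iid_law mu n) (Ham (subA i A) (cond_field i A c y))
      (fun s => \sum_k sub_col i A k * Xc k s) (Xc l) =
    \sum_k sub_col i A k * cov (iid_law mu n)
       (Ham (subA i A) (cond_field i A c y)) (Xc k) (Xc l).
    have b1 k : bm (fun s => sub_col i A k * Xc k s) by bmg.
    (* [Xc l] is viewed as a sum over a one-element list, so that the bilinearity [cov_sum] applies
       to both arguments. *)
    have b2 (_ : unit) : bm (Xc l : tup n -> R) by exact: bm_Xc.
    have h := cov_sum (iid_law mu n) (bm_Ham (subA i A) (cond_field i A c y))
      (index_enum 'I_n) [:: tt] b1 b2.
    rewrite (_ : (fun x => \sum_(j <- [:: tt]) Xc l x) = Xc l) in h; last first.
      by apply/funext => s; rewrite big_seq1.
    rewrite h; apply: eq_bigr => k _; rewrite big_seq1.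
    exact: (covZl _ (bm_Ham _ _) _ (bm_Xc k) (bm_Xc l)).
  rewrite (le_trans (ler_norm_sum _ _ _))//; apply: ler_sum => k _.
  rewrite normrM ler_wpM2l//; apply: IH => [a b|a]; first by rewrite /subA sA.
  by rewrite /subA A0.
have L0 : 0 <= L by exact: le_trans (FL 0).
have covE1 : gcov A c (Xc i) (Xc (lift i l)) =
    cov mu (H1 i A c) clip (F \o clip).
  have bX := @bm_Xc R n.+1.
  have D1 : gE A c (fun s => Xc i s * Xc (lift i l) s) =
      tilt mu (H1 i A c) (fun x => clip x * F (clip x)).
    rewrite (gE_disintegrate c sA (A0 i)); last by bmg.
    apply: eq_tilt => x; rewrite /F /condE /gE.
    rewrite -(tiltZ _ (bm_Ham _ _)); last by bmg.
    by apply: eq_tilt => t; rewrite Xc_ins Xc_ins_lift.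
  have D2 : gE A c (Xc i) = tilt mu (H1 i A c) clip.
    rewrite (gE_disintegrate c sA (A0 i)); last by bmg.
    apply: eq_tilt => x; rewrite /condE /gE.
    rewrite -[RHS](tilt_cst (iid_law mu n) (bm_Ham (subA i A)
      (cond_field i A c (clip x)))).
    by apply: eq_tilt => t; rewrite Xc_ins.
  have D3 : gE A c (Xc (lift i l)) = tilt mu (H1 i A c) (F \o clip).
    rewrite (gE_disintegrate c sA (A0 i)); last by bmg.
    apply: eq_tilt => x; rewrite /F /condE /gE.
    by apply: eq_tilt => t; rewrite Xc_ins_lift.
  by rewrite /cov -D1 -D2 -D3.
rewrite covE1; apply: (@le_trans _ _ L).
  apply: cov_comp_lip => //.
  - exact: bm_H1.
  - exact: bm_clip.
  - exact: (bm_derive_clip dF FL).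
  - by move=> x; exact: clip_norm.
  - by move=> a b; exact: (lip_of_derive _ _ dF FL).
rewrite /= (negbTE (neq_lift i l)) add0r (bigD1_ord i)//= A0 normr0 mul0r add0r.
by apply: ler_sum => k _; rewrite ler_wpM2l// nb_sub.
Qed.

End gibbs.

Opaque psi psi1 psi2.

(** * Approximate mean-field equations for the Gibbs means *)

Section gibbs_mean.
Context {R : realType}.
Variable mu : probability (measurableTypeR R) R.
Hypothesis hmu : base_measure mu.
Local Notation tup n := (n.-tuple (measurableTypeR R)).

(** Given the other spins, the spin at [i] follows [mu] tilted by its local field, whose mean is
    [psi1]. The zero diagonal makes that local field independent of the spin itself. *)
Lemma gE_Xc n (A : 'I_n -> 'I_n -> R) c i :
  (forall j k, A j k = A k j) -> (forall j, A j j = 0) ->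
  gE mu A c (Xc i) = gE mu A c (fun s => psi1 mu (lin (A i) s + c i)).
Proof.
case: n A c i => [|n] A c i sA A0; first by case: i.
have bp (a : 'I_n.+1 -> R) r : bm (fun s => psi1 mu (lin a s + r)).
  apply: (bm_comp (g := fun s => lin a s + r) (bm_psi1 hmu)).
  by have [] : bm (fun s : tup n.+1 => lin a s + r) by bmg.
rewrite /gE /tilt; congr (_ / _).
have bi (g : tup n.+1 -> R) : bm g -> bm (fun xt => g (ins i xt.1 xt.2)).
  by move=> bg; exact: (bm_comp bg (measurable_ins i)).
have b1 : bm (fun s : tup n.+1 => Xc i s * expR (Ham A c s)) by bmg.
have b2 : bm (fun s : tup n.+1 => psi1 mu (lin (A i) s + c i) * expR (Ham A c s)).
  by apply: bmM; [exact: bp|bmg].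
rewrite (Ex_ins mu i b1) (Ex_ins mu i b2).
rewrite (Ex_swap mu (iid_law mu n) (bi _ b1)) (Ex_swap mu (iid_law mu n) (bi _ b2)).
apply: eq_Ex => t /=.
pose K := Ham (subA i A) (subc i c) t.
pose h := lin (sub_col i A) t + c i.
have HE x : Ham A c (ins i x t) = K + psiH h x.
  by rewrite Ham_ins// Ham_field /psiH/cumH /K /h; ring.
have lE x : lin (A i) (ins i x t) + c i = h by rewrite lin_ins A0 mul0r add0r.
transitivity (\int[mu]_x (expR K * (clip x * expR (psiH h x)))).
  by apply: eq_Ex => x; rewrite Xc_ins HE expRD; ring.
transitivity (\int[mu]_x (expR K * (psi1 mu h * expR (psiH h x)))); last first.
  by apply: eq_Ex => x; rewrite lE HE expRD; ring.
have bH := bm_psiH h.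
rewrite ExZl; last by apply: bmM; [exact: bm_clip|exact: bm_exp].
rewrite ExZl; last by apply: bmM; [exact: bm_cst|exact: bm_exp].
rewrite ExZl; last exact: bm_exp.
congr (_ * _); rewrite psi1E// /tm /tilt divfK// gt_eqF//.
exact: Ex_exp_gt0.
Qed.

Section bounds.
Variables (n : nat) (A : 'I_n -> 'I_n -> R) (rho : R).
Hypothesis sA : forall i j, A i j = A j i.
Hypothesis A0 : forall i, A i i = 0.
Hypothesis rowA : forall i, \sum_j `|A i j| <= rho.
Hypothesis rho0 : 0 <= rho.
Hypothesis rho1 : rho < 1.

(** Schur's test for the covariance matrix, whose row sums are bounded through [gcov_le] by those of
    the Neumann sum. *)
Lemma gvar_lin_le c (a : 'I_n -> R) :
  gcov mu A c (lin a) (lin a) <= (\sum_i a i ^+ 2) / (1 - rho).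
Proof.
have bX k : bm (fun s : tup n => a k * Xc k s) by bmg.
rewrite /gcov /lin (cov_sum _ (bm_Ham A c) _ _ bX bX).
have cE i j : cov (iid_law mu n) (Ham A c) (fun s => a i * Xc i s)
   (fun s => a j * Xc j s) = a i * (a j * gcov mu A c (Xc i) (Xc j)).
  rewrite (covZl _ (bm_Ham A c) _ (bm_Xc i) (bX j)) covC.
  by rewrite (covZl _ (bm_Ham A c) _ (bm_Xc j) (bm_Xc i)) covC.
under eq_bigr do under eq_bigr do rewrite cE.
pose C i j := `|gcov mu A c (Xc i) (Xc j)|.
have CC i j : C i j = C j i by rewrite /C /gcov covC.
apply: (@le_trans _ _ (\sum_i \sum_j ((a i ^+ 2 + a j ^+ 2) / 2 * C i j))).
  apply: ler_sum => i _; apply: ler_sum => j _.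
  rewrite mulrA (le_trans (ler_norm _))// normrM ler_wpM2r//.
  rewrite normrM -[a i ^+ 2](real_normK (num_real _)).
  rewrite -[a j ^+ 2](real_normK (num_real _)).
  have := sqr_ge0 (`|a i| - `|a j|).
  by rewrite sqrrB -mulr_natr; set u := `|a i|; set v := `|a j|; lra.
have -> : \sum_i \sum_j ((a i ^+ 2 + a j ^+ 2) / 2 * C i j) =
    \sum_i \sum_j (a i ^+ 2 * C i j).
  have e : \sum_i \sum_j (a j ^+ 2 * C i j) = \sum_i \sum_j (a i ^+ 2 * C i j).
    by rewrite exchange_big/=; apply: eq_bigr => i _; apply: eq_bigr => j _; rewrite CC.
  rewrite -[RHS](@mulfK _ 2) ?pnatr_eq0// [in RHS]mulr2n mulrDr mulr1 -{2}e.
  rewrite -big_split/= mulr_suml; apply: eq_bigr => i _.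
  by rewrite -big_split/= mulr_suml; apply: eq_bigr => j _; ring.
rewrite mulr_suml; apply: ler_sum => i _.
rewrite -mulr_sumr ler_wpM2l ?sqr_ge0//.
apply: le_trans (nb_row n i rho0 rho1 rowA); apply: ler_sum => j _.
exact: gcov_le.
Qed.

Definition gmean c i := gE mu A c (Xc i).

Lemma gE_lin c a : gE mu A c (lin a) = \sum_i a i * gmean c i.
Proof.
rewrite /gE /lin (tilt_sum _ (bm_Ham A c)); last by move=> i; bmg.
by apply: eq_bigr => i _; rewrite (tiltZ _ (bm_Ham A c))//; exact: bm_Xc.
Qed.

(** [psi1] is expanded at the mean of the local field: the error is the Taylor constant 4 times the
    variance of that local field. *)
Lemma gmean_le c i :
  `|gmean c i - psi1 mu (app A (gmean c) i + c i)|
   <= 4 * (\sum_j A i j ^+ 2) / (1 - rho).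
Proof.
rewrite /gmean gE_Xc// -/(gmean c).
have -> : app A (gmean c) i = gE mu A c (lin (A i)) by rewrite gE_lin.
set a := gE mu A c (lin (A i)).
have bH := bm_Ham A c; have bl : bm (lin (A i) : tup n -> R) by exact: bm_lin.
have bp : bm (fun s : tup n => psi1 mu (lin (A i) s + c i)).
  apply: (bm_comp (g := fun s : tup n => lin (A i) s + c i) (bm_psi1 hmu)).
  by have [] : bm (fun s : tup n => lin (A i) s + c i) by bmg.
have fT y : `|psi1 mu (y + c i) - psi1 mu (a + c i) - psi2 mu (a + c i) * (y - a)|
    <= 4 * (y - a) ^+ 2.
  have E : y + c i - (a + c i) = y - a by rewrite opprD addrACA subrr addr0.
  by have := psi1_taylor hmu (a + c i) (y + c i); rewrite E.
apply: (le_trans (tilt_taylor bH (f := fun y => psi1 mu (y + c i)) bl bp fT)).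
by rewrite -mulrA ler_wpM2l// gvar_lin_le.
Qed.

(** Stability of the fixed point: the Gibbs means solve the equations up to the residual [r], and
    the contraction returns the distance to [u] as at most the norm of [r] divided by [1 - rho]. *)
Lemma gmean_meanfield c u (alpha : R) :
  (forall i, u i = psi1 mu (app A u i + c i)) ->
  (forall i, \sum_j A i j ^+ 2 <= alpha) ->
  \sum_i (gmean c i - u i) ^+ 2 <=
    n%:R * (4 * alpha / (1 - rho) ^+ 2) ^+ 2.
Proof.
move=> uE hal; have r1 : 0 < 1 - rho by rewrite subr_gt0.
pose r i := gmean c i - psi1 mu (app A (gmean c) i + c i).
have := contraction_sq sA rowA rho1 (b := r) (y := fun i => gmean c i - u i).
move=> /(_ _)/le_trans; apply.
  move=> i; rewrite {1}uE.
  rewrite -(subrKA (psi1 mu (app A (gmean c) i + c i))) (le_trans (ler_normD _ _))//.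
  rewrite lerD2l (le_trans (psi1_lip hmu _ _))//.
  rewrite opprD addrACA subrr addr0.
  have -> : app A (gmean c) i - app A u i = app A (fun j => gmean c j - u j) i.
    by rewrite /app -sumrB; apply: eq_bigr => j _; rewrite mulrBr.
  exact: app_le.
rewrite ler_pdivrMr ?exprn_gt0//.
have -> : n%:R * (4 * alpha / (1 - rho) ^+ 2) ^+ 2 * (1 - rho) ^+ 2 =
   n%:R * (4 * alpha / (1 - rho)) ^+ 2 by field; rewrite gt_eqF.
apply: sumsq_sq_le => i.
rewrite -(real_normK (num_real (r i))) ler_pXn2r// ?nnegrE//.
  apply: (le_trans (gmean_le c i)).
  by rewrite ler_pM2r ?invr_gt0// ler_pM2l.
apply: (le_trans _ (le_trans (gmean_le c i) _)) => //.
by rewrite ler_pM2r ?invr_gt0// ler_pM2l.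
Qed.

End bounds.
End gibbs_mean.

(** * Response of the Gibbs measure to the field *)

Opaque psi psi1 psi2.

Section quenched.
Context {R : realType}.
Variable mu : probability (measurableTypeR R) R.
Hypothesis hmu : base_measure mu.
Variables (n : nat) (A : 'I_n -> 'I_n -> R) (rho alpha : R).
Hypothesis sA : forall i j, A i j = A j i.
Hypothesis A0 : forall i, A i i = 0.
Hypothesis rowA : forall i, \sum_j `|A i j| <= rho.
Hypothesis rowA2 : forall i, \sum_j A i j ^+ 2 <= alpha.
Hypothesis rho0 : 0 <= rho.
Hypothesis rho1 : rho < 1.
Variable u : ('I_n -> R) -> 'I_n -> R.
Hypothesis uE : forall c i, u c i = psi1 mu (app A (u c) i + c i).
Variables (q e : 'I_n -> R) (kappa v delta : R).
Hypothesis qE : forall i, app A q i = kappa * q i + e i.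
Hypothesis q1 : nrm q = 1.
Hypothesis kappa_le : `|kappa| <= rho.
Hypothesis v01 : 0 <= v <= 1.
Hypothesis alpha0 : 0 <= alpha.
Hypothesis delta01 : 0 <= delta <= 1.
Hypothesis qd : forall i, `|q i| <= delta.
Hypothesis ed : nrm e <= delta.
Hypothesis ad : Num.sqrt n%:R * alpha <= delta.

Let b := (1 - rho)^-1.

Let r1 : 0 < 1 - rho. Proof. by rewrite subr_gt0. Qed.

Let b1 : 1 <= b. Proof. by rewrite /b invf_ge1// gerBl. Qed.

Let b0 : 0 <= b. Proof. exact: le_trans ler01 b1. Qed.

Let kv : 1 - rho <= 1 - kappa * v.
Proof.
rewrite lerD2l lerN2; case/andP: v01 => v0 v1.
rewrite (le_trans (ler_norm _))// normrM (ger0_norm v0).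
by rewrite -[leRHS]mulr1 ler_pM.
Qed.

Lemma appB (x y : 'I_n -> R) i :
  app A x i - app A y i = app A (fun j => x j - y j) i.
Proof. by rewrite /app -sumrB; apply: eq_bigr => j _; rewrite mulrBr. Qed.

Lemma nrm_ctr (x y : 'I_n -> R) :
  (forall i, `|y i| <= `|x i| + \sum_j `|A i j| * `|y j|) -> nrm y <= nrm x * b.
Proof.
move=> h; apply: nrm_le; first by rewrite mulr_ge0// nrm_ge0.
by rewrite exprMn nrm_sqr /b exprVn; exact: (contraction_sq sA rowA rho1 h).
Qed.

Variable c : 'I_n -> R.

Let xi i := psi1 mu (c i).
Let D i := psi2 mu (c i).
(** The part of [D q] left over when the diagonal matrix [D] is replaced by its mean [v]; it is
    centered when the field is random. *)
Let p i := q i * (D i - v).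

Let u_xi i : `|u c i - xi i| <= `|app A (u c) i|.
Proof.
rewrite uE /xi (le_trans (psi1_lip hmu _ _))//.
by have -> : app A (u c) i + c i - c i = app A (u c) i by rewrite addrK.
Qed.

(** Controls [A u], which is nonlinear in the field, by [A xi], which is linear in independent
    variables and has computable moments. *)
Let Au_ctr i : `|app A (u c) i| <= `|app A xi i| + \sum_j `|A i j| * `|app A (u c) j|.
Proof.
have -> : app A (u c) i = app A xi i + app A (fun j => u c j - xi j) i.
  by rewrite -appB addrC subrK.
rewrite (le_trans (ler_normD _ _))// lerD2l (le_trans (app_le _ _ _))//.
by apply: ler_sum => j _; rewrite ler_wpM2l.
Qed.

Let nrm_u_xi : nrm (fun i => u c i - xi i) <= nrm (app A xi) * b.
Proof.
apply: le_trans (nrm_ctr Au_ctr).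
rewrite ler_wsqrtr// ler_sum// => i _.
rewrite -(real_normK (num_real (u c i - xi i))).
by rewrite -(real_normK (num_real (app A (u c) i))) ler_pXn2r// nnegrE.
Qed.

(** These three conditions are all that the quenched estimate asks of the field; a small
    [field_stat] provides them. *)
Hypothesis s4 : \sum_i app A xi i ^+ 4 <= delta ^+ 4.
Hypothesis sD : `|\sum_i q i ^+ 2 * D i - v| <= delta.
Hypothesis sp : nrm (app A p) <= delta.

Let d0 : 0 <= delta. Proof. by case/andP: delta01. Qed.

Let Au4 : \sum_i app A (u c) i ^+ 4 <= (delta * b) ^+ 4.
Proof.
apply: (le_trans (contraction_pow4 sA rowA rho1 Au_ctr)).
by rewrite exprMn /b exprVn ler_wpM2r// invr_ge0 exprn_ge0// ltW.
Qed.

Let Au_sup i : `|app A (u c) i| <= delta * b.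
Proof.
rewrite -(@ler_pXn2r _ 4)// ?nnegrE ?mulr_ge0//.
apply: le_trans Au4; rewrite (bigD1 i)//=.
rewrite -normrX ger0_norm; last by rewrite (exprM _ 2 2) sqr_ge0.
by rewrite lerDl sumr_ge0// => j _; rewrite (exprM _ 2 2) sqr_ge0.
Qed.

Section tilted.
Variable l : R.

Let c' i := c i + l * q i.
Let Dl i := u c' i - u c i.
Let bl i := app A Dl i + l * q i.

Let Dl_bl i : `|Dl i| <= `|bl i|.
Proof.
rewrite /Dl !uE (le_trans (psi1_lip hmu _ _))//.
have -> : app A (u c') i + c' i - (app A (u c) i + c i) =
    (app A (u c') i - app A (u c) i) + l * q i.
  by rewrite /c'; ring.
by rewrite appB.
Qed.

Let bl_ctr i : `|bl i| <= `|l * q i| + \sum_j `|A i j| * `|bl j|.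
Proof.
rewrite /bl addrC (le_trans (ler_normD _ _))// lerD2l (le_trans (app_le _ _ _))//.
by apply: ler_sum => j _; rewrite ler_wpM2l.
Qed.

Let nrm_lq : nrm (fun i => l * q i) = `|l|.
Proof.
rewrite /nrm; under eq_bigr do rewrite exprMn.
by rewrite -mulr_sumr -(nrm_sqr q) q1 expr1n mulr1 sqrtr_sqr.
Qed.

Let nrm_bl : nrm bl <= `|l| * b.
Proof. by rewrite -nrm_lq; exact: nrm_ctr. Qed.

Let nrm_Dl : nrm Dl <= `|l| * b.
Proof.
apply: le_trans nrm_bl; rewrite ler_wsqrtr// ler_sum// => i _.
rewrite -(real_normK (num_real (Dl i))) -(real_normK (num_real (bl i))).
by rewrite ler_pXn2r// nnegrE.
Qed.

Let bl_sup i : `|bl i| <= `|l| * delta * b.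
Proof.
apply: (contraction_sup rowA rho1 _ bl_ctr) => j.
by rewrite normrM ler_wpM2l.
Qed.

(** There are two errors: the curvature of [psi1] along the step [bl i], which is small because [q]
    is small in sup norm, and the evaluation of [psi2] at [c i] instead of [app A (u c) i + c i]. *)
Let rem_le i : `|Dl i - D i * bl i| <= 4 * (`|l| * delta * b + delta * b) * `|bl i|.
Proof.
pose a := app A (u c) i + c i.
have E : Dl i - D i * bl i = (psi1 mu (a + bl i) - psi1 mu a - psi2 mu a * bl i)
   + (psi2 mu a - D i) * bl i.
  have -> : Dl i = psi1 mu (a + bl i) - psi1 mu a.
    have Ea : app A (u c') i + c' i = a + bl i.
      by rewrite /a /bl /Dl /c' -appB; ring.
    by rewrite /Dl !uE Ea.
  have ringid (x y s d z : R) : x - y - d * z = (x - y - s * z) + (s - d) * z.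
    by ring.
  exact: ringid.
rewrite E (le_trans (ler_normD _ _))//.
have h1 : `|psi1 mu (a + bl i) - psi1 mu a - psi2 mu a * bl i| <= 4 * bl i ^+ 2.
  have := psi1_taylor hmu a (a + bl i).
  by have -> : a + bl i - a = bl i by rewrite addrC addKr.
have h2 : `|(psi2 mu a - D i) * bl i| <= 4 * (delta * b) * `|bl i|.
  rewrite normrM ler_wpM2r// (le_trans (psi2_lip hmu _ _))// ler_wpM2l//.
  by have -> : a - c i = app A (u c) i by rewrite /a addrK.
have -> : 4 * (`|l| * delta * b + delta * b) * `|bl i| =
    4 * (`|l| * delta * b) * `|bl i| + 4 * (delta * b) * `|bl i|.
  by rewrite mulrDr mulrDl.
apply: lerD => //; apply: (le_trans h1).
have -> : 4 * bl i ^+ 2 = 4 * `|bl i| * `|bl i|.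
  by rewrite -mulrA -expr2 real_normK// num_real.
by rewrite ler_wpM2r// ler_wpM2l.
Qed.

(** To first order [Dl] is [D (A Dl + l q)]. Pairing it with [q], replacing [D] by [v], and moving
    [A] onto [q] and [p] by symmetry closes a scalar equation for [\sum_i q i * Dl i], because
    [A q = kappa q + e]. In the constant, 11 is 7 for the terms linear in [l] plus 4 for the
    quadratic one. *)
Lemma shift_response :
  `|(1 - kappa * v) * (\sum_i q i * Dl i) - l * v|
     <= 11 * b ^+ 2 * delta * (1 + `|l|) ^+ 2.
Proof.
case/andP: v01 => v0 v1.
have E : (1 - kappa * v) * (\sum_i q i * Dl i) - l * v =
  l * (\sum_i q i ^+ 2 * D i - v) + v * (\sum_i e i * Dl i)
  + (\sum_i app A p i * Dl i) + \sum_i q i * (Dl i - D i * bl i).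
  have E1 : \sum_i q i * (Dl i - D i * bl i) =
    \sum_i q i * Dl i - \sum_i (p i * app A Dl i) - v * \sum_i q i * app A Dl i
    - l * \sum_i q i ^+ 2 * D i.
    rewrite !mulr_sumr -!sumrB; apply: eq_bigr => i _.
    by rewrite /p /bl; ring.
  have E2 : \sum_i q i * app A Dl i = kappa * (\sum_i q i * Dl i) + \sum_i e i * Dl i.
    rewrite (app_sym sA) mulr_sumr -big_split/=; apply: eq_bigr => i _.
    by rewrite qE; ring.
  by rewrite E1 E2 (app_sym sA p Dl); ring.
have t1 : `|l * (\sum_i q i ^+ 2 * D i - v)| <= `|l| * delta.
  by rewrite normrM ler_wpM2l.
have t2 : `|v * (\sum_i e i * Dl i)| <= delta * (`|l| * b).
  rewrite normrM (ger0_norm v0) -[leRHS]mul1r ler_pM//.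
  by rewrite (le_trans (norm_sum_le _ _))// ler_pM ?nrm_ge0.
have t3 : `|\sum_i app A p i * Dl i| <= delta * (`|l| * b).
  by rewrite (le_trans (norm_sum_le _ _))// ler_pM ?nrm_ge0.
have t4 : `|\sum_i q i * (Dl i - D i * bl i)| <=
    4 * (`|l| * delta * b + delta * b) * (`|l| * b).
  have K0 : 0 <= 4 * (`|l| * delta * b + delta * b).
    by rewrite mulr_ge0// addr_ge0// !mulr_ge0.
  rewrite (le_trans (norm_sum_le _ _))// q1 mul1r; apply: nrm_le.
    by rewrite mulr_ge0// mulr_ge0.
  rewrite exprMn; apply: (@le_trans _ _
      ((4 * (`|l| * delta * b + delta * b)) ^+ 2 * nrm bl ^+ 2)).
    rewrite nrm_sqr mulr_sumr; apply: ler_sum => i _.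
    rewrite -(real_normK (num_real (Dl i - _))) -(real_normK (num_real (bl i))).
    by rewrite -exprMn ler_pXn2r// nnegrE mulr_ge0.
  by rewrite ler_wpM2l ?sqr_ge0// ler_pXn2r ?nnegrE ?nrm_ge0// mulr_ge0.
rewrite E.
apply: (@le_trans _ _ (`|l| * delta + delta * (`|l| * b) + delta * (`|l| * b) +
   4 * (`|l| * delta * b + delta * b) * (`|l| * b))).
  rewrite (le_trans (ler_normD _ _))// lerD// (le_trans (ler_normD _ _))// lerD//.
  by rewrite (le_trans (ler_normD _ _))// lerD.
set L := `|l|; have L0 : 0 <= L by exact: normr_ge0.
have -> : L * delta + delta * (L * b) + delta * (L * b) +
    4 * (L * delta * b + delta * b) * (L * b) =
  delta * (L * (1 + 2 * b + 4 * b ^+ 2) + 4 * b ^+ 2 * L ^+ 2) by ring.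
have -> : 11 * b ^+ 2 * delta * (1 + L) ^+ 2 =
   delta * (11 * b ^+ 2 * (1 + L) ^+ 2) by ring.
rewrite ler_wpM2l//.
have bb : 1 <= b ^+ 2 by rewrite expr_ge1.
have bbb : b <= b ^+ 2 by rewrite expr2 ler_peMr.
set B := b ^+ 2 in bb bbb *.
have h1 : L * (1 + 2 * b + 4 * B) <= L * (7 * B) by rewrite ler_wpM2l//; lra.
have h2 : 0 <= B * L by rewrite mulr_ge0//; lra.
have h3 : 0 <= B * L ^+ 2 by rewrite mulr_ge0 ?sqr_ge0//; lra.
have -> : 11 * B * (1 + L) ^+ 2 = 11 * B + 22 * (B * L) + 11 * (B * L ^+ 2) by ring.
have -> : 4 * B * L ^+ 2 = 4 * (B * L ^+ 2) by ring.
have h4 : L * (7 * B) = 7 * (B * L) by ring.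
lra.
Qed.

(** Adds the mean-field error at the shifted field, with constant 4, to the shift of the optimizer,
    with constant 11; the third power of [b] comes from dividing by [1 - kappa * v], which is at
    least [1 - rho]. *)
Lemma mean_response :
  `|\sum_i q i * (gmean mu A c' i - u c i) - l * (v / (1 - kappa * v))|
    <= 15 * b ^+ 3 * delta * (1 + `|l|) ^+ 2.
Proof.
have kv0 : 0 < 1 - kappa * v by exact: lt_le_trans r1 kv.
have h1 : `|\sum_i q i * (gmean mu A c' i - u c' i)| <= 4 * b ^+ 2 * delta.
  rewrite (le_trans (norm_sum_le _ _))// q1 mul1r; apply: nrm_le.
    by rewrite !mulr_ge0// sqr_ge0.
  apply: (le_trans (gmean_meanfield hmu sA A0 rowA rho0 rho1 (uE c') rowA2)).
  have -> : n%:R * (4 * alpha / (1 - rho) ^+ 2) ^+ 2 =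
      (4 * b ^+ 2 * (Num.sqrt n%:R * alpha)) ^+ 2.
    rewrite /b !exprMn sqr_sqrtr//; field; rewrite gt_eqF//.
  rewrite ler_pXn2r// ?nnegrE ?mulr_ge0 ?sqr_ge0 ?sqrtr_ge0//.
  by rewrite ler_wpM2l// mulr_ge0// sqr_ge0.
have h2 := shift_response.
have -> : \sum_i q i * (gmean mu A c' i - u c i) =
  \sum_i q i * (gmean mu A c' i - u c' i) + \sum_i q i * Dl i.
  by rewrite -big_split/=; apply: eq_bigr => i _; rewrite /Dl; ring.
set X := \sum_i _ in h1 *; set Y := \sum_i _ in h2 *.
have h3 : `|Y - l * (v / (1 - kappa * v))| <= 11 * b ^+ 3 * delta * (1 + `|l|) ^+ 2.
  have -> : Y - l * (v / (1 - kappa * v)) =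
     ((1 - kappa * v) * Y - l * v) / (1 - kappa * v) by field; rewrite gt_eqF.
  rewrite normrM normfV (gtr0_norm kv0).
  have -> : 11 * b ^+ 3 * delta * (1 + `|l|) ^+ 2 =
     11 * b ^+ 2 * delta * (1 + `|l|) ^+ 2 * b by ring.
  by rewrite ler_pM// ?invr_ge0 ?(ltW kv0)// /b lef_pV2// posrE.
rewrite -addrA (le_trans (ler_normD _ _))//.
have b23 : b ^+ 2 <= b ^+ 3 by rewrite [leRHS]exprS ler_peMl// sqr_ge0.
have L1 : 1 <= (1 + `|l|) ^+ 2 by rewrite expr_ge1// lerDl.
have h4 : 4 * b ^+ 2 * delta <= 4 * b ^+ 3 * delta * (1 + `|l|) ^+ 2.
  rewrite -[leLHS]mulr1 ler_pM// ?mulr_ge0 ?sqr_ge0//.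
  by rewrite ler_wpM2r// ler_wpM2l.
have -> : 15 * b ^+ 3 * delta * (1 + `|l|) ^+ 2 =
  4 * b ^+ 3 * delta * (1 + `|l|) ^+ 2 + 11 * b ^+ 3 * delta * (1 + `|l|) ^+ 2.
  by ring.
by rewrite lerD// (le_trans h1).
Qed.

End tilted.

Let Y (s : n.-tuple (measurableTypeR R)) : R := lin q s - \sum_i q i * u c i.

(** The left-hand difference vanishes at 0 and its derivative is the quantity bounded in
    [mean_response]; one mean value step adds a factor [|l|]. *)
Lemma quenched_log_mgf (l : R) :
  `|ln (gE mu A c (fun s => expR (l * Y s))) - v / (1 - kappa * v) * (l ^+ 2 / 2)|
    <= 15 * b ^+ 3 * delta * (1 + `|l|) ^+ 3.
Proof.
pose V := v / (1 - kappa * v).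
pose g (y : R) := ln (\int[iid_law mu n]_s expR (Ham A c s + y * lin q s))
   - y * (\sum_i q i * u c i) - V * (y ^+ 2 / 2).
have HE y : Ham A (fun i => c i + y * q i) = fun s => Ham A c s + y * lin q s.
  by apply/funext => s; rewrite Ham_field.
have bH := bm_Ham A c; have bq := bm_lin q.
have dg y : is_derive y (1 : R) g
    (\sum_i q i * (gmean mu A (fun i => c i + y * q i) i - u c i) - y * V).
  have d1 := is_derive_ln_Ex (iid_law mu n) y bH bq.
  have d2 : is_derive y (1 : R) (fun y => y * (\sum_i q i * u c i))
     (\sum_i q i * u c i).
    by apply: is_derive_eq; rewrite scaler0 add0r /GRing.scale/= mulr1.
  have d3 : is_derive y (1 : R) (fun y => V * (y ^+ 2 / 2)) (y * V).
    by apply: is_derive_eq; rewrite /GRing.scale/=; field.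
  have E : \sum_i q i * (gmean mu A (fun i => c i + y * q i) i - u c i) =
     tilt (iid_law mu n) (fun s => Ham A c s + y * lin q s) (lin q)
     - \sum_i q i * u c i.
    rewrite -HE -/(gE mu A _ _) gE_lin -sumrB.
    by apply: eq_bigr => i _; rewrite mulrBr.
  rewrite E; exact: (is_deriveB (is_deriveB d1 d2) d3).
have g0 : g 0 = ln (\int[iid_law mu n]_s expR (Ham A c s)).
  rewrite /g mul0r subr0 expr0n/= mul0r mulr0 subr0; congr (ln _).
  by apply: eq_Ex => s; rewrite mul0r addr0.
have gl : g l - g 0 = ln (gE mu A c (fun s => expR (l * Y s))) - V * (l ^+ 2 / 2).
  rewrite g0 /gE /tilt.
  have E : \int[iid_law mu n]_s (expR (l * Y s) * expR (Ham A c s)) =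
     \int[iid_law mu n]_s expR (Ham A c s + l * lin q s) *
       expR (- (l * (\sum_i q i * u c i))).
    rewrite -ExZr; last by bmg.
    by apply: eq_Ex => s; rewrite -!expRD /Y; congr expR; ring.
  have P1 : 0 < \int[iid_law mu n]_s expR (Ham A c s + l * lin q s).
    by apply: Ex_exp_gt0; bmg.
  have P2 : 0 < \int[iid_law mu n]_s expR (Ham A c s) by exact: Ex_exp_gt0.
  rewrite E ln_div ?posrE ?mulr_gt0 ?expR_gt0// lnM ?posrE ?expR_gt0// expRK.
  rewrite /g; move: (ln _) (ln _) (\sum_i _) => x1 x2 x3; ring.
rewrite -/V -gl; have [t /andP[t0 t1] ->] := mvt_cst 0 l dg.
rewrite subr0 add0r normrM.
have tl : `|t * l| <= `|l| by rewrite normrM ler_piMl// ger0_norm.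
have := mean_response (t * l); rewrite -/V => h.
have b30 : 0 <= 15 * b ^+ 3 * delta by rewrite !mulr_ge0// exprn_ge0.
have -> : 15 * b ^+ 3 * delta * (1 + `|l|) ^+ 3 =
    15 * b ^+ 3 * delta * (1 + `|l|) ^+ 2 * (1 + `|l|).
  by rewrite -[RHS]mulrA -exprSr.
apply: ler_pM; rewrite ?normr_ge0 ?lerDr ?ler01//.
by rewrite (le_trans h)// ler_wpM2l// ler_pXn2r ?nnegrE ?addr_ge0// lerD2l.
Qed.

Hypothesis se : `|\sum_i e i * xi i| <= delta.
Hypothesis spx : `|\sum_i p i * app A xi i| <= delta.
Hypothesis spn : nrm (app A p) * nrm (app A xi) <= delta.
Hypothesis sen : nrm e * nrm (app A xi) <= delta.

(** Expanding [u] at [c] leaves remainders quadratic in [A u], controlled by fourth powers. In each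
    error linear in [u], the part from [xi] is a polynomial in the field and the part from [u - xi]
    is bounded by a product of norms. The sum 2 + 2 b + 4 b^2 is at most 8 b^2. *)
Lemma optimizer_linear :
  `|(1 - kappa * v) * (\sum_i q i * u c i) - \sum_i q i * xi i|
    <= 8 * b ^+ 2 * delta.
Proof.
case/andP: v01 => v0 v1.
pose z i := u c i - xi i.
have rem i : `|z i - D i * app A (u c) i| <= 4 * app A (u c) i ^+ 2.
  have := psi1_taylor hmu (c i) (app A (u c) i + c i).
  have -> : app A (u c) i + c i - c i = app A (u c) i by rewrite addrK.
  by rewrite -uE.
have E : (1 - kappa * v) * (\sum_i q i * u c i) - \sum_i q i * xi i =
   v * (\sum_i e i * xi i + \sum_i e i * z i)
   + (\sum_i p i * app A xi i + \sum_i app A p i * z i)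
   + \sum_i q i * (z i - D i * app A (u c) i).
  have E1 : \sum_i q i * (z i - D i * app A (u c) i) =
     \sum_i q i * u c i - \sum_i q i * xi i - \sum_i p i * app A (u c) i
     - v * \sum_i q i * app A (u c) i.
    rewrite !mulr_sumr -!sumrB; apply: eq_bigr => i _.
    by rewrite /p /z; ring.
  have E2 : \sum_i q i * app A (u c) i = kappa * (\sum_i q i * u c i)
      + (\sum_i e i * xi i + \sum_i e i * z i).
    rewrite (app_sym sA) mulr_sumr -!big_split/=; apply: eq_bigr => i _.
    by rewrite qE /z; ring.
  have E3 : \sum_i p i * app A (u c) i =
     \sum_i p i * app A xi i + \sum_i app A p i * z i.
    rewrite -(app_sym sA p z) -big_split/=; apply: eq_bigr => i _.
    by rewrite /z -appB; ring.
  by rewrite E1 E2 E3; ring.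
have zn : nrm z <= nrm (app A xi) * b by exact: nrm_u_xi.
have t1 : `|\sum_i e i * z i| <= delta * b.
  rewrite (le_trans (norm_sum_le _ _))//.
  apply: (@le_trans _ _ (nrm e * (nrm (app A xi) * b))).
    by rewrite ler_wpM2l// nrm_ge0.
  by rewrite mulrA ler_wpM2r.
have t2 : `|\sum_i app A p i * z i| <= delta * b.
  rewrite (le_trans (norm_sum_le _ _))//.
  apply: (@le_trans _ _ (nrm (app A p) * (nrm (app A xi) * b))).
    by rewrite ler_wpM2l// nrm_ge0.
  by rewrite mulrA ler_wpM2r.
have t3 : `|\sum_i q i * (z i - D i * app A (u c) i)| <= 4 * (delta * b) ^+ 2.
  rewrite (le_trans (norm_sum_le _ _))// q1 mul1r; apply: nrm_le.
    by rewrite mulr_ge0// sqr_ge0.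
  rewrite exprMn -exprM; apply: le_trans (ler_wpM2l (sqr_ge0 4) Au4).
  rewrite mulr_sumr; apply: ler_sum => i _.
  rewrite -(real_normK (num_real (z i - _))) [_ ^+ 4](exprM _ 2 2) -exprMn.
  by rewrite ler_pXn2r// nnegrE mulr_ge0// sqr_ge0.
rewrite E.
apply: (@le_trans _ _ ((delta + delta * b) + (delta + delta * b) + 4 * (delta * b) ^+ 2)).
  rewrite (le_trans (ler_normD _ _))// lerD// (le_trans (ler_normD _ _))// lerD//.
    rewrite normrM (ger0_norm v0) -[leRHS]mul1r ler_pM//.
    by rewrite (le_trans (ler_normD _ _))// lerD.
  by rewrite (le_trans (ler_normD _ _))// lerD.
have bb : 1 <= b ^+ 2 by rewrite expr_ge1.
have bbb : b <= b ^+ 2 by rewrite expr2 ler_peMr.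
have dd : delta ^+ 2 <= delta by rewrite expr2 ler_piMr//; case/andP: delta01.
rewrite exprMn; set B := b ^+ 2 in bb bbb *.
have h1 : delta * b <= delta * B by rewrite ler_wpM2l.
have h2 : delta <= delta * B by rewrite ler_peMr.
have h3 : delta ^+ 2 * B <= delta * B by rewrite ler_wpM2r//; lra.
lra.
Qed.

End quenched.

(** * From moment generating functions to distribution functions *)

Section mgf_continuity.
Context {R : realType}.
Variable V : R.
Implicit Types (P : probability (measurableTypeR R) R) (h : R -> R).

(** Integrability is part of the definition, since the real-valued integral of a function of
    infinite mean is a default value. *)
Definition mgf_close (L d : R) P := forall l, `|l| <= L ->
  P.-integrable setT (EFin \o (fun x => expR (l * x))) /\
  `|\int[P]_x expR (l * x) - expR (V * (l ^+ 2 / 2))| <= d.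

Lemma mgf_closeW L L' d d' P : L <= L' -> d' <= d ->
  mgf_close L' d' P -> mgf_close L d P.
Proof.
move=> LL dd h l lL; have [h1 h2] := h l (le_trans lL LL).
by split => //; exact: le_trans dd.
Qed.

Definition growth h (K C : R) :=
  [/\ 0 <= K, 0 <= C & forall x, `|h x| <= C * expR (K * `|x|)].

Lemma expR_abs (K x : R) : 0 <= K ->
  expR (K * `|x|) <= expR (K * x) + expR (- K * x).
Proof.
move=> K0; have [x0|x0] := leP 0 x; first by rewrite ger0_norm// lerDl expR_ge0.
by rewrite ltr0_norm// mulrN mulNr lerDr expR_ge0.
Qed.

Lemma growth_integrable h K C L d P : measurable_fun setT h -> growth h K C ->
  K <= L -> mgf_close L d P ->
  P.-integrable setT (EFin \o h) /\
  `|\int[P]_x h x| <= C * (2 * (expR (V * (K ^+ 2 / 2)) + d)).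
Proof.
move=> mh [K0 C0 hK] KL cP.
have lK : `|K| <= L by rewrite ger0_norm.
have lNK : `|- K| <= L by rewrite normrN.
have [i1 b1] := cP K lK; have [i2 b2] := cP (- K) lNK.
have ig : P.-integrable setT (EFin \o (fun x => C * (expR (K * x) + expR (- K * x)))).
  have := integrableZl measurableT C (integrableD measurableT i1 i2).
  by apply: eq_integrable => // x _ /=; rewrite EFinM EFinD.
have hg x : `|h x| <= C * (expR (K * x) + expR (- K * x)).
  by rewrite (le_trans (hK x))// ler_wpM2l// expR_abs.
have ih : P.-integrable setT (EFin \o h).
  apply: (le_integrable measurableT _ _ ig); first exact/measurable_EFinP.
  by move=> x _ /=; rewrite lee_fin (le_trans (hg x))// ler_norm.
split => //.
rewrite (le_trans (le_normr_Rintegral measurableT ih))//.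
apply: (@le_trans _ _ (\int[P]_x (C * (expR (K * x) + expR (- K * x))))).
  apply: le_Rintegral => //.
  by have := integrable_abse ih; apply: eq_integrable.
rewrite RintegralZl//; last first.
  have := integrableD measurableT i1 i2.
  by apply: eq_integrable => // x _ /=; rewrite EFinD.
rewrite ler_wpM2l// RintegralD//.
move: b1 b2; rewrite sqrrN !ler_norml.
by set I1 := \int[P]_x _; set I2 := \int[P]_x _; set E := expR _; lra.
Qed.

(** A Cauchy form of continuity: two laws with moment generating functions close to the Gaussian one
    give close means of [h]. Comparing two laws avoids computing the limiting mean, and the normal
    law is later taken as one of the two. *)
Definition mcont h := [/\ measurable_fun setT h,
  exists K C, growth h K C &
  forall e, 0 < e -> exists L d, 0 < d /\ forall P P',
    mgf_close L d P -> mgf_close L d P' ->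
    `|\int[P]_x h x - \int[P']_x h x| <= e].

Lemma growthD h1 h2 K1 C1 K2 C2 : growth h1 K1 C1 -> growth h2 K2 C2 ->
  growth (fun x => h1 x + h2 x) (K1 + K2) (C1 + C2).
Proof.
move=> [K10 C10 g1] [K20 C20 g2]; split; rewrite ?addr_ge0// => x.
rewrite (le_trans (ler_normD _ _))// mulrDl lerD//.
  by rewrite (le_trans (g1 x))// ler_wpM2l// ler_expR ler_wpM2r// lerDl.
by rewrite (le_trans (g2 x))// ler_wpM2l// ler_expR ler_wpM2r// lerDr.
Qed.

Lemma mcont_exp l : mcont (fun x => expR (l * x)).
Proof.
split.
- by apply: measurableT_comp => //; exact: measurable_funM.
- exists `|l|, 1; split => // x; rewrite mul1r ger0_norm ?expR_ge0// ler_expR.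
  by rewrite (le_trans (ler_norm _))// normrM.
- move=> e e0; exists `|l|, (e / 2); split => [|P P' cP cP']; first by rewrite divr_gt0.
  have [_ b1] := cP l (lexx _); have [_ b2] := cP' l (lexx _).
  move: b1 b2; rewrite !ler_norml.
  by set I1 := \int[P]_x _; set I2 := \int[P']_x _; set E := expR _; lra.
Qed.

Lemma mcontZ a h : mcont h -> mcont (fun x => a * h x).
Proof.
move=> [mh [K [C [K0 C0 g]]] ch]; split.
- exact: measurable_funM.
- exists K, (`|a| * C); split; rewrite ?mulr_ge0// => x.
  by rewrite normrM -mulrA ler_wpM2l.
- move=> e e0.
  have [L [d [d0 H]]] := ch (e / (`|a| + 1)) (divr_gt0 e0 (ltr_wpDl (normr_ge0 a) ltr01)).
  exists (Num.max L K), d; split => // P P' cP cP'.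
  have LL : L <= Num.max L K by rewrite le_max lexx.
  have KL : K <= Num.max L K by rewrite le_max lexx orbT.
  have gh : growth h K C by [].
  have [i1 _] := growth_integrable mh gh KL cP.
  have [i2 _] := growth_integrable mh gh KL cP'.
  rewrite !RintegralZl// -mulrBr normrM.
  have := H P P' (mgf_closeW LL (lexx _) cP) (mgf_closeW LL (lexx _) cP').
  rewrite ler_pdivlMr ?ltr_wpDl//; apply: le_trans.
  by rewrite mulrC ler_wpM2l// lerDl.
Qed.

Lemma mcontD h1 h2 : mcont h1 -> mcont h2 -> mcont (fun x => h1 x + h2 x).
Proof.
move=> [m1 [K1 [C1 g1]] c1] [m2 [K2 [C2 g2]] c2]; split.
- exact: measurable_funD.
- by exists (K1 + K2), (C1 + C2); exact: growthD.
- move=> e e0; have e20 : 0 < e / 2 by rewrite divr_gt0.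
  have [L1 [d1 [d10 H1]]] := c1 _ e20; have [L2 [d2 [d20 H2]]] := c2 _ e20.
  pose L := Num.max (Num.max L1 L2) (Num.max K1 K2).
  pose d := Num.min d1 d2.
  have [L1L L2L] : L1 <= L /\ L2 <= L by rewrite !le_max !lexx ?orbT.
  have [K1L K2L] : K1 <= L /\ K2 <= L by rewrite !le_max !lexx ?orbT.
  have [dd1 dd2] : d <= d1 /\ d <= d2 by rewrite !ge_min !lexx orbT.
  exists L, d; split => [|P P' cP cP']; first by rewrite lt_min d10.
  have [i1 _] := growth_integrable m1 g1 K1L cP.
  have [i1' _] := growth_integrable m1 g1 K1L cP'.
  have [i2 _] := growth_integrable m2 g2 K2L cP.
  have [i2' _] := growth_integrable m2 g2 K2L cP'.
  rewrite !RintegralD// opprD addrACA.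
  have := H1 P P' (mgf_closeW L1L dd1 cP) (mgf_closeW L1L dd1 cP').
  have := H2 P P' (mgf_closeW L2L dd2 cP) (mgf_closeW L2L dd2 cP').
  move=> b2 b1; apply: (le_trans (ler_normD _ _)).
  by rewrite (splitr e) lerD.
Qed.

(** Approximation relative to an exponential weight is enough, because closeness of the generating
    functions bounds the exponential moments uniformly. *)
Lemma mcont_lim h K : 0 <= K -> measurable_fun setT h ->
  (forall e, 0 < e -> exists2 g, mcont g &
     forall x, `|h x - g x| <= e * expR (K * `|x|)) -> mcont h.
Proof.
move=> K0 mh app; split => //.
  have [g [mg [K1 [C1 [K10 C10 g1]]] _] hg] := app 1 ltr01.
  exists (K1 + K), (C1 + 1); split; rewrite ?addr_ge0// => x.
  rewrite -(subrK (g x) (h x)) addrC (le_trans (ler_normD _ _))// mulrDl lerD//.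
    by rewrite (le_trans (g1 x))// ler_wpM2l// ler_expR ler_wpM2r// lerDl.
  by rewrite (le_trans (hg x))// ler_wpM2l// ler_expR ler_wpM2r// lerDr.
(* Bounds the mean of exp(K |x|) under every law that is close up to 1 on a range containing [K]. *)
move=> e e0; pose B := 2 * (expR (V * (K ^+ 2 / 2)) + 1).
have B0 : 0 < B by rewrite mulr_gt0// addr_gt0// expR_gt0.
have eB0 : 0 < e / (4 * B) by rewrite divr_gt0// mulr_gt0.
have [g [mg [K1 [C1 g1]] cg] hg] := app _ eB0.
have e20 : 0 < e / 2 by rewrite divr_gt0.
have [L1 [d1 [d10 H1]]] := cg _ e20.
pose L := Num.max L1 (Num.max K1 K).
pose d := Num.min d1 1.
have [L1L K1L KL] : [/\ L1 <= L, K1 <= L & K <= L].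
  by split; rewrite !le_max !lexx ?orbT.
have [dd1 d_1] : d <= d1 /\ d <= 1 by rewrite !ge_min !lexx orbT.
exists L, d; split => [|P P' cP cP']; first by rewrite lt_min d10 ltr01.
have grow : growth (fun x => h x - g x) K (e / (4 * B)) by split => //; exact: ltW.
have mhg : measurable_fun setT (fun x => h x - g x) by exact: measurable_funB.
have key Q : mgf_close L d Q -> `|\int[Q]_x h x - \int[Q]_x g x| <= e / 4.
  move=> cQ.
  have [ig _] := growth_integrable mg g1 K1L cQ.
  have [ihg bhg] := growth_integrable mhg grow KL cQ.
  have ih : Q.-integrable setT (EFin \o h).
    have := integrableD measurableT ihg ig.
    by apply: eq_integrable => // x _ /=; rewrite -EFinD subrK.
  rewrite -RintegralB//; apply: (le_trans bhg).
  apply: (@le_trans _ _ (e / (4 * B) * B)).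
    by rewrite ler_wpM2l ?(ltW eB0)// ler_wpM2l// lerD2l.
  by rewrite le_eqVlt; apply/orP; left; apply/eqP; field; rewrite gt_eqF.
have := H1 P P' (mgf_closeW L1L dd1 cP) (mgf_closeW L1L dd1 cP').
have := key P cP; have := key P' cP'.
rewrite !ler_norml; set a := \int[P]_x h x; set a' := \int[P']_x h x.
by set b := \int[P]_x g x; set b' := \int[P']_x g x; lra.
Qed.

Lemma expR_sub1_sub (y : R) : `|expR y - 1 - y| <= y ^+ 2 * expR `|y|.
Proof.
have dexp (x : R) : is_derive x (1 : R) expR (expR x) by exact: is_derive_expR.
have [t /andP[t0 t1]] := mvt_cst 0 y dexp.
rewrite expR0 add0r !subr0 => ->.
have [s /andP[s0 s1]] := mvt_cst 0 (t * y) dexp.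
rewrite expR0 add0r !subr0 => E.
have -> : expR (t * y) * y - y = (expR (t * y) - 1) * y by ring.
rewrite E !normrM.
rewrite (ger0_norm (expR_ge0 _)) (ger0_norm t0).
rewrite -(real_normK (num_real y)).
have h1 : expR (s * (t * y)) <= expR `|y|.
  rewrite ler_expR (le_trans (ler_norm _))// !normrM (ger0_norm s0) (ger0_norm t0).
  by rewrite mulrA ler_piMl// mulr_ile1.
have -> : expR (s * (t * y)) * (t * `|y|) * `|y| =
   (t * `|y| ^+ 2) * expR (s * (t * y)) by ring.
by rewrite ler_pM ?mulr_ge0 ?sqr_ge0 ?expR_ge0// ler_piMl// sqr_ge0.
Qed.

Lemma exprn_le_expR (x : R) k : 0 <= x -> x ^+ k <= k`!%:R * expR x.
Proof.
move=> x0; have f0 m : 0 < m`!%:R :> R by rewrite ltr0n fact_gt0.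
case: k => [|k]; first by rewrite expr0 fact0 mul1r (le_trans _ (expR_ge1Dx x))// lerDl.
rewrite mulrC -ler_pdivrMr//; apply: le_trans (expR_ge1Dxn k x0).
by rewrite lerDr.
Qed.

(** Each further power of x is a limit of difference quotients in [l], so that moments are reached
    without differentiating the generating functions themselves. *)
Lemma mcont_Xexp k l : mcont (fun x => x ^+ k * expR (l * x)).
Proof.
elim: k l => [|k IH] l.
  rewrite (_ : (fun _ => _) = fun x => expR (l * x)); first exact: mcont_exp.
  by apply/funext => x; rewrite expr0 mul1r.
(* Of the 2, one unit pays for the exponential in the second-order remainder and one for |x|^(k+2)
   <= (k+2)! exp |x|, which also explains the factorial in the step [r]. *)
apply: (@mcont_lim _ (`|l| + 2)).
- by rewrite addr_ge0.
- apply: measurable_funM; first exact: measurable_funX.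
  by apply: measurableT_comp => //; exact: measurable_funM.
move=> e e0; have f0 : 0 < (k.+2)`!%:R :> R by rewrite ltr0n fact_gt0.
pose r := Num.min 1 (e / (k.+2)`!%:R).
have r0 : 0 < r by rewrite lt_min ltr01 divr_gt0.
have [rl1 re] : r <= 1 /\ r <= e / (k.+2)`!%:R by rewrite !ge_min !lexx orbT.
exists (fun x => r^-1 * (x ^+ k * expR ((l + r) * x) + -1 * (x ^+ k * expR (l * x)))).
  by apply: mcontZ; apply: mcontD; [exact: IH|apply: mcontZ; exact: IH].
move=> x.
have -> : x ^+ k.+1 * expR (l * x) -
    r^-1 * (x ^+ k * expR ((l + r) * x) + -1 * (x ^+ k * expR (l * x))) =
  - (r^-1 * x ^+ k * expR (l * x) * (expR (r * x) - 1 - r * x)).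
  by rewrite mulrDl expRD exprS; field; rewrite gt_eqF.
rewrite normrN !normrM normfV (gtr0_norm r0) (ger0_norm (expR_ge0 _)) normrX.
have h1 := expR_sub1_sub (r * x).
have h2 : expR `|r * x| <= expR `|x|.
  by rewrite ler_expR normrM (gtr0_norm r0) ler_piMl.
have h3 : expR (l * x) <= expR (`|l| * `|x|).
  by rewrite ler_expR -normrM ler_norm.
have h4 := exprn_le_expR k.+2 (normr_ge0 x).
apply: (@le_trans _ _ (r^-1 * `|x| ^+ k * expR (`|l| * `|x|) *
    (r ^+ 2 * `|x| ^+ 2 * expR `|x|))).
  apply: ler_pM; rewrite ?mulr_ge0 ?invr_ge0 ?expR_ge0 ?exprn_ge0// ?(ltW r0)//.
    by rewrite ler_wpM2l// mulr_ge0 ?invr_ge0 ?exprn_ge0// ltW.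
  apply: (le_trans h1); rewrite exprMn (real_normK (num_real x)) ler_wpM2l//.
  by rewrite mulr_ge0 ?sqr_ge0.
have -> : r^-1 * `|x| ^+ k * expR (`|l| * `|x|) * (r ^+ 2 * `|x| ^+ 2 * expR `|x|)
   = r * `|x| ^+ k.+2 * (expR (`|l| * `|x|) * expR `|x|).
  by rewrite !exprS; field; rewrite gt_eqF.
apply: (@le_trans _ _ (e * expR `|x| * (expR (`|l| * `|x|) * expR `|x|))).
  rewrite ler_wpM2r ?mulr_ge0 ?expR_ge0//.
  apply: (@le_trans _ _ (e / (k.+2)`!%:R * ((k.+2)`!%:R * expR `|x|))).
    by apply: ler_pM => //; rewrite ?exprn_ge0// ltW.
  by rewrite mulrA divfK// gt_eqF.
rewrite -mulrA -!expRD ler_wpM2l ?(ltW e0)// ler_expR.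
by rewrite le_eqVlt; apply/orP; left; apply/eqP; ring.
Qed.

Lemma mcont_poly (p : {poly R}) : mcont (horner p).
Proof.
have mc0 : mcont (fun=> 0).
  rewrite (_ : (fun=> 0) = fun x => 0 * expR (0 * x)); last first.
    by apply/funext => x; rewrite mul0r.
  by apply: mcontZ; exact: mcont_exp.
have E : (fun x => \sum_(i < size p) p`_i * x ^+ i) = horner p.
  by apply/funext => x; rewrite horner_coef.
rewrite -E; move: (size p) => m.
elim: m => [|m IH].
  by rewrite (_ : (fun _ => _) = fun=> 0)//; apply/funext => x; rewrite big_ord0.
rewrite (_ : (fun _ => _) = fun x => \sum_(i < m) p`_i * x ^+ i + p`_m * x ^+ m).
  apply: mcontD => //; apply: mcontZ.
  rewrite (_ : (fun _ => _) = fun x => x ^+ m * expR (0 * x)); first exact: mcont_Xexp.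
  by apply/funext => x; rewrite mul0r expR0 mulr1.
by apply/funext => x; rewrite big_ord_recr.
Qed.

(** The growth in the radius [W] is explicit because the Taylor polynomials of the sine at z are
    bounded only by exp |z|, which is the radius used later. *)
Lemma poly_lip (p : {poly R}) : exists C m, 0 <= C /\ forall W a b,
  1 <= W -> `|a| <= W -> `|b| <= W ->
  `|p.[a]| <= C * W ^+ m /\ `|p.[a] - p.[b]| <= C * W ^+ m * `|a - b|.
Proof.
elim/poly_ind: p => [|p c [C [m [C0 H]]]].
  exists 0, 0%N; split => // W a b W1 aW bW.
  by rewrite !horner0 subr0 normr0 !mul0r.
exists (2 * C + `|c|), m.+1; split => [|W a b W1 aW bW]; first by rewrite addr_ge0 ?mulr_ge0.
have W0 : 0 <= W by lra.
have [h1 h2] := H W a b W1 aW bW; have [h3 _] := H W b a W1 bW aW.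
have CW : 0 <= C * W ^+ m by rewrite mulr_ge0// exprn_ge0.
have Wm : 1 <= W ^+ m.+1 by rewrite exprn_ege1.
have E2 : C * W ^+ m * W = C * W ^+ m.+1 by rewrite exprSr mulrA.
rewrite !hornerMXaddC; split.
  have pa : `|p.[a] * a| <= C * W ^+ m.+1 by rewrite -E2 normrM ler_pM.
  have cw : `|c| <= `|c| * W ^+ m.+1 by rewrite ler_peMr.
  have Cw : 0 <= C * W ^+ m.+1 by rewrite mulr_ge0//; lra.
  rewrite (le_trans (ler_normD _ _))// mulrDl.
  by set w := W ^+ m.+1 in pa cw Cw *; lra.
rewrite opprD addrACA subrr addr0.
have -> : p.[a] * a - p.[b] * b = (p.[a] - p.[b]) * a + p.[b] * (a - b) by ring.
rewrite (le_trans (ler_normD _ _))// !normrM.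
apply: (@le_trans _ _ (C * W ^+ m * `|a - b| * W + C * W ^+ m * `|a - b|)).
  by rewrite lerD// ?ler_pM// ler_wpM2r.
have W2 : C * W ^+ m <= C * W ^+ m.+1 by rewrite -E2 ler_peMr.
have -> : C * W ^+ m * `|a - b| * W + C * W ^+ m * `|a - b| =
  (C * W ^+ m.+1 + C * W ^+ m) * `|a - b| by rewrite -E2; ring.
rewrite ler_wpM2r//.
have : 0 <= `|c| * W ^+ m.+1 by rewrite mulr_ge0//; lra.
by rewrite mulrDl; set w := W ^+ m.+1 in W2 *; lra.
Qed.

End mgf_continuity.

(** * Taylor polynomials of the sine and approximate step functions *)

Section sine_series.
Context {R : realType}.

Lemma exp_coeff_sum_le (y : R) a n : 0 <= y ->
  \sum_(a <= i < n) exp_coeff y i <= expR y.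
Proof.
move=> y0; have e0 i : 0 <= exp_coeff y i.
  by rewrite /exp_coeff/= divr_ge0 ?exprn_ge0.
apply: (@le_trans _ _ (series (exp_coeff y) n)).
  rewrite /series/=; have [an|na] := leqP a n; last first.
    by rewrite big_geq ?(ltnW na)// sumr_ge0.
  by rewrite [leRHS](big_cat_nat (leq0n a) an)/= lerDr sumr_ge0.
apply: nondecreasing_cvgn_le; last exact: is_cvg_series_exp_coeff.
by apply/nondecreasing_seqP => k; rewrite seriesS lerDr.
Qed.

Lemma sin_coeff_le (x : R) i : `|sin_coeff x i| <= exp_coeff `|x| i.
Proof.
rewrite /exp_coeff /sin_coeff /=.
rewrite !normrM normfV !normr_nat !normrX normrN normr1 expr1n mulr1.
by case: odd; [rewrite mul1r| rewrite !mul0r divr_ge0].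
Qed.

Lemma sin_partial_le (x : R) J : `|series (sin_coeff x) J| <= expR `|x|.
Proof.
apply: le_trans (exp_coeff_sum_le 0 J (normr_ge0 x)).
by rewrite (le_trans (ler_norm_sum _ _ _))// ler_sum// => i _; exact: sin_coeff_le.
Qed.

(** In the tail i >= J, inserting 2^i / 2^J >= 1 into the exponential series of [|x|] gives 2^-J
    times the series of [2 * |x|]. *)
Lemma sin_taylor (x : R) J :
  `|sin x - series (sin_coeff x) J| <= 2 ^- J * expR (2 * `|x|).
Proof.
have c : (fun N => `|series (sin_coeff x) N - series (sin_coeff x) J|) @ \oo
    --> `|sin x - series (sin_coeff x) J|.
  apply: cvg_norm; apply: cvgB; last exact: cvg_cst.
  by rewrite sin.unlock; exact: is_cvg_series_sin_coeff.
apply: (cvgr_to_le c); exists J => //= N /= JN.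
rewrite /series/= [X in `|X - _|](big_cat_nat (leq0n J) JN)/= addrAC subrr add0r.
rewrite (le_trans (ler_norm_sum _ _ _))//.
apply: (@le_trans _ _ (\sum_(J <= i < N) 2 ^- J * exp_coeff (2 * `|x|) i)); last first.
  by rewrite -mulr_sumr ler_wpM2l ?invr_ge0 ?exprn_ge0// exp_coeff_sum_le// mulr_ge0.
rewrite big_nat_cond [leRHS]big_nat_cond; apply: ler_sum => i /andP[/andP[Ji _] _].
rewrite (le_trans (sin_coeff_le _ _))// /exp_coeff/= exprMn mulrA.
rewrite ler_wpM2r ?invr_ge0// mulrA ler_peMl ?exprn_ge0//.
rewrite mulrC ler_pdivlMr ?exprn_gt0// mul1r.
by rewrite ler_weXn2l// ler1n.
Qed.

Lemma series_sin_poly J : exists p : {poly R},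
  forall x, series (sin_coeff x) J = p.[x].
Proof.
exists (\poly_(i < J) ((odd i)%:R * (-1) ^+ i.-1./2 / i`!%:R)) => x.
rewrite horner_poly /series/= big_mkord; apply: eq_bigr => i _.
by rewrite /sin_coeff/= mulrAC.
Qed.

(* the smooth step [(1 - y ^+ k) ^+ 2 ^ k], decreasing from [1] to [0] across
   [y = 1 / 2] (Bernoulli's inequality) *)
Definition step k (y : R) : R := (1 - y ^+ k) ^+ (2 ^ k).

Lemma step01 k y : 0 <= y <= 1 -> 0 <= step k y <= 1.
Proof.
move=> /andP[y0 y1]; have yk0 : 0 <= y ^+ k by exact: exprn_ge0.
have yk1 : y ^+ k <= 1 by rewrite exprn_ile1.
by rewrite /step exprn_ge0 ?subr_ge0// exprn_ile1// ?subr_ge0// gerBl.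
Qed.

Lemma bernoulli_sub (x : R) m : 0 <= x <= 1 -> 1 - m%:R * x <= (1 - x) ^+ m.
Proof.
move=> /andP[x0 x1]; elim: m => [|m IH]; first by rewrite mul0r subr0 expr0.
rewrite exprS; apply: (@le_trans _ _ ((1 - x) * (1 - m%:R * x))); last first.
  by rewrite ler_wpM2l// subr_ge0.
rewrite -natr1; set M := m%:R; have M0 : 0 <= M * x ^+ 2 by rewrite mulr_ge0 ?sqr_ge0.
by rewrite (_ : (1 - x) * (1 - M * x) = 1 - (M + 1) * x + M * x ^+ 2); [lra|ring].
Qed.

Lemma step_ge k y : 0 <= y <= 1 -> 1 - (2 * y) ^+ k <= step k y.
Proof.
move=> /andP[y0 y1]; rewrite exprMn -natrX /step; apply: bernoulli_sub.
by rewrite exprn_ge0//= exprn_ile1.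
Qed.

(** With x = y^k and m = 2^k, the product (1 - x)^m (1 + x)^m is at most 1, while (1 + x)^m >= m x =
    (2 y)^k. *)
Lemma step_le k y : 0 <= y <= 1 -> step k y * (2 * y) ^+ k <= 1.
Proof.
move=> /andP[y0 y1]; have yk0 : 0 <= y ^+ k by exact: exprn_ge0.
have yk1 : y ^+ k <= 1 by rewrite exprn_ile1.
apply: (@le_trans _ _ (step k y * (1 + y ^+ k) ^+ (2 ^ k))).
  rewrite ler_wpM2l ?exprn_ge0 ?subr_ge0// exprMn -natrX.
  have : forall m, m%:R * y ^+ k <= (1 + y ^+ k) ^+ m.
    elim=> [|m IH]; first by rewrite mul0r expr0.
    rewrite exprS mulrDl mul1r -natr1 mulrDl mul1r; apply: lerD => //.
    by rewrite ler_peMr// exprn_ege1// lerDl.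
  exact.
rewrite /step -exprMn exprn_ile1//.
  by rewrite mulr_ge0 ?subr_ge0// addr_ge0.
have -> : (1 - y ^+ k) * (1 + y ^+ k) = 1 - (y ^+ k) ^+ 2 by ring.
by rewrite gerBl sqr_ge0.
Qed.

End sine_series.

(** * Densities and the normal law *)

Section density.
Context {d : measure_display} {T : measurableType d} {R : realType}.
Variables (nu : {finite_measure set T -> \bar R})
  (m : {sigma_finite_measure set T -> \bar R}).
Local Open Scope ereal_scope.

(** A density in the sense of set integrals is almost everywhere the Radon-Nikodym derivative, for
    which the change of variables is available. *)
Lemma ge0_integral_density (g f : T -> \bar R) :
  m.-integrable setT g ->
  (forall A, measurable A -> nu A = \int[m]_(x in A) g x) ->
  measurable_fun setT f -> (forall x, 0 <= f x) ->
  \int[nu]_x f x = \int[m]_x (f x * g x).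
Proof.
move=> ig nug mf f0.
have dom : nu `<< m.
  apply/null_content_dominatesP => A mA mA0; rewrite nug//.
  apply: null_set_integral => //; exact: (measurable_funTS (measurable_int _ ig)).
rewrite -(Radon_Nikodym_SigmaFinite.change_of_variables dom)//.
apply: ae_eq_integral => //.
- apply: emeasurable_funM => //.
  exact: measurable_int (Radon_Nikodym_SigmaFinite.f_integrable dom).
- by apply: emeasurable_funM => //; exact: measurable_int ig.
- apply: ae_eqe_mul2l; apply: integral_ae_eq => //.
  + exact: Radon_Nikodym_SigmaFinite.f_integrable.
  + exact: measurable_int ig.
  + by move=> A _ mA; rewrite -nug// -Radon_Nikodym_SigmaFinite.f_integral.
Qed.

End density.

Section normal.
Context {R : realType}.
Variable V : R.
Hypothesis V0 : 0 < V.
Local Notation s := (Num.sqrt V).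
Local Notation N := (normal_prob 0 s).

Let s0 : s != 0. Proof. by rewrite gt_eqF// sqrtr_gt0. Qed.

(** Completing the square turns the tilted density into a constant times the normal density of mean
    [l * V]. *)
Lemma normal_mgf_ereal (l : R) :
  (\int[N]_x (expR (l * x))%:E = (expR (V * (l ^+ 2 / 2)))%:E)%E.
Proof.
rewrite (@ge0_integral_density _ _ _ N lebesgue_measure
  (fun x => (normal_pdf 0 s x)%:E)) => //.
- transitivity (\int[@lebesgue_measure R]_x
      ((expR (V * (l ^+ 2 / 2)))%:E * (normal_pdf (l * V) s x)%:E))%E.
    apply: eq_integral => x _; rewrite -!EFinM; congr EFin.
    rewrite !normal_pdfE// mulrCA [RHS]mulrCA; congr (_ * _).
    rewrite /normal_fun -!expRD; congr expR.
    by rewrite sqr_sqrtr ?(ltW V0)// -mulr_natr; field; rewrite gt_eqF.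
  rewrite ge0_integralZl//; first by rewrite integral_normal_pdf mule1.
  + by apply/measurable_EFinP; exact: measurable_normal_pdf.
  + by move=> x _; rewrite lee_fin normal_pdf_ge0.
- exact: integrable_normal_pdf.
- apply/measurable_EFinP; apply: measurableT_comp => //; exact: measurable_funM.
Qed.

Lemma normal_mgf_close L d : 0 <= d ->
  mgf_close V L d (N : probability (measurableTypeR R) R).
Proof.
move=> d0 l _; have E := normal_mgf_ereal l; split.
  apply/integrableP; split.
    by apply/measurable_EFinP; apply: measurableT_comp => //; exact: measurable_funM.
  under eq_integral do rewrite /= ger0_norm ?expR_ge0//.
  by rewrite E ltry.
by rewrite /Rintegral E/= subrr normr0.
Qed.

Lemma normal_cdf_lip a b : a <= b ->
  cdf_of N b <= cdf_of N a + normal_peak s * (b - a).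
Proof.
move=> ab; rewrite /cdf_of.
have fin (A : set (measurableTypeR R)) : measurable A -> N A \is a fin_num.
  exact: fin_num_measure.
rewrite (_ : `]-oo, b]%classic = `]-oo, a]%classic `|` `]a, b]%classic); last first.
  by rewrite -itv_bndbnd_setU.
rewrite measureU//=; last first.
  apply/seteqP; split => x //=; rewrite !in_itv/= => -[xa /andP[ax _]].
  by move: xa; rewrite leNgt ax.
rewrite fineD ?fin// lerD2l.
rewrite -lee_fin fineK ?fin// /normal_prob.
apply: (@le_trans _ _ (\int[lebesgue_measure]_(x in `]a, b]) (normal_peak s)%:E)%E).
  apply: ge0_le_integral => //.
  - by move=> x _; rewrite lee_fin normal_pdf_ge0.
  - apply: measurable_funTS; apply/measurable_EFinP; exact: measurable_normal_pdf.
  - by move=> x _; rewrite lee_fin normal_pdf_ub.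
rewrite integral_cst//= lebesgue_measure_itv/= lte_fin.
by move: ab; rewrite le_eqVlt => /predU1P[->|->];
  rewrite ?ltxx ?mule0 ?subrr ?mulr0// -EFinB -EFinM.
Qed.

End normal.

(** * Distribution functions compared through sine polynomials *)

Section ks.
Context {R : realType}.
Implicit Type P : probability (measurableTypeR R) R.

Lemma cdf_Ex P t : cdf_of P t = \int[P]_x \1_(`]-oo, t]%classic) x.
Proof. by rewrite /Rintegral integral_indic ?setIT//. Qed.

Lemma cdf_homo P : {homo cdf_of P : x y / x <= y}.
Proof.
move=> x y xy; rewrite /cdf_of fine_le ?fin_num_measure//.
apply: le_measure; rewrite ?inE//.
by apply: subset_itvl; rewrite bnd_simp.
Qed.

Lemma cdf_ge0 P t : 0 <= cdf_of P t.
Proof. by rewrite /cdf_of fine_ge0. Qed.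

Lemma cdf_le1 P t : cdf_of P t <= 1.
Proof.
rewrite /cdf_of -lee_fin fineK ?fin_num_measure//; exact: probability_le1.
Qed.

Variable V : R.

(** The sine is replaced by its Taylor polynomials. The error grows exponentially at the rate
    [(m%:R + 2) / M], which does not depend on the degree [J], and its prefactor is of order
    2^-J. *)
Lemma mcont_sin (p : {poly R}) M t : 0 < M ->
  mcont V (fun x => p.[sin ((x - t) / M)]).
Proof.
move=> M0; have [C [m [C0 H]]] := poly_lip p.
apply: (@mcont_lim _ _ _ ((m%:R + 2) / M)).
- by rewrite divr_ge0 ?addr_ge0// ltW.
- have ms : measurable_fun setT (fun x : R => sin ((x - t) / M)).
    apply: measurableT_comp.
      by apply: continuous_measurable_fun; exact: continuous_sin.
    by apply: measurable_funM => //; exact: measurable_funB.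
  have mp : measurable_fun setT (horner p).
    by case: (mcont_poly V p).
  exact: (measurableT_comp mp ms).
move=> e e0.
pose B := C * expR ((m%:R + 2) * (`|t| / M)).
have B0 : 0 <= B by rewrite mulr_ge0 ?expR_ge0.
have [J JB] : exists J : nat, B / e <= 2 ^+ J.
  exists (Num.truncn (B / e)).+1; apply: (le_trans (ltW (truncnS_gt _))).
  by rewrite -natrX ler_nat ltnW// ltn_expl.
have [sp spE] := @series_sin_poly R J.
exists (fun x => p.[series (sin_coeff ((x - t) / M)) J]).
  rewrite (_ : (fun _ => _) =
      horner (p \Po (sp \Po (M^-1 *: ('X - t%:P))))); first exact: mcont_poly.
  apply/funext => x; rewrite !horner_comp spE; congr (p.[sp.[_]]).
  by rewrite hornerZ hornerXsubC mulrC.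
move=> x; set z := (x - t) / M.
have W1 : 1 <= expR `|z| by rewrite -expR0 ler_expR.
have [_ h] := H (expR `|z|) _ _ W1 (le_trans (sin_max z) W1) (sin_partial_le z J).
apply: (le_trans h).
apply: (@le_trans _ _ (C * expR `|z| ^+ m * (2 ^- J * expR (2 * `|z|)))).
  by rewrite ler_wpM2l ?mulr_ge0 ?exprn_ge0 ?expR_ge0// sin_taylor.
have -> : C * expR `|z| ^+ m * (2 ^- J * expR (2 * `|z|)) =
    C * expR ((m%:R + 2) * `|z|) / 2 ^+ J.
  have -> : expR ((m%:R + 2) * `|z|) = expR `|z| ^+ m * expR (2 * `|z|).
    by rewrite mulrDl expRD expRM_natl.
  by rewrite -!mulrA; congr (_ * (_ * _)); rewrite mulrC.
have hz : expR ((m%:R + 2) * `|z|) <=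
    expR ((m%:R + 2) * (`|t| / M)) * expR ((m%:R + 2) / M * `|x|).
  rewrite -expRD ler_expR -mulrA -mulrDr ler_wpM2l ?addr_ge0//.
  rewrite /z normrM normfV (gtr0_norm M0) [M^-1 * _]mulrC -mulrDl.
  by rewrite ler_pM2r ?invr_gt0// [leRHS]addrC ler_normB.
rewrite ler_pdivrMr ?exprn_gt0//.
apply: (@le_trans _ _ (B * expR ((m%:R + 2) / M * `|x|))).
  by rewrite /B -mulrA ler_wpM2l.
rewrite [leRHS]mulrAC ler_wpM2r ?expR_ge0//.
by move: JB; rewrite ler_pdivrMr// mulrC.
Qed.

Lemma mcont_step k M t : 0 < M ->
  mcont V (fun x => step k ((1 + sin ((x - t) / M)) / 2)).
Proof.
move=> M0; have := mcont_sin ((1 - (2^-1 *: (1 + 'X)) ^+ k) ^+ (2 ^ k)) t M0.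
rewrite (_ : (fun _ => _.[_]) = fun x => step k ((1 + sin ((x - t) / M)) / 2))//.
apply/funext => x; rewrite /step !(hornerE, horner_exp).
by rewrite [2^-1 * _]mulrC.
Qed.

Lemma homo_sin (x y : R) : -1 <= x -> x <= y -> y <= 1 -> sin x <= sin y.
Proof.
move=> x1 xy y1; have p2 : 2 <= pi :> R by exact: pi_ge2.
rewrite leNgt ltr_sin ?in_itv/= -?leNgt//; lra.
Qed.

Lemma sin_gt0_1 (x : R) : 0 < x -> x <= 1 -> 0 < sin x.
Proof. by move=> x0 x1; apply: sin2_gt0; lra. Qed.

(** The smooth step [h] is almost 1 to the left of t - a and almost 0 to the right of t + a, as long
    as |x - t| < M. Farther out the periodicity of the sine spoils this, and the exponential weight
    [tail] takes over. *)
Lemma cdf_sandwich t a e : 0 < a -> 0 < e -> exists L d, 0 < d /\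
  forall P P', mgf_close V L d P -> mgf_close V L d P' ->
    cdf_of P (t - a) <= cdf_of P' (t + a) + e.
Proof.
(* Five errors: the step and the tail for each of the two laws, and the difference of the two means
   of [h]. *)
move=> a0 e0; pose eta := e / 5.
have eta0 : 0 < eta by rewrite divr_gt0.
pose B := expR `|t| * (2 * (expR (V * (1 ^+ 2 / 2)) + 1)).
have B0 : 0 < B by rewrite mulr_gt0 ?expR_gt0// mulr_gt0// addr_gt0// expR_gt0.
(* Large enough for the mean of [tail] to be at most [eta]; on |x - t| <= M the argument of the sine
   stays in [-1, 1], where the sine increases. *)
pose M := a + B / eta.
have BM : B / eta <= M by rewrite lerDr ltW.
have aM : a <= M by rewrite lerDl divr_ge0// ltW.
have M0 : 0 < M by exact: lt_le_trans aM.
have eM : expR (- M) * B <= eta.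
  rewrite expRN mulrC ler_pdivrMr ?expR_gt0//.
  apply: (@le_trans _ _ (eta * M)); first by rewrite mulrC -ler_pdivrMr.
  rewrite ler_pM2l//; apply: le_trans (expR_ge1Dx M); lra.
pose sg := sin (a / M).
have aM0 : 0 < a / M by rewrite divr_gt0.
have aM1 : a / M <= 1 by rewrite ler_pdivrMr// mul1r.
have sg0 : 0 < sg by exact: sin_gt0_1.
have sg1 : sg <= 1 by exact: sin_le1.
(* Outside the window, [2 * y x] is at least [1 + sg] or at most [1 - sg], which is below
   [(1 + sg)^-1]; this [k] makes the step accurate to [eta] on both sides. *)
have [k hk] : exists k : nat, eta^-1 <= (1 + sg) ^+ k.
  exists (Num.truncn (eta^-1 / sg)).+1.
  have h : eta^-1 / sg < (Num.truncn (eta^-1 / sg)).+1%:R by exact: truncnS_gt.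
  apply: (@le_trans _ _ (1 + (Num.truncn (eta^-1 / sg)).+1%:R * sg)).
    by move: h; rewrite ltr_pdivrMr// => /ltW h; rewrite (le_trans h)// lerDr.
  elim: (Num.truncn _).+1 => [|m IH]; first by rewrite mul0r addr0 expr0.
  rewrite exprS mulrDl mul1r -natr1 mulrDl mul1r addrA; apply: lerD => //.
  by rewrite ler_peMr ?(ltW sg0)// exprn_ege1// lerDl (ltW sg0).
pose y x := (1 + sin ((x - t) / M)) / 2.
have y01 x : 0 <= y x <= 1.
  by have := sin_geN1 ((x - t) / M); have := sin_le1 ((x - t) / M); rewrite /y; lra.
pose h x := step k (y x).
have h01 x : 0 <= h x <= 1 by exact: step01.
have [mh [K [C gh]] ch] := mcont_step k t M0.
have [L1 [d1 [d10 H1]]] := ch _ eta0.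
pose tail x := expR (- M) * expR `|x - t|.
have tail0 x : 0 <= tail x by rewrite mulr_ge0 ?expR_ge0.
have tail1 x : M <= `|x - t| -> 1 <= tail x.
  by move=> h1; rewrite /tail -expRD -expR0 ler_expR addrC subr_ge0.
have mtail : measurable_fun setT tail.
  apply: measurable_funM => //; apply: measurableT_comp => //.
  by apply: measurableT_comp => //; exact: measurable_funB.
have gtail : growth tail 1 (expR (- M) * expR `|t|).
  split; rewrite ?mulr_ge0 ?expR_ge0// => x.
  rewrite ger0_norm// /tail -mulrA ler_wpM2l ?expR_ge0// -expRD ler_expR mul1r.
  by rewrite [leRHS]addrC ler_normB.
have low x : x <= t - a -> 1 <= h x + eta + tail x.
  move=> xta; have /andP[hx0 _] := h01 x.
  have [xM|xM] := leP M `|x - t|; first by have := tail1 _ xM; lra.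
  have z1 : -1 <= (x - t) / M.
    by rewrite ler_pdivlMr// mulN1r; move: xM => /ltW; rewrite ler_norml; lra.
  have z2 : (x - t) / M <= - (a / M) by rewrite -mulNr ler_pM2r ?invr_gt0//; lra.
  have sz : sin ((x - t) / M) <= - sg.
    by rewrite -sinN; apply: homo_sin => //; lra.
  have hs := step_ge k (y01 x).
  have : (2 * y x) ^+ k <= eta.
    apply: (@le_trans _ _ ((1 + sg) ^- k)); last first.
      by rewrite -[eta]invrK lef_pV2 ?posrE ?invr_gt0// exprn_gt0//; lra.
    rewrite -exprVn; apply: lerXn2r.
    - by rewrite nnegrE mulr_ge0//; case/andP: (y01 x).
    - by rewrite nnegrE invr_ge0; lra.
    have -> : 2 * y x = 1 + sin ((x - t) / M) by rewrite /y; field.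
    apply: (@le_trans _ _ (1 - sg)); first by lra.
    by rewrite -div1r ler_pdivlMr; [nra|lra].
  by have := tail0 x; rewrite -/(h x) in hs; lra.
have high x : t + a < x -> h x <= eta + tail x.
  move=> xta; have /andP[_ hx1] := h01 x.
  have [xM|xM] := leP M `|x - t|; first by have := tail1 _ xM; lra.
  have z1 : (x - t) / M <= 1.
    by rewrite ler_pdivrMr// mul1r; move: xM => /ltW; rewrite ler_norml; lra.
  have z2 : a / M <= (x - t) / M by rewrite ler_pM2r ?invr_gt0//; lra.
  have sz : sg <= sin ((x - t) / M) by apply: homo_sin => //; lra.
  have hs := step_le k (y01 x).
  have : h x <= eta.
    have p0 : 0 < (1 + sg) ^+ k by rewrite exprn_gt0//; lra.
    apply: (@le_trans _ _ ((1 + sg) ^- k)); last first.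
      by rewrite -[eta]invrK lef_pV2 ?posrE ?invr_gt0.
    rewrite -div1r ler_pdivlMr//; apply: le_trans hs; rewrite -/(h x).
    apply: ler_wpM2l; first by case/andP: (h01 x).
    apply: lerXn2r; rewrite ?nnegrE; [lra|by rewrite mulr_ge0//; case/andP: (y01 x)|].
    have -> : 2 * y x = 1 + sin ((x - t) / M) by rewrite /y; field.
    lra.
  by have := tail0 x; lra.
pose L := Num.max L1 (Num.max K 1); pose d := Num.min d1 1.
have [L1L KL oL] : [/\ L1 <= L, K <= L & 1 <= L].
  by split; rewrite !le_max !lexx ?orbT.
have [dd1 d_1] : d <= d1 /\ d <= 1 by rewrite !ge_min !lexx orbT.
have d0 : 0 < d by rewrite lt_min d10 ltr01.
exists L, d; split => // P P' cP cP'.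
have tl Q : mgf_close V L d Q -> Q.-integrable setT (EFin \o tail) /\
    \int[Q]_x tail x <= eta.
  move=> cQ; have [it bt] := growth_integrable mtail gtail oL cQ; split => //.
  apply: le_trans (ler_norm _) _; apply: (le_trans bt); apply: le_trans eM.
  rewrite /B -mulrA ler_wpM2l ?expR_ge0// ler_wpM2l ?expR_ge0// ler_wpM2l//.
  by rewrite lerD2l.
have [it1 bt1] := tl P cP; have [it2 bt2] := tl P' cP'.
have [ih1 _] := growth_integrable mh gh KL cP.
have [ih2 _] := growth_integrable mh gh KL cP'.
have HH := H1 P P' (mgf_closeW L1L dd1 cP) (mgf_closeW L1L dd1 cP').
have cst_int (Q : probability (measurableTypeR R) R) r :
    Q.-integrable setT (EFin \o (fun=> r)) by apply: bm_integrable; exact: bm_cst.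
have ind_int (Q : probability (measurableTypeR R) R) r :
    Q.-integrable setT (EFin \o (\1_(`]-oo, r]%classic) : R -> R)).
  by apply: bm_integrable; exact: bm_indic.
have st1 : cdf_of P (t - a) <= \int[P]_x h x + eta + \int[P]_x tail x.
  have ihe : P.-integrable setT (EFin \o (fun x => h x + eta)).
    by have := integrableD measurableT ih1 (cst_int P eta); apply: eq_integrable.
  have E : \int[P]_x (h x + eta + tail x) = \int[P]_x h x + eta + \int[P]_x tail x.
    rewrite (RintegralD measurableT ihe it1).
    by rewrite (RintegralD measurableT ih1 (cst_int P eta)) Ex_cst.
  have iet : P.-integrable setT (EFin \o (fun x => h x + eta + tail x)).
    by have := integrableD measurableT ihe it1; apply: eq_integrable.
  rewrite cdf_Ex -E; apply: (le_Rintegral measurableT (ind_int P (t - a)) iet).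
  move=> x _; rewrite indicE; case: (boolP (x \in _)) => [|_].
    by rewrite inE/= in_itv/= => /low.
  case/andP: (h01 x) => hx0 _.
  by rewrite /= addr_ge0// addr_ge0// ltW.
have st2 : \int[P']_x h x <= cdf_of P' (t + a) + eta + \int[P']_x tail x.
  have iie : P'.-integrable setT
      (EFin \o (fun x => \1_(`]-oo, (t + a)]%classic) x + eta)).
    by have := integrableD measurableT (ind_int P' (t + a)) (cst_int P' eta);
      apply: eq_integrable.
  have E : \int[P']_x (\1_(`]-oo, (t + a)]%classic) x + eta + tail x) =
      cdf_of P' (t + a) + eta + \int[P']_x tail x.
    rewrite (RintegralD measurableT iie it2).
    by rewrite (RintegralD measurableT (ind_int P' _) (cst_int P' eta)) Ex_cst cdf_Ex.
  have iet : P'.-integrable setT (EFin \o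
      (fun x => \1_(`]-oo, (t + a)]%classic) x + eta + tail x)).
    by have := integrableD measurableT iie it2; apply: eq_integrable.
  rewrite -E; apply: (le_Rintegral measurableT ih2 iet).
  move=> x _; rewrite indicE; case: (boolP (x \in _)) => [_|].
    case/andP: (h01 x) => _ hx1.
    by rewrite /= -addrA ler_wpDr// addr_ge0// ltW.
  rewrite notin_setE/= in_itv/= => /negP; rewrite -ltNge => /high; rewrite add0r.
  by apply: le_trans.
move: HH; rewrite ler_norml => /andP[_ HH].
have E5 : e = 5 * eta by rewrite /eta; field.
by rewrite E5; move: st1 st2 HH; rewrite /h /y; set I1 := \int[P]_x step _ _;
  set I2 := \int[P']_x step _ _; lra.
Qed.

End ks.

Section ks_normal.
Context {R : realType}.
Implicit Type P : probability (measurableTypeR R) R.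
Variable V : R.

(** Chernoff's bound with the two parameters 1 and -1. *)
Lemma cdf_tail L d P t : 1 <= L -> d <= 1 -> mgf_close V L d P ->
  cdf_of P t <= expR t * (expR (V / 2) + 1) /\
  1 - cdf_of P t <= expR (- t) * (expR (V / 2) + 1).
Proof.
move=> L1 d1 cP.
have n1 : `|1 : R| <= L by rewrite normr1.
have nN1 : `|- 1 : R| <= L by rewrite normrN normr1.
have [i1 b1] := cP 1 n1; have [i2 b2] := cP (- 1) nN1.
have EV : V * (1 ^+ 2 / 2) = V / 2 by rewrite expr1n mul1r.
have EV' : V * ((- 1) ^+ 2 / 2) = V / 2 by rewrite sqrrN.
rewrite EV in b1; rewrite EV' in b2.
have ii : P.-integrable setT (EFin \o (\1_(`]-oo, t]%classic) : R -> R)).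
  by apply: bm_integrable; exact: bm_indic.
have i0 : P.-integrable setT (EFin \o (fun=> 1 : R)).
  by apply: bm_integrable; exact: bm_cst.
have Zl (f : R -> R) r : P.-integrable setT (EFin \o f) ->
    P.-integrable setT (EFin \o (fun x => r * f x)).
  by move=> if'; have := integrableZl measurableT r if'; apply: eq_integrable.
split.
  apply: (@le_trans _ _ (expR t * \int[P]_x expR (-1 * x))).
    rewrite -RintegralZl// cdf_Ex; apply: le_Rintegral => // [|x _].
      exact: Zl.
    rewrite indicE -expRD; case: (boolP (x \in _)) => [|_]; last by rewrite expR_ge0.
    rewrite inE/= in_itv/= => xt.
    by apply: (@le_trans _ _ (expR 0)); [rewrite expR0|rewrite ler_expR; lra].
  rewrite ler_pM2l ?expR_gt0//; move: b2; rewrite ler_norml => /andP[_].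
  by set I1 := \int[P]_x _; lra.
apply: (@le_trans _ _ (expR (- t) * \int[P]_x expR (1 * x))).
  rewrite -RintegralZl// cdf_Ex -[X in X - _](Ex_cst P) -RintegralB//.
  apply: le_Rintegral => // [||x _].
  - by have := integrableB measurableT i0 ii; apply: eq_integrable.
  - exact: Zl.
  rewrite indicE -expRD; case: (boolP (x \in _)) => [_|].
    by rewrite subrr expR_ge0.
  rewrite notin_setE/= in_itv/= => /negP; rewrite -ltNge => tx.
  rewrite subr0.
  by apply: (@le_trans _ _ (expR 0)); [rewrite expR0|rewrite ler_expR; lra].
rewrite ler_pM2l ?expR_gt0//; move: b1; rewrite ler_norml => /andP[_].
by set I1 := \int[P]_x _; lra.
Qed.

Hypothesis V0 : 0 < V.
Local Notation N := (normal_prob 0 (Num.sqrt V) : probability (measurableTypeR R) R).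

Lemma normal_cdf_le x y r : x <= y -> y - x <= r ->
  cdf_of N y <= cdf_of N x + r * normal_peak (Num.sqrt V).
Proof.
move=> xy xr; apply: (le_trans (normal_cdf_lip V0 xy)).
by rewrite lerD2l mulrC ler_wpM2r// normal_peak_ge0.
Qed.

(** Uniformity in t: the tails beyond T are handled by Chernoff's bound, and between finitely many
    grid points monotonicity of the distribution functions and the Lipschitz bound for the normal
    one suffice. *)
Lemma mgf_ks e : 0 < e -> exists L d, 0 < d /\
  forall P, mgf_close V L d P -> ks_dist P (centered_normal V) <= e.
Proof.
move=> e0; pose C := normal_peak (Num.sqrt V).
have C0 : 0 < C by apply: normal_peak_gt0; rewrite gt_eqF// sqrtr_gt0.
(* A displacement of [4 * a] changes the normal distribution function by at most e/2; the sandwich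
   spends the other half. *)
pose a := e / (8 * C).
have a0 : 0 < a by rewrite divr_gt0// mulr_gt0.
have aC : 4 * a * C = e / 2 by rewrite /a; field; rewrite gt_eqF.
have e20 : 0 < e / 2 by rewrite divr_gt0.
pose E := expR (V / 2) + 1.
have E0 : 0 < E by rewrite addr_gt0// expR_gt0.
pose T := E / e.
have T0 : 0 < T by rewrite divr_gt0.
have TE : expR (- T) * E <= e.
  rewrite expRN mulrC ler_pdivrMr ?expR_gt0// -ler_pdivrMl// mulrC -/T.
  by apply: le_trans (expR_ge1Dx T); lra.
have Ncl L d : 0 < d -> mgf_close V L d N by move=> d0; apply: normal_mgf_close => //; exact: ltW.
(* Induction on the number of cells of width [2 * a]: each new cell asks for two more sandwich
   conditions, so [L] and [d] remain a finite maximum and minimum. *)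
have grid k : exists L d, 0 < d /\ forall P, mgf_close V L d P ->
    forall t, - T <= t <= - T + k%:R * (2 * a) -> `|cdf_of P t - cdf_of N t| <= e.
  elim: k => [|k [L [d [d0 IH]]]]; last first.
    pose s := - T + k%:R * (2 * a).
    have [L1 [d1 [d10 H1]]] := cdf_sandwich V (s + 3 * a) a0 e20.
    have [L2 [d2 [d20 H2]]] := cdf_sandwich V (s - a) a0 e20.
    pose L' := Num.max L (Num.max L1 L2); pose d' := Num.min d (Num.min d1 d2).
    have [LL L1L L2L] : [/\ L <= L', L1 <= L' & L2 <= L'].
      by split; rewrite !le_max !lexx ?orbT.
    have [dd dd1 dd2] : [/\ d' <= d, d' <= d1 & d' <= d2].
      by split; rewrite !ge_min !lexx ?orbT.
    have d'0 : 0 < d' by rewrite !lt_min d0 d10.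
    exists L', d'; split => // P cP t /andP[Tt tT].
    have [ts|st] := leP t s; first by apply: (IH P (mgf_closeW LL dd cP)); rewrite Tt.
    have u1 := H1 P N (mgf_closeW L1L dd1 cP) (Ncl _ _ d10).
    have u2 := H2 N P (Ncl _ _ d20) (mgf_closeW L2L dd2 cP).
    have e1 : s + 3 * a - a = s + 2 * a by ring.
    have e2 : s + 3 * a + a = s + 4 * a by ring.
    have e3 : s - a - a = s - 2 * a by ring.
    have e4 : s - a + a = s by ring.
    rewrite e1 e2 in u1; rewrite e3 e4 in u2.
    have tS : t <= s + 2 * a by move: tT; rewrite -natr1 mulrDl mul1r addrA.
    have c1 := cdf_homo P tS; have c2 := cdf_homo P (ltW st).
    have c3 : cdf_of N (s + 4 * a) <= cdf_of N t + 4 * a * C.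
      by apply: normal_cdf_le; lra.
    have c4 : cdf_of N t <= cdf_of N (s - 2 * a) + 4 * a * C.
      by apply: normal_cdf_le; lra.
    rewrite aC in c3 c4; rewrite ler_norml.
    move: u1 u2 c1 c2 c3 c4; set x1 := cdf_of P _; set x2 := cdf_of N _.
    set x3 := cdf_of N _; set x4 := cdf_of P _; set x5 := cdf_of P _.
    by set x6 := cdf_of N _; lra.
  have [L1 [d1 [d10 H1]]] := cdf_sandwich V (- T + a) a0 e20.
  have [L2 [d2 [d20 H2]]] := cdf_sandwich V (- T - a) a0 e20.
  pose L' := Num.max L1 L2; pose d' := Num.min d1 d2.
  have [L1L L2L] : L1 <= L' /\ L2 <= L' by rewrite !le_max !lexx ?orbT.
  have [dd1 dd2] : d' <= d1 /\ d' <= d2 by rewrite !ge_min !lexx ?orbT.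
  have d'0 : 0 < d' by rewrite !lt_min d10.
  exists L', d'; split => // P cP t; rewrite mul0r addr0 => tT.
  have -> : t = - T by apply/eqP; rewrite eq_le andbC.
  have u1 := H1 P N (mgf_closeW L1L dd1 cP) (Ncl _ _ d10).
  have u2 := H2 N P (Ncl _ _ d20) (mgf_closeW L2L dd2 cP).
  have e1 : - T + a - a = - T by ring.
  have e2 : - T + a + a = - T + 2 * a by ring.
  have e3 : - T - a - a = - T - 2 * a by ring.
  have e4 : - T - a + a = - T by ring.
  rewrite e1 e2 in u1; rewrite e3 e4 in u2.
  have c3 : cdf_of N (- T + 2 * a) <= cdf_of N (- T) + 4 * a * C.
    by apply: normal_cdf_le; lra.
  have c4 : cdf_of N (- T) <= cdf_of N (- T - 2 * a) + 4 * a * C.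
    by apply: normal_cdf_le; lra.
  rewrite aC in c3 c4; rewrite ler_norml.
  move: u1 u2 c3 c4; set x1 := cdf_of P _; set x2 := cdf_of N _.
  by set x3 := cdf_of N _; set x4 := cdf_of N _; lra.
pose k := (Num.truncn (T / a)).+1.
have kT : T <= - T + k%:R * (2 * a).
  have : T / a < k%:R by exact: truncnS_gt.
  by rewrite ltr_pdivrMr//; lra.
have [L [d [d0 H]]] := grid k.
pose L' := Num.max L 1; pose d' := Num.min d 1.
have [LL L1] : L <= L' /\ 1 <= L' by rewrite !le_max !lexx ?orbT.
have [dd d1] : d' <= d /\ d' <= 1 by rewrite !ge_min !lexx ?orbT.
exists L', d'; split => [|P cP]; first by rewrite lt_min d0 ltr01.
rewrite /ks_dist; apply: ge_sup; first by exists `|cdf_of P 0 - cdf_of N 0|, 0.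
move=> _ [t _ <-].
have PN : mgf_close V L' d' N by apply: Ncl; rewrite lt_min d0 ltr01.
have [p1 p2] := cdf_tail t L1 d1 cP; have [n1 n2] := cdf_tail t L1 d1 PN.
have := cdf_ge0 P t; have := cdf_ge0 N t; have := cdf_le1 P t; have := cdf_le1 N t.
have [tT|Tt] := leP t (- T).
  have h : expR t * E <= e by apply: le_trans TE; rewrite ler_pM2r// ler_expR.
  move: p1 n1; rewrite -/E => p1 n1 h1 h2 h3 h4; rewrite ler_norml /centered_normal.
  move: (le_trans p1 h) (le_trans n1 h) h1 h2 h3 h4; set x := cdf_of P t.
  by set y := cdf_of N t; lra.
have [tT'|Tt'] := leP T t.
  have h : expR (- t) * E <= e.
    by apply: le_trans TE; rewrite ler_pM2r// ler_expR lerN2.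
  move: p2 n2; rewrite -/E => p2 n2 h1 h2 h3 h4; rewrite ler_norml /centered_normal.
  move: (le_trans p2 h) (le_trans n2 h) h1 h2 h3 h4; set x := cdf_of P t.
  by set y := cdf_of N t; lra.
move=> _ _ _ _; apply: (H P (mgf_closeW LL dd cP)).
by rewrite (ltW Tt)/= (le_trans (ltW Tt')).
Qed.

End ks_normal.

(** * Linear and quadratic statistics of the field *)

Section linear_field.
Context {d : measure_display} {T : measurableType d} {R : realType}.
Variable P : probability T R.

Definition fld (f : T -> R) n (a : 'I_n -> R) (t : n.-tuple T) : R :=
  \sum_i a i * f (tnth t i).

Definition bilin (g f : T -> R) n (B : 'I_n -> 'I_n -> R) (t : n.-tuple T) : R :=
  \sum_i \sum_j B i j * (g (tnth t i) * f (tnth t j)).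

Lemma bm_tnth (f : T -> R) n (i : 'I_n) : bm f ->
  bm (fun t : n.-tuple T => f (tnth t i)).
Proof. by move=> bf; apply: (bm_comp bf); exact: measurable_tnth. Qed.

Lemma bm_fld f n (a : 'I_n -> R) : bm f -> bm (fld f a).
Proof.
move=> bf; apply: bm_sum => i; apply: bmM; first exact: bm_cst.
exact: bm_tnth.
Qed.

Lemma bm_bilin g f n (B : 'I_n -> 'I_n -> R) : bm g -> bm f -> bm (bilin g f B).
Proof.
move=> bg bf; apply: bm_sum => i; apply: bm_sum => j.
apply: bmM; first exact: bm_cst.
by apply: bmM; exact: bm_tnth.
Qed.

Lemma fld_cons f n (a : 'I_n.+1 -> R) x (t : n.-tuple T) :
  fld f a [tuple of x :: t] = a ord0 * f x + fld f (a \o lift ord0) t.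
Proof.
rewrite /fld big_ord_recl; congr (_ + _).
by apply: eq_bigr => i _; rewrite tnthS.
Qed.

Lemma bilin_cons g f n (B : 'I_n.+1 -> 'I_n.+1 -> R) x (t : n.-tuple T) :
  B ord0 ord0 = 0 ->
  bilin g f B [tuple of x :: t] =
    g x * fld f (fun j => B ord0 (lift ord0 j)) t +
    f x * fld g (fun i => B (lift ord0 i) ord0) t +
    bilin g f (fun i j => B (lift ord0 i) (lift ord0 j)) t.
Proof.
move=> B0; rewrite /bilin big_ord_recl big_ord_recl B0 mul0r add0r -addrA.
congr (_ + _).
  by rewrite /fld mulr_sumr; apply: eq_bigr => j _; rewrite tnthS/=; ring.
rewrite /fld mulr_sumr -big_split; apply: eq_bigr => i _/=.
rewrite big_ord_recl; congr (_ + _); first by rewrite tnthS/=; ring.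
by apply: eq_bigr => j _; rewrite !tnthS.
Qed.

Section moments.
Variables f : T -> R.
Hypotheses (bf : bm f) (f0 : \int[P]_x f x = 0).

Let bfl n (a : 'I_n -> R) : bm (fld f a). Proof. exact: bm_fld. Qed.

Lemma fld_mean n (a : 'I_n -> R) : \int[iid_law P n]_t fld f a t = 0.
Proof.
elim: n a => [|n IH] a.
  by rewrite -[RHS](Ex_cst (iid_law P 0)); apply: eq_Ex => t; rewrite /fld big_ord0.
rewrite Ex_cons//.
transitivity (\int[P]_x (a ord0 * f x)); last by rewrite ExZl// f0 mulr0.
apply: eq_Ex => x.
transitivity (\int[iid_law P n]_t (a ord0 * f x + fld f (a \o lift ord0) t)).
  by apply: eq_Ex => t; rewrite fld_cons.
by rewrite ExD; [rewrite Ex_cst IH addr0|exact: bm_cst|exact: bm_fld].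
Qed.

Lemma fld_mgf n (a : 'I_n -> R) :
  \int[iid_law P n]_t expR (fld f a t) = expR (\sum_i cum P f (a i)).
Proof.
elim: n a => [|n IH] a.
  rewrite big_ord0 expR0 -[RHS](Ex_cst (iid_law P 0)).
  by apply: eq_Ex => t; rewrite /fld big_ord0 expR0.
have be m (b : 'I_m -> R) : bm (fun t => expR (fld f b t)) by exact: bm_exp.
rewrite Ex_cons// big_ord_recl expRD.
transitivity (\int[P]_x (expR (a ord0 * f x) *
    expR (\sum_i cum P f ((a \o lift ord0) i)))).
  apply: eq_Ex => x; rewrite -IH.
  transitivity (\int[iid_law P n]_t
      (expR (a ord0 * f x) * expR (fld f (a \o lift ord0) t))).
    by apply: eq_Ex => t; rewrite fld_cons expRD.
  by rewrite ExZl//; exact: be.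
rewrite ExZr; last by bmt.
by congr (_ * _); rewrite /cum /cumH lnK// posrE Ex_exp_gt0//; bmt.
Qed.

Lemma fld_sqE n (a : 'I_n -> R) :
  \int[iid_law P n]_t (fld f a t ^+ 2) = (\int[P]_x f x ^+ 2) * \sum_i a i ^+ 2.
Proof.
elim: n a => [|n IH] a.
  rewrite big_ord0 mulr0 -[RHS](Ex_cst (iid_law P 0)).
  by apply: eq_Ex => t; rewrite /fld big_ord0 expr0n.
have bS := bfl (a \o lift ord0).
rewrite Ex_cons; last by apply: bmX.
set E2 := (\int[P]_x f x ^+ 2) * \sum_i (a \o lift ord0) i ^+ 2.
transitivity (\int[P]_x (a ord0 ^+ 2 * (f x ^+ 2) + E2)).
  apply: eq_Ex => x.
  transitivity (\int[iid_law P n]_t (a ord0 ^+ 2 * (f x ^+ 2) +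
    (2 * a ord0 * f x * fld f (a \o lift ord0) t +
     fld f (a \o lift ord0) t ^+ 2))).
    by apply: eq_Ex => t; rewrite fld_cons; ring.
  rewrite ExD; [|by bmt..]; rewrite ExD; [|by bmt..].
  rewrite Ex_cst ExZl; last exact: bS.
  by rewrite fld_mean IH mulr0 add0r.
rewrite ExD; [|by bmt..]; rewrite ExZl; last by bmt.
by rewrite Ex_cst big_ord_recl/= /E2 mulrDr mulrC.
Qed.

Hypothesis f1 : forall x, `|f x| <= 1.

Lemma Ex_pow_le1 k : \int[P]_x f x ^+ k <= 1.
Proof.
rewrite -[leRHS](Ex_cst P); apply: le_Ex => [||x]; [by bmt|by bmt|].
by rewrite (le_trans (ler_norm _))// normrX exprn_ile1.
Qed.

Lemma fld_sq n (a : 'I_n -> R) :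
  \int[iid_law P n]_t (fld f a t ^+ 2) <= \sum_i a i ^+ 2.
Proof.
by rewrite fld_sqE ler_piMl ?Ex_pow_le1// sumr_ge0// => i _; exact: sqr_ge0.
Qed.

(** Splitting off one coordinate, the terms of odd degree in it vanish by centering. The constant 3
    is the Gaussian fourth moment and reproduces itself, since the cross term 6 y^2 s is the one in
    3 (y^2 + s)^2. *)
Lemma fld_pow4 n (a : 'I_n -> R) :
  \int[iid_law P n]_t (fld f a t ^+ 4) <= 3 * (\sum_i a i ^+ 2) ^+ 2.
Proof.
elim: n a => [|n IH] a.
  rewrite big_ord0 expr0n/= mulr0 -[leRHS](Ex_cst (iid_law P 0)).
  rewrite le_eqVlt; apply/orP; left; apply/eqP.
  by apply: eq_Ex => t; rewrite /fld big_ord0 expr0n.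
set S := fld f (a \o lift ord0); have bS : bm S := bfl (a \o lift ord0).
rewrite Ex_cons; last by apply: bmX.
set E2 := \int[iid_law P n]_t (S t ^+ 2).
set E3 := \int[iid_law P n]_t (S t ^+ 3).
set E4 := \int[iid_law P n]_t (S t ^+ 4).
have -> : \int[P]_x \int[iid_law P n]_t (fld f a [tuple of x :: t] ^+ 4) =
    \int[P]_x (a ord0 ^+ 4 * (f x ^+ 4) + (6 * a ord0 ^+ 2 * E2 * (f x ^+ 2) +
      (4 * a ord0 * E3 * f x + E4))).
  apply: eq_Ex => x.
  transitivity (\int[iid_law P n]_t (a ord0 ^+ 4 * f x ^+ 4 +
    (4 * a ord0 ^+ 3 * f x ^+ 3 * S t + (6 * a ord0 ^+ 2 * f x ^+ 2 * (S t ^+ 2) +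
     (4 * a ord0 * f x * (S t ^+ 3) + S t ^+ 4))))).
    by apply: eq_Ex => t; rewrite fld_cons -/S; ring.
  do 4 (rewrite ExD; [|by bmt..]).
  rewrite Ex_cst; do 3 (rewrite ExZl; [|by bmt..]).
  by rewrite fld_mean -/E2 -/E3 -/E4; ring.
do 3 (rewrite ExD; [|by bmt..]).
do 3 (rewrite ExZl; [|by bmt..]).
rewrite Ex_cst f0 big_ord_recl.
have := IH (a \o lift ord0); rewrite -/S -/E4.
have := fld_sq (a \o lift ord0); rewrite -/S -/E2.
have : 0 <= E2 by apply: Ex_ge0 => t; exact: sqr_ge0.
have := Ex_pow_le1 4; have := Ex_pow_le1 2.
have m20 : 0 <= \int[P]_x f x ^+ 2 by apply: Ex_ge0 => x; exact: sqr_ge0.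
rewrite /comp; move: m20; set s := \sum_i _.
move: (\int[P]_x f x ^+ 2) (\int[P]_x f x ^+ 4) (a ord0) E2 E4 s => m2 m4 y E2 E4 s.
move=> m20 m21 m41 E20 E2s E4s.
have h1 : y ^+ 4 * m4 <= y ^+ 4 by rewrite ler_piMr// exprn_even_ge0.
have h2 : 6 * y ^+ 2 * E2 * m2 <= 6 * y ^+ 2 * s.
  rewrite -mulrA; apply: ler_wpM2l; first by rewrite mulr_ge0// sqr_ge0.
  by rewrite (le_trans _ E2s)// ler_piMr.
have h3 : 0 <= y ^+ 4 by rewrite exprn_even_ge0.
have -> : 3 * (y ^+ 2 + s) ^+ 2 = 3 * y ^+ 4 + 6 * y ^+ 2 * s + 3 * s ^+ 2 by ring.
by rewrite mulr0; lra.
Qed.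

End moments.

Section bilinear.
Variables f g : T -> R.
Hypotheses (bf : bm f) (f0 : \int[P]_x f x = 0) (f1 : forall x, `|f x| <= 1).
Hypotheses (bg : bm g) (g0 : \int[P]_x g x = 0) (g1 : forall x, `|g x| <= 1).

(** With a zero diagonal, the first coordinate enters only through terms linear in [g x] or in
    [f x]. The factor 2 pays for the correlation between the entries [B i j] and [B j i] of the same
    pair. *)
Lemma bilin_sq n (B : 'I_n -> 'I_n -> R) : (forall i, B i i = 0) ->
  \int[iid_law P n]_t (bilin g f B t ^+ 2) <= 2 * \sum_i \sum_j B i j ^+ 2.
Proof.
elim: n B => [|n IH] B B0.
  rewrite big_ord0 mulr0 -[leRHS](Ex_cst (iid_law P 0)).
  rewrite le_eqVlt; apply/orP; left; apply/eqP.
  by apply: eq_Ex => t; rewrite /bilin big_ord0 expr0n.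
set U := fld f (fun j => B ord0 (lift ord0 j)).
set V := fld g (fun i => B (lift ord0 i) ord0).
set Q := bilin g f (fun i j => B (lift ord0 i) (lift ord0 j)).
have bU : bm U by exact: bm_fld.
have bV : bm V by exact: bm_fld.
have bQ : bm Q by exact: bm_bilin.
rewrite Ex_cons; last by apply: bmX; exact: bm_bilin.
set UU := \int[iid_law P n]_t (U t ^+ 2).
set VV := \int[iid_law P n]_t (V t ^+ 2).
set UV := \int[iid_law P n]_t (U t * V t).
set QQ := \int[iid_law P n]_t (Q t ^+ 2).
set QU := \int[iid_law P n]_t (Q t * U t).
set QV := \int[iid_law P n]_t (Q t * V t).
have -> : \int[P]_x \int[iid_law P n]_t (bilin g f B [tuple of x :: t] ^+ 2) =
    \int[P]_x (UU * (g x ^+ 2) + (2 * UV * (g x * f x) + (VV * (f x ^+ 2) +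
      (2 * QU * g x + (2 * QV * f x + QQ))))).
  apply: eq_Ex => x.
  transitivity (\int[iid_law P n]_t (g x ^+ 2 * (U t ^+ 2) +
    (2 * (g x * f x) * (U t * V t) + (f x ^+ 2 * (V t ^+ 2) +
     (2 * g x * (Q t * U t) + (2 * f x * (Q t * V t) + Q t ^+ 2)))))).
    by apply: eq_Ex => t; rewrite bilin_cons// -/U -/V -/Q; ring.
  do 5 (rewrite ExD; [|by bmt..]).
  do 5 (rewrite ExZl; [|by bmt..]).
  by rewrite -/UU -/VV -/UV -/QQ -/QU -/QV; ring.
do 5 (rewrite ExD; [|by bmt..]).
do 5 (rewrite ExZl; [|by bmt..]).
rewrite Ex_cst f0 g0.
have uu0 : 0 <= UU by apply: Ex_ge0 => t; exact: sqr_ge0.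
have vv0 : 0 <= VV by apply: Ex_ge0 => t; exact: sqr_ge0.
have uv : `|UV| <= (UU + VV) / 2.
  have -> : (UU + VV) / 2 = \int[iid_law P n]_t ((U t ^+ 2 + V t ^+ 2) / 2).
    rewrite ExZr; last by bmt.
    by rewrite ExD//; bmt.
  apply: norm_Ex_le => [||t]; [by bmt|by bmt|].
  have := sqr_ge0 (U t - V t); have := sqr_ge0 (U t + V t).
  by rewrite ler_norml; move: (U t) (V t) => a b; nra.
have cc : `|\int[P]_x (g x * f x)| <= 1.
  rewrite -[leRHS](Ex_cst P); apply: norm_Ex_le => [||x]; [by bmt|by bmt|].
  by rewrite normrM mulr_ile1.
have := IH (fun i j => B (lift ord0 i) (lift ord0 j)) (fun i => B0 _).
rewrite -/Q -/QQ.
have := fld_sq bf f0 f1 (fun j => B ord0 (lift ord0 j)); rewrite -/U -/UU.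
have := fld_sq bg g0 g1 (fun i => B (lift ord0 i) ord0); rewrite -/V -/VV.
have -> : \sum_i \sum_j B i j ^+ 2 = \sum_j B ord0 (lift ord0 j) ^+ 2 +
   (\sum_i B (lift ord0 i) ord0 ^+ 2 +
    \sum_i \sum_j B (lift ord0 i) (lift ord0 j) ^+ 2).
  rewrite big_ord_recl big_ord_recl B0 expr0n/= add0r; congr (_ + _).
  by rewrite -big_split; apply: eq_bigr => i _; rewrite big_ord_recl.
have := Ex_pow_le1 bf f1 2; have := Ex_pow_le1 bg g1 2.
have h : `|UV * \int[P]_x (g x * f x)| <= (UU + VV) / 2.
  by rewrite normrM (le_trans _ uv)// ler_piMr.
have := le_trans (ler_norm _) h.
set s1 := \sum_i _; set s2 := \sum_i _; set s3 := \sum_i _.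
move: (\int[P]_x (g x * f x)) cc h => C cc h.
move: (\int[P]_x g x ^+ 2) (\int[P]_x f x ^+ 2) => G2 F2 {h} h gg ff h1 h2 h3.
have h4 : UU * G2 <= UU by rewrite ler_piMr.
have h5 : VV * F2 <= VV by rewrite ler_piMr.
rewrite !mulr0 !add0r -mulrA; move: (UV * C) (UU * G2) (VV * F2) h h4 h5 => a b c.
by lra.
Qed.

End bilinear.

(** By independence the logarithm is a sum of cumulant generating functions at the [a i], and the
    cubic errors add up. *)
Lemma fld_log_mgf f n (a : 'I_n -> R) : bm f -> \int[P]_x f x = 0 ->
  (forall x, `|f x| <= 1) ->
  `|ln (\int[iid_law P n]_t expR (fld f a t)) -
    (\int[P]_x f x ^+ 2) * ((\sum_i a i ^+ 2) / 2)| <= 4 * \sum_i `|a i| ^+ 3.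
Proof.
move=> bf f0 f1; rewrite fld_mgf// expRK mulr_suml [X in _ - X]mulr_sumr.
rewrite -sumrB [leRHS]mulr_sumr.
rewrite (le_trans (ler_norm_sum _ _ _))//; apply: ler_sum => i _.
exact: cum_cubic.
Qed.

End linear_field.

(** * The Gibbs law as a tilted expectation *)

Lemma iid_law_all d (T : measurableType d) (R : realType) (P : probability T R)
    n (B : set T) : measurable B -> P (~` B) = 0%E ->
  iid_law P n (~` [set t | forall i, B (tnth t i)]) = 0%E.
Proof.
move=> mB PB.
have mA : measurable [set t : n.-tuple T | forall i, B (tnth t i)].
  rewrite (_ : [set _ | _] = \bigcap_(i in [set: 'I_n])
    ((fun t : n.-tuple T => tnth t i) @^-1` B)); last first.
    by apply/seteqP; split=> t /= H i; [move=> _; exact: H|exact: H].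
  apply: fin_bigcap_measurable => // i _.
  by rewrite -[X in measurable X]setTI; exact: measurable_tnth.
have PB1 : P B = 1%E.
  have := probability_setC P (measurableC mB).
  by rewrite setCK PB sube0.
rewrite probability_setC// (iid_law_box P (fun=> mB)).
by rewrite big1 ?subee// => i _.
Qed.

Section statistic.
Context {R : realType}.
Variables (n : nat) (q m : 'I_n -> R).

Definition qstat (s : n.-tuple (measurableTypeR R)) : measurableTypeR R :=
  \sum_i q i * (tnth s i - m i).

Lemma measurable_qstat : measurable_fun [set: _] qstat.
Proof.
apply: measurable_sum => i; apply: measurable_funM => //.
by apply: measurable_funB => //; exact: measurable_tnth.
Qed.

HB.instance Definition _ := isMeasurableFun.Build _ _ _ _ qstat measurable_qstat.

End statistic.

Section gibbs_law.
Context {R : realType}.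
Variable mu : probability (measurableTypeR R) R.
Hypothesis hmu : base_measure mu.
Variables (n : nat) (A : 'M[R]_n) (c : 'cV[R]_n).
Local Notation tup := (n.-tuple (measurableTypeR R)).
Let P := iid_law mu n.
Let H : tup -> R := Ham A (fun i => c i 0).
Let Z := \int[P]_s expR (H s).

Let bH : bm H. Proof. exact: bm_Ham. Qed.

Let Z0 : 0 < Z. Proof. exact: Ex_exp_gt0. Qed.

Definition offcube : set tup := ~` [set s | forall i, `[-1, 1]%classic (tnth s i)].

Lemma offcube0 : P offcube = 0%E.
Proof.
apply: (@iid_law_all _ (measurableTypeR R)); first exact: measurable_itv.
by have [] := hmu.
Qed.

Lemma measurable_offcube : measurable offcube.
Proof.
apply: measurableC.
rewrite (_ : [set _ | _] = \bigcap_(i in [set: 'I_n])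
  ((fun t : tup => tnth t i) @^-1` `[-1, 1]%classic)); last first.
  by apply/seteqP; split=> t /= h i; [move=> _; exact: h|exact: h].
apply: fin_bigcap_measurable => // i _.
rewrite -[X in measurable X]setTI; apply: measurable_tnth => //.
Qed.

Lemma Xc_cube i s : ~ offcube s -> Xc i s = tnth s i.
Proof.
by rewrite /offcube /= => /contrapT h; apply: clip_id; have := h i; rewrite /= in_itv.
Qed.

Lemma energy_cube s : ~ offcube s -> energy A c s = H s.
Proof.
move=> hs; rewrite /energy quad_formE /H /Ham /lin; congr (_ * _ + _).
  apply: eq_bigr => i _; rewrite mxE Xc_cube//; congr (_ * _).
  by apply: eq_bigr => j _; rewrite mxE Xc_cube.
by apply: eq_bigr => i _; rewrite mxE Xc_cube.
Qed.

Lemma integral_cube (D : set tup) (f g : tup -> \bar R) : measurable D ->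
  measurable_fun D f -> measurable_fun D g ->
  (forall s, ~ offcube s -> f s = g s) ->
  (\int[P]_(s in D) f s = \int[P]_(s in D) g s)%E.
Proof.
move=> mD mf mg fg; apply: ae_eq_integral => //.
exists offcube; split; [exact: measurable_offcube|exact: offcube0|].
by move=> s /= h; apply: contrapT => hs; apply: h => _; exact: fg.
Qed.

Lemma gibbs_density S : measurable S ->
  gibbs mu A c S = (\int[P]_(s in S) (expR (H s) / Z)%:E)%E.
Proof.
move=> mS.
have wE B : measurable B ->
    exp_weight P (energy A c) B = (\int[P]_(s in B) (expR (H s))%:E)%E.
  move=> mB; apply: integral_cube => //.
  - by apply/measurable_EFinP/measurable_funTS/measurableT_comp.
  - apply/measurable_EFinP/measurable_funTS; have [] // : bm (fun s => expR (H s)).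
    exact: bm_exp.
  - by move=> s hs; congr (expR _)%:E; exact: energy_cube.
have ZE : exp_weight P (energy A c) setT = Z%:E.
  by rewrite wE// -EFin_Ex//; exact: bm_exp.
rewrite -[LHS]/(mnormalize (exp_weight P (energy A c)) P S).
(* The default branches of the normalization are excluded because [Z] is positive and finite. *)
rewrite /mnormalize; case: ifPn => [/orP[]/eqP e0|_].
- have /eqP : Z%:E = 0%E by rewrite -ZE; exact: e0.
  by rewrite eqe gt_eqF.
- have : Z%:E = +oo%E by rewrite -ZE; exact: e0.
  by [].
transitivity (exp_weight P (energy A c) S *
  (fine (exp_weight P (energy A c) setT))^-1%:E)%E; first by [].
rewrite ZE wE//=.
rewrite -ge0_integralZr//.
- apply/measurable_EFinP/measurable_funTS; have [] // : bm (fun s => expR (H s)).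
  exact: bm_exp.
- by rewrite lee_fin invr_ge0 ltW.
Qed.

Lemma gibbs_integral (f : tup -> \bar R) : measurable_fun setT f ->
  (forall s, 0 <= f s)%E ->
  (\int[gibbs mu A c]_s f s = \int[P]_s (f s * (expR (H s) / Z)%:E))%E.
Proof.
move=> mf f0; apply: ge0_integral_density => //.
  apply: (bm_integrable P (f := fun s => expR (H s) / Z)).
  by apply: bmM; [exact: bm_exp|exact: bm_cst].
exact: gibbs_density.
Qed.

(** Passes from a statistic of the spins to its truncated version. The integral is extended-valued
    so that the integrability of [f] is part of the conclusion. *)
Lemma gibbs_expect (f g : tup -> R) : measurable_fun setT f ->
  (forall s, 0 <= f s) -> bm g -> (forall s, ~ offcube s -> f s = g s) ->
  (\int[gibbs mu A c]_s (f s)%:E =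
   (gE mu (fun i j => A i j) (fun i => c i 0%R) g)%:E)%E.
Proof.
move=> mf f0 bg fg.
have beH : bm (fun s => expR (H s)) by exact: bm_exp.
have bh : bm (fun s => g s * expR (H s)) by exact: bmM.
have mE : measurable_fun setT (fun s => (f s)%:E) by exact/measurable_EFinP.
have fE0 s : (0 <= (f s)%:E)%E by rewrite lee_fin.
rewrite (gibbs_integral mE fE0).
rewrite /gE /tilt -ExZr// EFin_Ex; last by apply: bmM => //; exact: bm_cst.
apply: integral_cube => //.
- apply: emeasurable_funM; first exact/measurable_EFinP.
  by apply/measurable_EFinP; have [] : bm (fun s => expR (H s) / Z)
    by apply: bmM => //; exact: bm_cst.
- by apply/measurable_EFinP; have [] : bm (fun s => g s * expR (H s) / Z)
    by apply: bmM => //; exact: bm_cst.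
- by move=> s hs; rewrite -EFinM fg// mulrA.
Qed.

Lemma gibbs_prob (S : set tup) : measurable S ->
  fine (gibbs mu A c S) =
  (\int[P]_s (\1_S s * expR (H s))) / Z.
Proof.
move=> mS.
have b : bm (fun s => \1_S s * expR (H s)).
  by apply: bmM; [exact: bm_indic|exact: bm_exp].
rewrite gibbs_density// -ExZr// integral_mkcond /Rintegral; congr fine.
apply: eq_integral => s _; rewrite patchE indicE.
by case: (s \in S); rewrite ?mul1r ?mul0r.
Qed.

End gibbs_law.

(** * Typical fields *)

(** Everything the estimates use of the coupling matrix and of the direction [q], with one smallness
    parameter [zeta]. The last condition compensates the norm of [A xi], whose square is bounded in
    mean only by [n%:R * alpha]. *)
Record regime (R : realType) n (A : 'I_n -> 'I_n -> R) (q e : 'I_n -> R)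
    (rho alpha kappa zeta : R) : Prop := Regime {
  regime_sym : forall i j, A i j = A j i;
  regime_diag : forall i, A i i = 0;
  regime_row : forall i, \sum_j `|A i j| <= rho;
  regime_row2 : forall i, \sum_j A i j ^+ 2 <= alpha;
  regime_eigen : forall i, app A q i = kappa * q i + e i;
  regime_nrm : nrm q = 1;
  regime_alpha : 0 <= alpha;
  regime_sqrt : Num.sqrt n%:R * alpha <= zeta;
  regime_sup : forall i, `|q i| <= zeta;
  regime_err : nrm e <= zeta;
  regime_err2 : nrm e ^+ 2 * (n%:R * alpha) <= zeta }.

Section field_statistic.
Context {R : realType}.
Variables mu F : probability (measurableTypeR R) R.
Hypothesis hmu : base_measure mu.
Hypothesis hF : \int[F]_x psi1 mu x = 0.
Let v := \int[F]_x psi2 mu x.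
Let xi : measurableTypeR R -> R := psi1 mu.
Let eta : measurableTypeR R -> R := fun x => psi2 mu x - v.

Lemma mean_psi2_01 : 0 <= v <= 1.
Proof.
apply/andP; split; first by apply: Ex_ge0 => x; exact: psi2_ge0.
rewrite /v -[leRHS](Ex_cst F); apply: le_Ex => [||x]; last exact: psi2_le1.
  exact: bm_psi2.
exact: bm_cst.
Qed.

Let bxi : bm xi. Proof. exact: bm_psi1. Qed.

Let beta : bm eta. Proof. by apply: bmB; [exact: bm_psi2|exact: bm_cst]. Qed.

Let eta1 x : `|eta x| <= 1.
Proof.
have /andP[v0 v1] := mean_psi2_01.
have := psi2_ge0 hmu x; have := psi2_le1 hmu x.
rewrite /eta ler_norml; move: (psi2 mu x) => y; lra.
Qed.

Let eta0 : \int[F]_x eta x = 0.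
Proof.
rewrite /eta ExB; [|exact: bm_psi2|exact: bm_cst].
by rewrite Ex_cst subrr.
Qed.

Variables (n : nat) (A : 'I_n -> 'I_n -> R) (q e : 'I_n -> R).

(** The reciprocal weights [Num.sqrt n%:R] and [(Num.sqrt n%:R)^-1] are there to bound the product
    of the norms of [A p] and [A xi]; the weight 1 bounds the norm of [A p] alone, and [nrm e ^+ 2]
    bounds the product of the norms of [e] and [A xi]. *)
Definition field_stat (c : n.-tuple (measurableTypeR R)) : R :=
  \sum_i fld xi (A i) c ^+ 4 +
  ((1 + Num.sqrt n%:R) * \sum_i fld eta (fun j => A i j * q j) c ^+ 2 +
  (fld eta (fun i => q i ^+ 2) c ^+ 2 +
  (fld xi e c ^+ 2 +
  (bilin eta xi (fun i j => q i * A i j) c ^+ 2 +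
  ((Num.sqrt n%:R)^-1 + nrm e ^+ 2) * \sum_i fld xi (A i) c ^+ 2)))).

Lemma bm_field_stat : bm field_stat.
Proof.
by rewrite /field_stat; repeat first [apply: bm_cst | exact: bm_fld
  | exact: bm_bilin | apply: bmX | apply: bmD | apply: bmM
  | (apply: bm_sum; move=> ?)].
Qed.

Lemma field_stat_ge0 c : 0 <= field_stat c.
Proof.
rewrite /field_stat; repeat (apply: addr_ge0); rewrite ?sqr_ge0//.
- by apply: sumr_ge0 => i _; rewrite exprn_even_ge0.
- by rewrite mulr_ge0 ?addr_ge0 ?sqrtr_ge0// sumsq_ge0.
- by rewrite mulr_ge0 ?addr_ge0 ?invr_ge0 ?sqrtr_ge0 ?sqr_ge0// sumsq_ge0.
Qed.

Variables rho alpha kappa zeta : R.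
Hypothesis reg : regime A q e rho alpha kappa zeta.

Lemma regime_n_gt0 : (0 < n)%N.
Proof.
case: (posnP n) => // n0; have := regime_nrm reg.
rewrite /nrm big1 ?sqrtr0; first by move=> /eqP; rewrite eq_sym oner_eq0.
by move=> i _; have := leq_trans (ltn_ord i) (eq_leq n0).
Qed.

Lemma regime_zeta : 0 <= zeta.
Proof. exact: le_trans (nrm_ge0 e) (regime_err reg). Qed.

(** Independence and centering reduce each mean square to a sum of squared coefficients. The 11 is 3
    + 2 + 1 + 1 + 2 + 2, in the order of the terms of [field_stat]. *)
Lemma field_stat_mean : zeta <= 1 -> \int[iid_law F n]_c field_stat c <= 11 * zeta.
Proof.
move=> z1; have z0 := regime_zeta.
have [sA A0 _ rA2 _ q1 a0 sa qz ez ea] := reg.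
have n0 : 0 < Num.sqrt n%:R :> R by rewrite sqrtr_gt0 ltr0n regime_n_gt0.
have n1 : 1 <= Num.sqrt n%:R :> R.
  by rewrite -[leLHS]sqrtr1 ler_wsqrtr// ler1n regime_n_gt0.
have sn : n%:R = Num.sqrt n%:R ^+ 2 :> R by rewrite sqr_sqrtr.
have sq1 : \sum_i q i ^+ 2 = 1 by rewrite -nrm_sqr q1 expr1n.
have bx m (a : 'I_m -> R) : bm (fld xi a) by exact: bm_fld.
have be m (a : 'I_m -> R) : bm (fld eta a) by exact: bm_fld.
have bb (B : 'I_n -> 'I_n -> R) : bm (bilin eta xi B) by exact: bm_bilin.
have xi1 x : `|xi x| <= 1 by exact: psi1_norm.
set s := Num.sqrt n%:R in n0 n1 sn sa *.
have T1 : \int[iid_law F n]_c (\sum_i fld xi (A i) c ^+ 4) <= 3 * zeta.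
  rewrite Ex_sum => [|i]; last by apply: bmX; exact: bx.
  apply: (@le_trans _ _ (\sum_(i < n) 3 * alpha ^+ 2)).
    apply: ler_sum => i _; apply: (le_trans (fld_pow4 bxi hF xi1 _ )).
    rewrite ler_pM2l// ler_pXn2r ?nnegrE//.
    exact: sumsq_ge0.
  rewrite sumr_const card_ord -[leLHS]mulr_natl sn.
  rewrite (_ : _ * _ = 3 * (s * alpha) ^+ 2); last by ring.
  rewrite ler_pM2l//; apply: (@le_trans _ _ (zeta ^+ 2)).
    by rewrite ler_pXn2r ?nnegrE// mulr_ge0// ltW.
  by rewrite expr2 ler_piMr.
have T2 : \int[iid_law F n]_c ((1 + s) * \sum_i fld eta (fun j => A i j * q j) c ^+ 2)
    <= 2 * zeta.
  rewrite ExZl; last by apply: bm_sum => i; apply: bmX; exact: be.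
  rewrite Ex_sum => [|i]; last by apply: bmX; exact: be.
  apply: (@le_trans _ _ ((1 + s) * alpha)).
    rewrite ler_pM2l ?addr_gt0//.
    apply: (@le_trans _ _ (\sum_i \sum_j (A i j * q j) ^+ 2)).
      by apply: ler_sum => i _; exact: fld_sq.
    rewrite exchange_big/= -[leRHS]mulr1 -sq1 mulr_sumr; apply: ler_sum => j _.
    under eq_bigr do rewrite exprMn sA.
    by rewrite -mulr_suml ler_wpM2r ?sqr_ge0.
  rewrite mulrDl mul1r (_ : 2 * zeta = zeta + zeta); last by ring.
  by apply: lerD => //; rewrite (le_trans _ sa)// ler_peMl.
have T3 : \int[iid_law F n]_c (fld eta (fun i => q i ^+ 2) c ^+ 2) <= zeta.
  apply: (le_trans (fld_sq beta eta0 eta1 _)).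
  rewrite -[leRHS]mulr1 -sq1 mulr_sumr; apply: ler_sum => i _.
  rewrite [leLHS]expr2 ler_wpM2r ?sqr_ge0//.
  rewrite -(real_normK (num_real _)) expr2 -[leRHS]mulr1.
  by rewrite ler_pM// (le_trans (qz i)).
have T4 : \int[iid_law F n]_c (fld xi e c ^+ 2) <= zeta.
  apply: (le_trans (fld_sq bxi hF xi1 _)); rewrite -nrm_sqr expr2 -[leRHS]mulr1.
  by rewrite ler_pM ?nrm_ge0// (le_trans ez).
have T5 : \int[iid_law F n]_c (bilin eta xi (fun i j => q i * A i j) c ^+ 2)
    <= 2 * zeta.
  apply: (le_trans (bilin_sq bxi hF xi1 beta eta0 eta1 _)).
    by move=> i; rewrite A0 mulr0.
  rewrite ler_pM2l//; apply: (@le_trans _ _ alpha).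
    rewrite -[leRHS]mulr1 -sq1 mulr_sumr; apply: ler_sum => i _.
    under eq_bigr do rewrite exprMn.
    by rewrite -mulr_sumr mulrC ler_wpM2r ?sqr_ge0.
  by rewrite (le_trans _ sa)// ler_peMl.
have T6 : \int[iid_law F n]_c ((s^-1 + nrm e ^+ 2) * \sum_i fld xi (A i) c ^+ 2)
    <= 2 * zeta.
  rewrite ExZl; last by apply: bm_sum => i; apply: bmX; exact: bx.
  rewrite Ex_sum => [|i]; last by apply: bmX; exact: bx.
  apply: (@le_trans _ _ ((s^-1 + nrm e ^+ 2) * (n%:R * alpha))).
    apply: ler_wpM2l; first by rewrite addr_ge0 ?invr_ge0 ?sqr_ge0// ltW.
    apply: (@le_trans _ _ (\sum_(i < n) alpha)).
      by apply: ler_sum => i _; apply: (le_trans (fld_sq bxi hF xi1 _)); exact: rA2.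
    by rewrite sumr_const card_ord mulr_natl.
  rewrite mulrDl (_ : 2 * zeta = zeta + zeta); last by ring.
  apply: lerD => //.
  by rewrite sn expr2 -mulrA mulKf ?gt_eqF.
rewrite /field_stat.
do 5 (rewrite ExD; [|by repeat first [apply: bm_cst | exact: bx | exact: be
  | exact: bb | apply: bmX | apply: bmD | apply: bmM
  | (apply: bm_sum; move=> ?)]..]).
rewrite (_ : 11 * zeta = 3 * zeta + (2 * zeta + (zeta + (zeta + (2 * zeta + 2 * zeta)))));
  last by ring.
by repeat apply: lerD.
Qed.

End field_statistic.

Section mgf_of_log.
Context {R : realType}.

Lemma norm_expR_sub1 (y : R) : `|y| <= 1 ->
  `|expR y - 1| <= (1 + expR 1) * `|y|.
Proof.
move=> y1; have h := expR_sub1_sub y.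
have h2 : `|expR y - 1| <= `|y| + `|expR y - 1 - y|.
  by rewrite -{1}(subrK y (expR y - 1)) addrC ler_normD.
rewrite (le_trans h2)// mulrDl mul1r lerD2l (le_trans h)//.
rewrite -(real_normK (num_real y)) expr2 -mulrA mulrC ler_wpM2r//.
by rewrite mulrC -[leRHS]mulr1 ler_pM ?expR_ge0// ler_expR.
Qed.

(** An additive error on the logarithm is a relative error on the generating function; the last
    exponential in the bound is the largest value of the Gaussian one on the range. *)
Lemma mgf_close_log (V L r : R) (P : probability (measurableTypeR R) R) :
  0 <= V -> r <= 1 -> (forall l, `|l| <= L -> exists2 M, 0 < M &
    (\int[P]_x (expR (l * x))%:E = M%:E)%E /\
    `|ln M - V * (l ^+ 2 / 2)| <= r) ->
  mgf_close V L ((1 + expR 1) * r * expR (V * (L ^+ 2 / 2))) P.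
Proof.
move=> V0 r1 h l lL; have [M M0 [E Mr]] := h l lL; split.
  apply/integrableP; split.
    by apply/measurable_EFinP; apply: measurableT_comp => //; exact: measurable_funM.
  under eq_integral do rewrite /= ger0_norm ?expR_ge0//.
  by rewrite E ltry.
rewrite /Rintegral E/= -{1}(lnK (x := M)) ?posrE//.
have -> : expR (ln M) - expR (V * (l ^+ 2 / 2)) =
    (expR (ln M - V * (l ^+ 2 / 2)) - 1) * expR (V * (l ^+ 2 / 2)).
  by rewrite mulrBl mul1r -expRD subrK.
rewrite normrM (ger0_norm (expR_ge0 _)); apply: ler_pM; rewrite ?expR_ge0//.
  by rewrite (le_trans (norm_expR_sub1 (le_trans Mr r1)))// ler_wpM2l// addr_ge0// expR_ge0.
rewrite ler_expR ler_wpM2l// ler_pM2r ?invr_gt0//.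
by rewrite -(real_normK (num_real l)) lerXn2r ?nnegrE// (le_trans _ lL).
Qed.

End mgf_of_log.

Section good_field.
Context {R : realType}.
Variables mu F : probability (measurableTypeR R) R.
Hypothesis hmu : base_measure mu.
Let v := \int[F]_x psi2 mu x.
Variables (n : nat) (A : 'M[R]_n) (q e : 'I_n -> R) (rho alpha kappa zeta delta : R).
Hypothesis reg : regime (fun i j => A i j) q e rho alpha kappa zeta.
Hypothesis rho0 : 0 <= rho.
Hypothesis rho1 : rho < 1.
Hypothesis kappa_le : `|kappa| <= rho.
Hypothesis zd : zeta <= delta.
Hypothesis d1 : delta <= 1.
Variable c : n.-tuple R.
Hypothesis good :
  field_stat mu F (fun i j => A i j) q e c <= delta ^+ 4.

Let b := (1 - rho)^-1.
Let u := mf_optimizer mu A (col_of_tuple c).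
Let Af i j := A i j.
Let xi i := psi1 mu (tnth c i).
Let p i := q i * (psi2 mu (tnth c i) - v).

Let d0 : 0 <= delta. Proof. exact: le_trans (regime_zeta reg) zd. Qed.

Let stat_parts :
  [/\ \sum_i app Af xi i ^+ 4 <= delta ^+ 4,
      (1 + Num.sqrt n%:R) * \sum_i app Af p i ^+ 2 <= delta ^+ 4,
      (\sum_i q i ^+ 2 * psi2 mu (tnth c i) - v) ^+ 2 <= delta ^+ 4,
      (\sum_i e i * xi i) ^+ 2 <= delta ^+ 4 &
      (\sum_i p i * app Af xi i) ^+ 2 <= delta ^+ 4 /\
      ((Num.sqrt n%:R)^-1 + nrm e ^+ 2) * \sum_i app Af xi i ^+ 2 <= delta ^+ 4].
Proof.
have E2 : \sum_i fld (fun x : measurableTypeR R => psi2 mu x - v) (fun j => A i j * q j) c ^+ 2 =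
    \sum_i app Af p i ^+ 2.
  apply: eq_bigr => i _; congr (_ ^+ 2); apply: eq_bigr => j _.
  by rewrite -mulrA.
have E3 : fld (fun x : measurableTypeR R => psi2 mu x - v) (fun i => q i ^+ 2) c =
    \sum_i q i ^+ 2 * psi2 mu (tnth c i) - v.
  rewrite /fld; under eq_bigr do rewrite mulrBr.
  by rewrite sumrB -mulr_suml -nrm_sqr (regime_nrm reg) expr1n mul1r.
have E5 : bilin (fun x : measurableTypeR R => psi2 mu x - v)
      (psi1 mu : measurableTypeR R -> R) (fun i j => q i * A i j) c =
    \sum_i p i * app Af xi i.
  rewrite /bilin; apply: eq_bigr => i _; rewrite /app mulr_sumr.
  by apply: eq_bigr => j _; rewrite /p /xi /Af; ring.
move: good; rewrite /field_stat -/v E2 E3 E5.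
set S1 := \sum_i fld _ _ _ ^+ 4; set S2 := _ * _; set S3 := (_ - v) ^+ 2.
set S4 := fld _ _ _ ^+ 2; set S5 := _ ^+ 2; set S6 := _ * _ => g.
have p1 : 0 <= S1 by apply: sumr_ge0 => i _; rewrite exprn_even_ge0.
have p2 : 0 <= S2 by rewrite mulr_ge0 ?addr_ge0 ?sqrtr_ge0// sumsq_ge0.
have p3 : 0 <= S3 by exact: sqr_ge0.
have p4 : 0 <= S4 by exact: sqr_ge0.
have p5 : 0 <= S5 by exact: sqr_ge0.
have p6 : 0 <= S6.
  by rewrite mulr_ge0 ?addr_ge0 ?invr_ge0 ?sqrtr_ge0 ?sqr_ge0// sumsq_ge0.
move: S1 S2 S3 S4 S5 S6 p1 p2 p3 p4 p5 p6 g => S1 S2 S3 S4 S5 S6 p1 p2 p3 p4 p5 p6 g.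
by do !split; lra.
Qed.

Let sq_le x : x ^+ 2 <= delta ^+ 4 -> `|x| <= delta.
Proof.
move=> h; rewrite -(@ler_pXn2r _ 2)// ?nnegrE// real_normK ?num_real//.
by rewrite (le_trans h)// ler_wiXn2l.
Qed.

Let s4 : \sum_i app Af xi i ^+ 4 <= delta ^+ 4.
Proof. by have [] := stat_parts. Qed.

Let sD : `|\sum_i q i ^+ 2 * psi2 mu (tnth c i) - v| <= delta.
Proof. by apply: sq_le; have [] := stat_parts. Qed.

Let sp : nrm (app Af p) <= delta.
Proof.
rewrite -(ger0_norm (nrm_ge0 _)); apply: sq_le; rewrite nrm_sqr.
have [_ h _ _ _] := stat_parts; apply: le_trans h.
by rewrite ler_peMl ?sumsq_ge0// lerDl sqrtr_ge0.
Qed.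

Let se : `|\sum_i e i * xi i| <= delta.
Proof. by apply: sq_le; have [] := stat_parts. Qed.

Let spx : `|\sum_i p i * app Af xi i| <= delta.
Proof. by apply: sq_le; have [_ _ _ _ []] := stat_parts. Qed.

Let spn : nrm (app Af p) * nrm (app Af xi) <= delta.
Proof.
rewrite -(ger0_norm (mulr_ge0 (nrm_ge0 _) (nrm_ge0 _))); apply: sq_le.
rewrite exprMn !nrm_sqr.
have s0 : 0 < Num.sqrt n%:R :> R by rewrite sqrtr_gt0 ltr0n (regime_n_gt0 reg).
have [_ h2 _ _ [_ h6]] := stat_parts.
set X := \sum_i _ ^+ 2 in h2 *; set Y := \sum_i _ ^+ 2 in h6 *.
have X0 : 0 <= X by exact: sumsq_ge0.
have Y0 : 0 <= Y by exact: sumsq_ge0.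
have g2 : Num.sqrt n%:R * X <= delta ^+ 4.
  by apply: le_trans h2; rewrite ler_wpM2r// lerDr.
have g6 : (Num.sqrt n%:R)^-1 * Y <= delta ^+ 4.
  by apply: le_trans h6; rewrite ler_wpM2r// lerDl sqr_ge0.
(* The weights of the two terms of [field_stat] cancel in the product. *)
have -> : X * Y = (Num.sqrt n%:R * X) * ((Num.sqrt n%:R)^-1 * Y).
  by field; rewrite gt_eqF.
apply: (@le_trans _ _ (delta ^+ 4 * delta ^+ 4)).
  by apply: ler_pM => //; rewrite mulr_ge0// ?invr_ge0 ltW.
by rewrite ler_piMr// ?exprn_ge0// exprn_ile1.
Qed.

Let sen : nrm e * nrm (app Af xi) <= delta.
Proof.
rewrite -(ger0_norm (mulr_ge0 (nrm_ge0 _) (nrm_ge0 _))); apply: sq_le.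
rewrite exprMn [X in _ * X]nrm_sqr.
have [_ _ _ _ [_ h]] := stat_parts; apply: le_trans h.
by rewrite ler_wpM2r ?sumsq_ge0// lerDr invr_ge0 sqrtr_ge0.
Qed.

(** The optimizer as a function of an arbitrary field, because the response lemmas compare the
    fields [c] and [c + l q]. *)
Let uu (x : 'I_n -> R) i := mf_optimizer mu A (\col_j x j) i 0.

Let uuE x i : uu x i = psi1 mu (app Af (uu x) i + x i).
Proof.
have := mf_optimizerE hmu (regime_sym reg) (regime_row reg) rho0 rho1 (\col_j x j) i.
by rewrite [(\col_j x j) i 0]mxE.
Qed.

Let v01 : 0 <= v <= 1. Proof. exact: mean_psi2_01. Qed.

Lemma good_optimizer :
  `|(1 - kappa * v) * (\sum_i q i * u i 0) - \sum_i q i * psi1 mu (tnth c i)|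
    <= 8 * b ^+ 2 * delta.
Proof.
have d01 : 0 <= delta <= 1 by rewrite d0.
exact: (optimizer_linear hmu (regime_sym reg) (regime_row reg) rho0 rho1 uuE
  (regime_eigen reg) (regime_nrm reg) v01 d01 s4 se spx spn sen).
Qed.

Let kv : 0 < 1 - kappa * v.
Proof.
have /andP[v0 v1] := v01; rewrite subr_gt0 (le_lt_trans _ rho1)//.
rewrite (le_trans (ler_norm _))// normrM (ger0_norm v0).
by rewrite -[leRHS]mulr1 ler_pM.
Qed.

Lemma good_mgf L (r := 15 * b ^+ 3 * delta * (1 + L) ^+ 3) : r <= 1 ->
  mgf_close (v / (1 - kappa * v)) L
    ((1 + expR 1) * r * expR (v / (1 - kappa * v) * (L ^+ 2 / 2)))
    (distribution (gibbs mu A (col_of_tuple c)) (qstat q (fun i => u i 0))).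
Proof.
have d01 : 0 <= delta <= 1 by rewrite d0.
have /andP[v0 _] := v01.
have b0 : 0 <= b by rewrite invr_ge0 subr_ge0 ltW.
move=> r1; apply: mgf_close_log => //; first by rewrite divr_ge0// ltW.
move=> l lL; pose Y s := lin q s - \sum_i q i * u i 0.
have bY : bm Y by apply: bmB; [exact: bm_lin|exact: bm_cst].
have blY : bm (fun s => l * Y s) by apply: bmM => //; exact: bm_cst.
exists (gE mu Af (tnth c) (fun s => expR (l * Y s))).
  rewrite /gE /tilt divr_gt0//; last by apply: Ex_exp_gt0; exact: bm_Ham.
  have -> : \int[iid_law mu n]_s (expR (l * Y s) * expR (Ham Af (tnth c) s)) =
      \int[iid_law mu n]_s expR (l * Y s + Ham Af (tnth c) s).
    by apply: eq_Ex => s; exact/esym/expRD.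
  by apply: Ex_exp_gt0; apply: bmD => //; exact: bm_Ham.
have cE : (fun i => col_of_tuple c i 0) = tnth c.
  by apply/funext => i; rewrite mxE.
split.
  rewrite ge0_integral_distribution//; last first.
    by apply/measurable_EFinP; apply: measurableT_comp => //; exact: measurable_funM.
  rewrite -cE; apply: gibbs_expect => //.
  - by apply: measurableT_comp => //; apply: measurable_funM => //; exact: measurable_qstat.
  - exact: bm_exp.
  - move=> s hs; congr (expR (l * _)); rewrite /qstat /Y /lin -sumrB.
    by apply: eq_bigr => i _; rewrite (Xc_cube _ hs) mulrBr.
have uE i : u i 0 = uu (tnth c) i by [].
rewrite /Y; under eq_fun do under eq_bigr do rewrite uE.
apply: le_trans (quenched_log_mgf hmu (regime_sym reg) (regime_diag reg)
  (regime_row reg) (regime_row2 reg) rho0 rho1 uuE (regime_eigen reg)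
  (regime_nrm reg) kappa_le v01 (regime_alpha reg) d01
  (fun i => le_trans (regime_sup reg i) zd) (le_trans (regime_err reg) zd)
  (le_trans (regime_sqrt reg) zd) s4 sD sp l) _.
rewrite -/b /r; apply: ler_wpM2l; first by rewrite !mulr_ge0// exprn_ge0.
by rewrite lerXn2r ?nnegrE ?lerD2l ?addr_ge0// (le_trans _ lL).
Qed.

End good_field.

(** * Averaging over the field *)

Section gibbs_measurable.
Context {R : realType}.
Variable mu : probability (measurableTypeR R) R.
Hypothesis hmu : base_measure mu.
Variables (n : nat) (A : 'M[R]_n).
Local Notation tup := (n.-tuple (measurableTypeR R)).
Local Notation Hc c := (Ham (fun i j => A i j) (tnth c)).

Let measurable_part (S : set tup) : measurable S ->
  measurable_fun setT (fun c : tup =>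
    \int[iid_law mu n]_s (\1_S s * expR (Hc c s))).
Proof.
move=> mS; pose f (z : tup * tup) := (\1_S z.2 * expR (Hc z.1 z.2))%:E.
have mf : measurable_fun setT f.
  apply/measurable_EFinP; apply: measurable_funM.
    by apply: measurableT_comp.
  apply: measurableT_comp => //; apply: measurable_funD.
    pose h s : R := 2^-1 * (\sum_i Xc i s * \sum_j A i j * Xc j s).
    have [mh _] : bm h by rewrite /h; bmg.
    exact: (measurableT_comp mh measurable_snd).
  apply: measurable_sum => i; apply: measurable_funM.
    exact: (measurableT_comp (measurable_tnth i) measurable_fst).
  exact: (measurableT_comp (bm_Xc i).1 measurable_snd).
have f0 z : (0 <= f z)%E by rewrite lee_fin mulr_ge0 ?expR_ge0.
have := @measurable_fun_fubini_tonelli_F _ _ tup tup R (iid_law mu n) f mf f0.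
move=> mF; apply/measurable_EFinP.
rewrite (_ : _ \o _ = fubini_F (iid_law mu n) f)//; apply/funext => c /=.
rewrite EFin_Ex//; apply: bmM; first exact: bm_indic.
by apply: bm_exp; exact: bm_Ham.
Qed.

Lemma bm_gibbs (S : set tup) : measurable S ->
  bm (fun c : tup => fine (gibbs mu A (col_of_tuple c) S)).
Proof.
move=> mS; split; last first.
  exists 1 => c; rewrite ger0_norm ?fine_ge0//.
  rewrite -lee_fin fineK; first exact: probability_le1.
  exact: fin_num_measure.
pose I B c := \int[iid_law mu n]_s (\1_B s * expR (Hc c s)).
(* The division by the partition function is written as a product with an exponential of a
   logarithm, whose measurability in [c] is then a matter of composition. *)
have E c : fine (gibbs mu A (col_of_tuple c) S) = I S c * expR (- ln (I setT c)).
  rewrite expRN lnK; last first.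
    rewrite posrE /I (_ : Rintegral _ _ _ = \int[iid_law mu n]_s expR (Hc c s)).
      by apply: Ex_exp_gt0; exact: bm_Ham.
    by apply: eq_Ex => s; rewrite indicT mul1r.
  rewrite gibbs_prob// /I.
  have -> : (fun i => col_of_tuple c i 0) = tnth c.
    by apply/funext => i; rewrite mxE.
  by congr (_ / _); apply: eq_Ex => s; rewrite indicT mul1r.
rewrite (_ : (fun _ => _) = fun c => I S c * expR (- ln (I setT c))); last exact/funext.
have mI B : measurable B -> measurable_fun setT (I B) by exact: measurable_part.
apply: measurable_funM; first exact: mI.
have mln := measurableT_comp (@measurable_ln R) (mI _ measurableT).
exact: (measurableT_comp (@measurable_expR R) (measurable_funN mln)).
Qed.

Lemma annealed_cdf (F : probability (measurableTypeR R) R) q t :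
  cdf_of (pushforward (annealed_gibbs mu F A) (qstat q (fun=> 0))) t =
  \int[iid_law F n]_c fine (gibbs mu A (col_of_tuple c)
    [set s | qstat q (fun=> 0) s <= t]).
Proof.
rewrite /cdf_of /pushforward /annealed_gibbs /Rintegral; congr fine.
apply: eq_integral => c _.
have -> : qstat q (fun=> 0) @^-1` `]-oo, t] = [set s | qstat q (fun=> 0) s <= t].
  by apply/seteqP; split => s /=; rewrite in_itv.
rewrite fineK// fin_num_measure//.
rewrite -[X in measurable X]setTI.
have -> : [set s | qstat q (fun=> 0) s <= t] = qstat q (fun=> 0) @^-1` `]-oo, t].
  by apply/seteqP; split => s /=; rewrite in_itv.
by apply: measurable_qstat.
Qed.

End gibbs_measurable.

(** * Normal mixtures as comparison laws *)

Section mixture.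
Context {d : measure_display} {T : measurableType d} {R : realType}.
Variables (P : probability T R) (N : probability (measurableTypeR R) R).
Variables (y : T -> R) (by_ : bm y).

Definition shifted (z : T * measurableTypeR R) : measurableTypeR R := y z.1 + z.2.

Lemma measurable_shifted : measurable_fun setT shifted.
Proof.
apply: measurable_funD; last exact: measurable_snd.
by case: by_ => my _; exact: (measurableT_comp my measurable_fst).
Qed.

HB.instance Definition _ :=
  isMeasurableFun.Build _ _ _ _ shifted measurable_shifted.

(** The law of [y c] plus an independent variable of law [N]; with [N] normal and [y] a linear
    statistic of the field, it stands in for the annealed law. *)
Definition mixture : probability (measurableTypeR R) R :=
  distribution (P \x N)%E shifted.

Let S t := shifted @^-1` `]-oo, t].

Let mS t : measurable (S t).
Proof. by rewrite -[X in measurable X]setTI; apply: measurable_shifted. Qed.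

Let SE t x : \int[N]_z \1_(S t) (x, z) = cdf_of N (t - y x).
Proof.
rewrite cdf_Ex; apply: eq_Ex => z; rewrite !indicE.
suff -> : ((x, z) \in S t) = (z \in `]-oo, t - y x]%classic) by [].
by apply/idP/idP => /set_mem h; apply/mem_set; move: h;
  rewrite /S /shifted /= !in_itv/= lerBrDl.
Qed.

Lemma bm_cdf_shift t : bm (fun x => cdf_of N (t - y x)).
Proof.
have := bm_Ex2 P N (bm_indic (mS t)).
by rewrite (_ : (fun x => \int[N]_z _) = fun x => cdf_of N (t - y x))//;
  apply/funext => x; exact: SE.
Qed.

Lemma mixture_cdf t : cdf_of mixture t = \int[P]_x cdf_of N (t - y x).
Proof.
transitivity (\int[(P \x N)%E]_z \1_(S t) z).
  by rewrite Ex_indic.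
rewrite Ex_prod12; last exact: bm_indic.
by apply: eq_Ex => x; exact: SE.
Qed.

Lemma mixture_mgf l M : (\int[N]_z (expR (l * z))%:E = M%:E)%E ->
  (\int[mixture]_x (expR (l * x))%:E = (M * \int[P]_x expR (l * y x))%:E)%E.
Proof.
move=> NM.
have me : measurable_fun setT (fun x : measurableTypeR R => (expR (l * x))%:E).
  by apply/measurable_EFinP; apply: measurableT_comp => //; exact: measurable_funM.
have bey : bm (fun x => expR (l * y x)).
  by apply: bm_exp; apply: bmM => //; exact: bm_cst.
rewrite ge0_integral_distribution//.
pose f z := (expR (l * shifted z))%:E.
rewrite (@fubini_tonelli1 _ _ T (measurableTypeR R) R P N f); last 2 first.
- exact: (measurableT_comp me measurable_shifted).
- by move=> z; rewrite lee_fin expR_ge0.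
transitivity (\int[P]_x (M * expR (l * y x))%:E)%E; last first.
  by rewrite -EFin_Ex ?ExZl//; apply: bmM => //; exact: bm_cst.
apply: eq_integral => x _; rewrite /fubini_F /f EFinM -NM -ge0_integralZr//.
apply: eq_integral => z _.
by rewrite /shifted/= -EFinM -expRD mulrDr addrC.
Qed.

End mixture.

Lemma small_delta (R : realType) (K d : R) : 0 <= K -> 0 < d ->
  exists2 x, 0 < x <= 1 & forall y, 0 <= y -> y <= x -> K * y <= d.
Proof.
move=> K0 d0; exists (Num.min 1 (d / (K + 1))).
  by rewrite lt_min ltr01 divr_gt0 ?ltr_wpDl//= ge_min lexx.
move=> y y0; rewrite le_min => /andP[_]; rewrite ler_pdivlMr ?ltr_wpDl//.
by rewrite mulrC => /(le_trans _); apply; rewrite ler_wpM2r// lerDl.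
Qed.

Section ks_bounds.
Context {R : realType}.
Implicit Types P Q : probability (measurableTypeR R) R.

Lemma cdf_dist_le1 P Q s t : `|cdf_of P s - cdf_of Q t| <= 1.
Proof.
have := cdf_ge0 P s; have := cdf_le1 P s.
have := cdf_ge0 Q t; have := cdf_le1 Q t.
by move: (cdf_of P s) (cdf_of Q t) => a b; rewrite ler_norml; lra.
Qed.

Lemma cdf_dist_le_ks P Q t : `|cdf_of P t - cdf_of Q t| <= ks_dist P Q.
Proof.
apply: ub_le_sup; last by exists t.
by exists 1 => _ [s _ <-]; exact: cdf_dist_le1.
Qed.

Lemma ks_dist_ge0 P Q : 0 <= ks_dist P Q.
Proof. exact: le_trans (normr_ge0 _) (cdf_dist_le_ks P Q 0). Qed.

Lemma normal_cdf_dist (V x y r : R) : 0 < V -> `|x - y| <= r ->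
  `|cdf_of (centered_normal V) x - cdf_of (centered_normal V) y|
    <= r * normal_peak (Num.sqrt V).
Proof.
move=> V0; wlog xy : x y / x <= y => [h|].
  have [/h//|/ltW/h] := leP x y; rewrite distrC => {}h xyr.
  by rewrite distrC; exact: h.
rewrite distrC ger0_norm ?subr_ge0// => xyr.
rewrite distrC ger0_norm ?subr_ge0; last exact: (cdf_homo (normal_prob 0 (Num.sqrt V))).
by rewrite lerBlDl; exact: normal_cdf_le.
Qed.

End ks_bounds.

(** * Estimates uniform in the dimension *)

Section core.
Context {R : realType}.
Variables mu F : probability (measurableTypeR R) R.
Hypothesis hmu : base_measure mu.
Hypothesis hF : \int[F]_x psi1 mu x = 0.
Let v := \int[F]_x psi2 mu x.
Let w := \int[F]_x psi1 mu x ^+ 2.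

(** [psi2] is positive everywhere, so a zero mean would make the whole line negligible for [F]. The
    positivity keeps the limiting variances away from 0. *)
Lemma mean_psi2_gt0 : 0 < v.
Proof.
rewrite lt_neqAle; have /andP[-> _] := mean_psi2_01 F hmu; rewrite andbT eq_sym.
apply/eqP => v0.
have b2 := bm_psi2 hmu.
have : (\int[F]_x `|(psi2 mu x)%:E| = 0)%E.
  have -> : (\int[F]_x `|(psi2 mu x)%:E| = v%:E)%E.
    rewrite /v EFin_Ex//; apply: eq_integral => x _.
    by rewrite /= ger0_norm// psi2_ge0.
  by rewrite v0.
move/(ae_eq_integral_abs F measurableT (f := fun x => (psi2 mu x)%:E)) => h.
have /h [B [mB B0 sB]] : measurable_fun setT (fun x : measurableTypeR R => (psi2 mu x)%:E).
  by apply/measurable_EFinP; case: b2.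
have BT : B = setT.
  apply/seteqP; split=> // x _; apply: sB => /= /(_ I) [] /eqP.
  by rewrite gt_eqF// psi2_gt0.
have F1 : F setT = 1%E by exact: probability_setT.
have : 1%E = 0%E :> \bar R by rewrite -F1 -BT.
by move/eqP; rewrite onee_eq0.
Qed.

Variables rho kappa : R.
Hypothesis rho0 : 0 <= rho.
Hypothesis rho1 : rho < 1.
Hypothesis kappa_le : `|kappa| <= rho.

Let b := (1 - rho)^-1.
Let tau := 1 - kappa * v.
Let V := v / tau.

Let b0 : 0 <= b. Proof. by rewrite invr_ge0 subr_ge0 ltW. Qed.

Let tau0 : 0 < tau.
Proof.
have /andP[v0 v1] := mean_psi2_01 F hmu; rewrite subr_gt0 (le_lt_trans _ rho1)//.
rewrite (le_trans (ler_norm _))// normrM (ger0_norm v0).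
by rewrite -[leRHS]mulr1 ler_pM.
Qed.

Let V0 : 0 < V. Proof. by rewrite divr_gt0// mean_psi2_gt0. Qed.

Local Notation qlaw A q c := (distribution (gibbs mu A (col_of_tuple c))
  (qstat q (fun i => mf_optimizer mu A (col_of_tuple c) i 0))).
Local Notation stat A q err := (field_stat mu F (fun i j => A i j) q err).

(** The threshold is chosen before the dimension, the matrix and the direction; [K] and [K1] collect
    the constants of [good_mgf]. *)
Lemma good_ks e : 0 < e -> exists2 d0, 0 < d0 <= 1 &
  forall delta, 0 <= delta -> delta <= d0 ->
  forall n (A : 'M[R]_n) q err alpha zeta,
    regime (fun i j => A i j) q err rho alpha kappa zeta -> zeta <= delta ->
  forall c, stat A q err c <= delta ^+ 4 ->
    ks_dist (qlaw A q c) (centered_normal V) <= e.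
Proof.
move=> e0; have [L [d [d0 H]]] := mgf_ks V0 e0.
pose L' := Num.max L 0; have L'0 : 0 <= L' by rewrite le_max lexx orbT.
pose K := 15 * b ^+ 3 * (1 + L') ^+ 3.
have K0 : 0 <= K.
  by apply: mulr_ge0; [apply: mulr_ge0 => //|]; apply: exprn_ge0 => //; exact: addr_ge0.
pose K1 := (1 + expR 1) * K * expR (V * (L' ^+ 2 / 2)).
have K10 : 0 <= K1.
  by apply: mulr_ge0; [apply: mulr_ge0 => //; rewrite addr_ge0|]; rewrite ?expR_ge0.
have [x1 /andP[x10 x11] h1] := small_delta K0 ltr01.
have [x2 /andP[x20 x21] h2] := small_delta K10 d0.
exists (Num.min x1 x2); first by rewrite lt_min x10 x20 ge_min x11.
move=> delta de0; rewrite le_min => /andP[dx1 dx2] n A q err alpha zeta reg zd c gc.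
apply: H; have d1 := le_trans dx1 x11.
have r1 : 15 * b ^+ 3 * delta * (1 + L') ^+ 3 <= 1.
  by apply: le_trans (h1 _ de0 dx1); rewrite /K le_eqVlt; apply/orP; left; apply/eqP; ring.
have := good_mgf hmu reg rho0 rho1 kappa_le zd d1 gc r1.
apply: mgf_closeW; first by rewrite le_max lexx.
apply: le_trans (h2 _ de0 dx2); rewrite /K1 /K /V /tau /b le_eqVlt.
by apply/orP; left; apply/eqP; ring.
Qed.

Lemma field_stat_markov n (A : 'I_n -> 'I_n -> R) q err alpha zeta delta :
  regime A q err rho alpha kappa zeta -> zeta <= 1 -> 0 < delta ->
  (iid_law F n [set c | delta ^+ 4 < field_stat mu F A q err c]%R
    <= (11 * zeta / delta ^+ 4)%:E)%E.
Proof.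
move=> reg z1 d0; have bs := bm_field_stat F hmu A q err.
have mB := measurable_gt_cst (delta ^+ 4) bs.1.
rewrite -(fineK (fin_num_measure (iid_law F n) _ mB)) lee_fin -Ex_indic//.
rewrite ler_pdivlMr ?exprn_gt0//.
apply: le_trans (field_stat_mean hmu hF reg z1).
rewrite -ExZr; last exact: bm_indic.
apply: le_Ex => //; first by apply: bmM; [exact: bm_indic|exact: bm_cst].
move=> c; rewrite indicE; case: (boolP (c \in _)) => [/set_mem/= /ltW|_].
  by rewrite mul1r.
by rewrite mul0r; exact: field_stat_ge0.
Qed.

(** The event on the distance is contained in the event that [field_stat] is large, which is
    measurable and rare by Markov's inequality; the outer measure only uses this inclusion. *)
Lemma quenched_ks e : 0 < e -> exists2 zeta, 0 < zeta &
  forall n (A : 'M[R]_n) q err alpha,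
    regime (fun i j => A i j) q err rho alpha kappa zeta ->
    (mu_ext (iid_law F n) [set c | (e < `|ks_dist (qlaw A q c) (centered_normal V)|)%R]
      <= e%:E)%E.
Proof.
move=> e0; have [d /andP[d0 d1] H] := good_ks e0.
exists (Num.min d (e * d ^+ 4 / 11)).
  by rewrite lt_min d0 divr_gt0// mulr_gt0// exprn_gt0.
set zeta := Num.min _ _ => n A q err alpha reg.
have zd : zeta <= d by rewrite ge_min lexx.
have ze : zeta <= e * d ^+ 4 / 11 by rewrite ge_min lexx orbT.
have mB := measurable_gt_cst (d ^+ 4) (bm_field_stat F hmu (fun i j => A i j) q err).1.
apply: (@le_trans _ _ (iid_law F n [set c | (d ^+ 4 < stat A q err c)%R])).
  rewrite -measurable_mu_extE//; apply: le_mu_ext => c /=.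
  rewrite ger0_norm; last exact: (ks_dist_ge0 (qlaw A q c) (normal_prob 0 (Num.sqrt V))).
  move=> ek; rewrite ltNge; apply/negP => gc.
  have := H d (ltW d0) (lexx _) _ _ _ _ _ _ reg zd _ gc.
  by rewrite leNgt ek.
apply: (le_trans (field_stat_markov reg (le_trans zd d1) d0)).
rewrite lee_fin ler_pdivrMr ?exprn_gt0// mulrC.
by rewrite -ler_pdivlMr.
Qed.

Let b1 : 1 <= b. Proof. by rewrite /b invf_ge1 ?gerBl// subr_gt0. Qed.

Let vv := V + w / tau ^+ 2.

Let w0 : 0 <= w. Proof. by apply: Ex_ge0 => x; exact: sqr_ge0. Qed.

Let vv0 : 0 < vv.
Proof. by rewrite ltr_wpDr// divr_ge0// sqr_ge0. Qed.

Let N : probability (measurableTypeR R) R := normal_prob 0 (Num.sqrt V).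

(** The logarithm of the generating function of the mixture is the normal one plus a sum of cumulant
    functions. Its cubic error is of order \sum_i |q_i|^3, at most the sup norm of [q] because [q]
    is a unit vector: this is where the spread of [q] acts as a Lindeberg condition. *)
Lemma mixture_close L d : 0 < d -> exists2 z0, 0 < z0 <= 1 &
  forall n (A : 'I_n -> 'I_n -> R) q err alpha zeta,
    regime A q err rho alpha kappa zeta -> zeta <= z0 ->
    mgf_close vv L d
      (mixture (iid_law F n) N (bm_fld (fun i => q i / tau) (bm_psi1 hmu))).
Proof.
move=> d0; pose L' := Num.max L 0; have L'0 : 0 <= L' by rewrite le_max lexx orbT.
pose K := 4 * L' ^+ 3 / tau ^+ 3.
have K0 : 0 <= K.
  apply: divr_ge0; last exact/exprn_ge0/ltW.
  by apply: mulr_ge0 => //; exact: exprn_ge0.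
pose K1 := (1 + expR 1) * K * expR (vv * (L' ^+ 2 / 2)).
have K10 : 0 <= K1.
  by apply: mulr_ge0; [apply: mulr_ge0 => //; rewrite addr_ge0|]; rewrite ?expR_ge0.
have [x1 /andP[x10 x11] h1] := small_delta K0 ltr01.
have [x2 /andP[x20 x21] h2] := small_delta K10 d0.
exists (Num.min x1 x2); first by rewrite lt_min x10 x20 ge_min x11.
move=> n A q err alpha zeta reg; rewrite le_min => /andP[z1 z2].
have z0 := regime_zeta reg.
apply: (@mgf_closeW _ _ L L' d ((1 + expR 1) * (K * zeta) * expR (vv * (L' ^+ 2 / 2)))).
- by rewrite le_max lexx.
- apply: le_trans (h2 _ z0 z2); rewrite /K1 le_eqVlt.
  by apply/orP; left; apply/eqP; ring.
apply: mgf_close_log => //; [exact: ltW|exact: h1|] => l lL.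
pose a i := l * (q i / tau).
have aE c : l * fld (psi1 mu) (fun i => q i / tau) c = fld (psi1 mu) a c.
  by rewrite /fld mulr_sumr; apply: eq_bigr => i _; rewrite /a; ring.
have fm := fld_log_mgf a (bm_psi1 hmu) hF (psi1_norm hmu).
have bf : bm (fld (psi1 mu) a : n.-tuple (measurableTypeR R) -> R).
  exact: (bm_fld a (bm_psi1 hmu)).
pose E := \int[iid_law F n]_c expR (fld (psi1 mu) a c).
have E0 : 0 < E by exact: Ex_exp_gt0.
exists (expR (V * (l ^+ 2 / 2)) * E); first by rewrite mulr_gt0 ?expR_gt0.
split.
  rewrite (mixture_mgf _ _ (normal_mgf_ereal V0 l)); congr (_ * _)%:E.
  by apply: eq_Ex => c; rewrite aE.
rewrite lnM ?posrE ?expR_gt0// expRK.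
have sq : \sum_i q i ^+ 2 = 1 by rewrite -nrm_sqr (regime_nrm reg) expr1n.
have sa : \sum_i a i ^+ 2 = l ^+ 2 / tau ^+ 2.
  rewrite -[RHS]mulr1 -sq mulr_sumr; apply: eq_bigr => i _.
  by rewrite /a; field; rewrite gt_eqF.
have -> : V * (l ^+ 2 / 2) + ln E - vv * (l ^+ 2 / 2) =
    ln E - w * ((\sum_i a i ^+ 2) / 2).
  by rewrite sa /vv; field; rewrite gt_eqF.
apply: (le_trans fm).
rewrite (_ : K * zeta = 4 * (L' ^+ 3 * (tau ^- 3 * zeta))) ?ler_wpM2l//; last first.
  by rewrite /K; field; rewrite gt_eqF.
apply: (@le_trans _ _ (\sum_i (L' ^+ 3 * (tau ^- 3 * zeta)) * q i ^+ 2)); last first.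
  by rewrite -mulr_sumr sq mulr1.
apply: ler_sum => i _; rewrite /a !normrM normfV (gtr0_norm tau0).
have -> : (`|l| * (`|q i| / tau)) ^+ 3 =
    `|l| ^+ 3 * (tau ^- 3 * `|q i|) * q i ^+ 2.
  by rewrite -(real_normK (num_real (q i))); field; rewrite gt_eqF.
rewrite ler_wpM2r ?sqr_ge0//; apply: ler_pM.
- exact: exprn_ge0.
- by apply: mulr_ge0 => //; rewrite invr_ge0 exprn_ge0// ltW.
- by rewrite lerXn2r ?nnegrE// (le_trans lL).
- by rewrite ler_wpM2l ?invr_ge0 ?exprn_ge0 ?(ltW tau0)//; exact: (regime_sup reg).
Qed.

(** Four errors of e/4: the fields with a large [field_stat], the quenched distance on the other
    fields, the displacement of the normal distribution function when the optimizer is linearized,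
    and the distance from the mixture to the normal law. *)
Lemma annealed_dist e t : 0 < e -> exists2 zeta, 0 < zeta &
  forall n (A : 'M[R]_n) q err alpha,
    regime (fun i j => A i j) q err rho alpha kappa zeta ->
    `|cdf_of (pushforward (annealed_gibbs mu F A) (qstat q (fun=> 0))) t -
      cdf_of (centered_normal vv) t| <= e.
Proof.
move=> e0; have e4 : 0 < e / 4 by rewrite divr_gt0.
pose C := normal_peak (Num.sqrt V).
have C0 : 0 <= C by exact: normal_peak_ge0.
have [L [d [d0 HL]]] := mgf_ks vv0 e4.
have [z0 /andP[z00 z01] HM] := mixture_close L d0.
have [x1 /andP[x10 x11] HQ] := good_ks e4.
have K0 : 0 <= 8 * b ^+ 2 / tau * C.
  apply: mulr_ge0 => //; apply: divr_ge0; last exact: ltW.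
  by apply: mulr_ge0 => //; exact: sqr_ge0.
have [x2 /andP[x20 x21] HC] := small_delta K0 e4.
pose delta := Num.min x1 x2.
have dl0 : 0 < delta by rewrite lt_min x10.
have dl1 : delta <= x1 by rewrite ge_min lexx.
have dl2 : delta <= x2 by rewrite ge_min lexx orbT.
have dd : delta <= 1 by exact: le_trans dl1 x11.
have d40 : 0 < delta ^+ 4 by exact: exprn_gt0.
exists (Num.min (Num.min z0 delta) (e / 4 * delta ^+ 4 / 11)).
  rewrite lt_min divr_gt0 ?mulr_gt0// andbT lt_min z00 /=; exact: dl0.
set zeta := Num.min _ _ => n A q err alpha reg.
have zz0 : zeta <= z0 by rewrite ge_min ge_min lexx.
have zd : zeta <= delta.
  by rewrite ge_min; apply/orP; left; rewrite ge_min (lexx delta) orbT.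
have ze : zeta <= e / 4 * delta ^+ 4 / 11 by rewrite ge_min lexx orbT.
have by_ := bm_fld (fun i => q i / tau) (bm_psi1 hmu).
have := HL _ (HM _ _ _ _ _ _ reg zz0).
set Q := mixture _ _ _ => ksQ.
have h1 : `|cdf_of Q t - cdf_of (centered_normal vv) t| <= e / 4.
  exact: le_trans (cdf_dist_le_ks Q (normal_prob 0 (Num.sqrt vv)) t) ksQ.
have h2 : `|cdf_of (pushforward (annealed_gibbs mu F A) (qstat q (fun=> 0))) t -
    cdf_of Q t| <= e / 4 + e / 4 + e / 4.
  rewrite annealed_cdf mixture_cdf.
  have mS : measurable [set s | qstat q (fun=> 0) s <= t].
    rewrite -[X in measurable X]setTI.
    have -> : [set s | qstat q (fun=> 0) s <= t] = qstat q (fun=> 0) @^-1` `]-oo, t].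
      by apply/seteqP; split => s /=; rewrite in_itv.
    by apply: measurable_qstat.
  have bg := bm_gibbs hmu A mS.
  have bN := bm_cdf_shift (iid_law F n) N by_ t.
  have bs := bm_field_stat F hmu (fun i j => A i j) q err.
  have bs' : bm (fun c => e / 4 + e / 4 + stat A q err c * (delta ^+ 4)^-1).
    by apply: bmD; [exact: bm_cst|apply: bmM => //; exact: bm_cst].
  (* The last summand exceeds 1 on the fields with a large statistic, where only the trivial bound
     on the difference is available. *)
  rewrite -ExB//; apply: (@le_trans _ _ (\int[iid_law F n]_c
      (e / 4 + e / 4 + stat A q err c * (delta ^+ 4)^-1))).
    apply: norm_Ex_le => //; first exact: bmB.
    move=> c.
    set m := \sum_i q i * mf_optimizer mu A (col_of_tuple c) i 0.
    have -> : fine (gibbs mu A (col_of_tuple c) [set s | qstat q (fun=> 0) s <= t]) =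
        cdf_of (qlaw A q c) (t - m).
      rewrite /cdf_of; congr (fine (gibbs mu A (col_of_tuple c) _)).
      have E s : qstat q (fun=> 0) s =
          qstat q (fun i => mf_optimizer mu A (col_of_tuple c) i 0) s + m.
        rewrite /qstat /m -big_split/=; apply: eq_bigr => i _.
        by rewrite subr0 -mulrDr subrK.
      by apply/seteqP; split => s /=; rewrite in_itv/= lerBrDr E.
    have [gc|bc] := leP (stat A q err c) (delta ^+ 4); last first.
      apply: (@le_trans _ _ 1).
        exact: (cdf_dist_le1 (qlaw A q c) N).
      rewrite ler_wpDl ?addr_ge0 ?(ltW e4)//.
      by rewrite ler_pdivlMr// mul1r ltW.
    apply: (@le_trans _ _ (e / 4 + e / 4)); last first.
      by rewrite lerDl divr_ge0 ?field_stat_ge0// ltW.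
    rewrite -(subrK (cdf_of N (t - m)) (cdf_of (qlaw A q c) (t - m))) -addrA.
    rewrite (le_trans (ler_normD _ _))//; apply: lerD.
      apply: le_trans (HQ _ (ltW dl0) dl1 _ _ _ _ _ _ reg zd _ gc).
      exact: (cdf_dist_le_ks (qlaw A q c) N).
    apply: le_trans (HC _ (ltW dl0) dl2).
    rewrite mulrAC; apply: normal_cdf_dist => //.
    have go := good_optimizer hmu reg rho0 rho1 zd dd gc.
    rewrite opprB addrC subrKA distrC.
    have -> : m - fld (psi1 mu) (fun i => q i / tau) c =
        (tau * m - \sum_i q i * psi1 mu (tnth c i)) / tau.
      rewrite mulrBl mulrAC divff ?gt_eqF// mul1r; congr (_ - _).
      by rewrite mulr_suml; apply: eq_bigr => i _; ring.
    rewrite normrM normfV (gtr0_norm tau0) mulrAC.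
    by apply: ler_wpM2r => //; rewrite invr_ge0 ltW.
  rewrite ExD; [|exact: bm_cst|by apply: bmM => //; exact: bm_cst].
  rewrite Ex_cst lerD2l ExZr// ler_pdivrMr//.
  apply: (le_trans (field_stat_mean hmu hF reg (le_trans zd dd))).
  by rewrite mulrC -ler_pdivlMr.
rewrite (_ : _ - _ = (cdf_of (pushforward (annealed_gibbs mu F A) (qstat q (fun=> 0))) t
  - cdf_of Q t) + (cdf_of Q t - cdf_of (centered_normal vv) t)); last by ring.
rewrite (le_trans (ler_normD _ _))//.
have -> : e = e / 4 + e / 4 + e / 4 + e / 4 by field.
exact: lerD.
Qed.

End core.

Section limits.
Context {R : realType}.
Variables mu F : probability (measurableTypeR R) R.
Hypothesis hmu : base_measure mu.
Hypothesis hF : \int[F]_x psi1 mu x = 0.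
Let v := \int[F]_x psi2 mu x.
Let w := \int[F]_x psi1 mu x ^+ 2.
Variables (A : forall n, 'M[R]_n) (q err : forall n, 'I_n -> R) (alpha : nat -> R).
Variables rho kappa : R.
Hypothesis rho0 : 0 <= rho.
Hypothesis rho1 : rho < 1.
Hypothesis kappa_le : `|kappa| <= rho.
Hypothesis reg : forall zeta, 0 < zeta -> \forall n \near \oo,
  regime (fun i j => A n i j) (@q n) (@err n) rho (alpha n) kappa zeta.

Lemma quenched_limit : cvg0_in_prob (iid_law F)
  (fun n c => ks_dist
     (pushforward (gibbs mu (A n) (col_of_tuple c))
        (qstat (@q n) (fun i => mf_optimizer mu (A n) (col_of_tuple c) i 0)))
     (centered_normal (v / (1 - kappa * v)))).
Proof.
move=> e e0.
have key eps : 0 < eps -> \forall n \near \oo,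
    (mu_ext (iid_law F n) [set c | (e < `|ks_dist
       (pushforward (gibbs mu (A n) (col_of_tuple c))
         (qstat (@q n) (fun i => mf_optimizer mu (A n) (col_of_tuple c) i 0)))
       (centered_normal (v / (1 - kappa * v)))|)%R] <= eps%:E)%E.
  move=> eps0; have e'0 : 0 < Num.min e eps by rewrite lt_min e0.
  have [zeta z0 H] := quenched_ks hmu hF rho0 rho1 kappa_le e'0.
  near=> n.
  have rn : regime (fun i j => A n i j) (@q n) (@err n) rho (alpha n) kappa zeta.
    by near: n; exact: reg.
  apply: le_trans (le_trans (H _ _ _ _ _ rn) _); last by rewrite lee_fin ge_min lexx orbT.
  by apply: le_mu_ext => c /=; apply: le_lt_trans; rewrite ge_min lexx.
apply/fine_cvgP; split.
  near=> n; apply/fin_numPlt; rewrite (lt_le_trans _ (mu_ext_ge0 _ _))//=.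
  apply: (@le_lt_trans _ _ 1%E); last exact: ltry.
  by near: n; exact: key.
apply/cvgrPdist_le => eps eps0; near=> n.
rewrite /= sub0r normrN ger0_norm ?fine_ge0 ?mu_ext_ge0//.
have h : (mu_ext (iid_law F n) [set c | (e < `|ks_dist
       (pushforward (gibbs mu (A n) (col_of_tuple c))
         (qstat (@q n) (fun i => mf_optimizer mu (A n) (col_of_tuple c) i 0)))
       (centered_normal (v / (1 - kappa * v)))|)%R] <= eps%:E)%E.
  by near: n; exact: key.
rewrite -lee_fin fineK//; apply/fin_numPlt.
rewrite (lt_le_trans _ (mu_ext_ge0 _ _))//=.
exact: le_lt_trans h (ltry _).
Unshelve. all: by end_near.
Qed.

Lemma annealed_limit : cvg_in_law
  (fun n => pushforward (annealed_gibbs mu F (A n)) (qstat (@q n) (fun=> 0)))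
  (centered_normal (v / (1 - kappa * v) + w / (1 - kappa * v) ^+ 2)).
Proof.
move=> t _; apply/cvgrPdist_le => eps eps0.
have [zeta z0 H] := annealed_dist hmu hF rho0 rho1 kappa_le t eps0.
near=> n; rewrite distrC; apply: (H n (A n) (@q n) (@err n) (alpha n)).
by near: n; exact: reg.
Unshelve. all: by end_near.
Qed.

End limits.

(** * Regular graphs *)

Section operator_norm.
Context {R : realType}.

Lemma nrm_mulmx_le n (M : 'M[R]_n) (x : 'cV[R]_n) : norm2 x <= 1 ->
  nrm (app (fun i j => M i j) (fun j => x j 0)) <= opnorm M.
Proof.
move=> x1; set y := app _ _.
have yE (z : 'cV[R]_n) : norm2 (M *m z) = nrm (app (fun i j => M i j) (fun j => z j 0)).
  by rewrite /norm2 /nrm; congr Num.sqrt; apply: eq_bigr => i _; rewrite mxE.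
rewrite -yE; apply: ub_le_sup; last by exists x.
(* The Frobenius norm bounds the set, so that the supremum defining [opnorm] is an actual upper
   bound. *)
exists (Num.sqrt (\sum_i \sum_j M i j ^+ 2)) => _ [z /= z1 <-].
rewrite /norm2 ler_wsqrtr//; apply: ler_sum => i _; rewrite mxE.
rewrite (le_trans (cauchy_schwarz _ _))// ler_piMr ?sumsq_ge0//.
by rewrite -(nrm_sqr (fun j => z j 0)) exprn_ile1// nrm_ge0.
Qed.

Lemma nrmD_sqr n (x y z : 'I_n -> R) : (forall i, z i = x i + y i) ->
  nrm z ^+ 2 <= 2 * nrm x ^+ 2 + 2 * nrm y ^+ 2.
Proof.
move=> zE; rewrite !nrm_sqr !mulr_sumr -big_split; apply: ler_sum => i _ /=.
rewrite zE; have := sqr_ge0 (x i - y i); move: (x i) (y i) => a b; nra.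
Qed.

End operator_norm.

Section regular_graph.
Context {R : realType}.
Variables (n d : nat) (G : rel 'I_n) (theta : R).
Hypothesis hG : regular_graph G d.
Hypothesis d0 : (0 < d)%N.
Hypothesis theta1 : `|theta| < 1.
Let A : 'M[R]_n := (theta / d%:R) *: adj_mx G.
Let Af i j := A i j.
Let alpha := theta ^+ 2 / d%:R.

Let dR : 0 < d%:R :> R. Proof. by rewrite ltr0n. Qed.

Lemma sum_adj (x : R) i : \sum_j (G i j)%:R * x = d%:R * x.
Proof.
have [_ _ deg] := hG; rewrite -mulr_suml; congr (_ * _).
rewrite -(deg i) -sum1_card natr_sum [RHS]big_mkcond/=.
by apply: eq_bigr => j _; rewrite inE; case: (G i j).
Qed.

Let AE i j : A i j = (G i j)%:R * (theta / d%:R).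
Proof. by rewrite !mxE mulrC. Qed.

Lemma graph_mx_const i (x : R) : app Af (fun=> x) i = theta * x.
Proof.
rewrite /app /Af; under eq_bigr do rewrite AE -mulrA.
by rewrite sum_adj; field; rewrite gt_eqF.
Qed.

Lemma graph_deg_le : (0 < n)%N -> (d <= n)%N.
Proof.
case: n G hG => // m g [_ _ deg] _; rewrite -(deg ord0).
by rewrite (leq_trans (max_card _))// card_ord.
Qed.

Lemma theta2_le1 : theta ^+ 2 <= 1.
Proof. by rewrite -(real_normK (num_real _)) exprn_ile1// ltW. Qed.

Lemma graph_regime (q e : 'I_n -> R) kappa zeta :
  (forall i, app Af q i = kappa * q i + e i) -> nrm q = 1 ->
  Num.sqrt n%:R / d%:R <= zeta -> (forall i, `|q i| <= zeta) ->
  nrm e <= zeta -> nrm e ^+ 2 * (n%:R * alpha) <= zeta ->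
  regime Af q e `|theta| alpha kappa zeta.
Proof.
move=> qE q1 sz qz ez ez2; have [sG iG _] := hG; split => //.
- by move=> i j; rewrite /Af !AE sG.
- by move=> i; rewrite /Af AE iG mul0r.
- move=> i; under eq_bigr do rewrite /Af AE normrM normr_nat.
  by rewrite sum_adj normrM normfV normr_nat mulrC divfK// gt_eqF.
- move=> i; rewrite (eq_bigr (fun j => (G i j)%:R * (theta / d%:R) ^+ 2)).
    by rewrite sum_adj /alpha le_eqVlt; apply/orP; left; apply/eqP; field; rewrite gt_eqF.
  by move=> j _; rewrite /Af AE exprMn; case: (G i j); rewrite ?expr1n ?expr0n.
- by rewrite divr_ge0// sqr_ge0.
- apply: le_trans sz; rewrite mulrA ler_wpM2r ?invr_ge0//.
  by rewrite ler_piMr ?sqrtr_ge0// theta2_le1.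
Qed.

(** [A q] splits into the centered matrix applied to [q] and a constant vector with entries theta /
    n times the sum of [q]. *)
Lemma graph_contrast_error (q : 'cV[R]_n) : norm2 q = 1 ->
  nrm (app Af (fun j => q j 0)) ^+ 2 <=
    2 * opnorm (A - (theta / n%:R) *: const_mx 1) ^+ 2 +
    2 * ((\sum_i q i 0) ^+ 2 / n%:R).
Proof.
move=> q1; set M := A - _.
case: (posnP n) => [n0|n0].
  move: q1; rewrite /norm2 big1 ?sqrtr0; first by move=> /eqP; rewrite eq_sym oner_eq0.
  by move=> i _; have := leq_trans (ltn_ord i) (eq_leq n0).
pose s := \sum_i q i 0.
have nR : 0 < n%:R :> R by rewrite ltr0n.
apply: (le_trans (nrmD_sqr (x := app (fun i j => M i j) (fun j => q j 0))
  (y := fun=> theta / n%:R * s) _)).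
  move=> i; rewrite /app /s mulr_sumr -big_split; apply: eq_bigr => j _ /=.
  by rewrite /Af /M !mxE; ring.
apply: lerD; rewrite ler_pM2l//.
  have h : nrm (app (fun i j => M i j) (fun j => q j 0)) <= opnorm M.
    by apply: nrm_mulmx_le; rewrite q1.
  by rewrite lerXn2r ?nnegrE ?nrm_ge0// (le_trans (nrm_ge0 _) h).
rewrite nrm_sqr sumr_const card_ord -[leLHS]mulr_natl -/s.
rewrite (_ : _ * _ = theta ^+ 2 * (s ^+ 2 / n%:R)); last by field; rewrite gt_eqF.
by rewrite ler_piMl ?theta2_le1// divr_ge0// sqr_ge0.
Qed.

End regular_graph.
Theorem corollary2p9 (R : realType) (mu F : probability (measurableTypeR R) R)
    (hmu : base_measure mu)
    (d : nat -> nat) (G : forall n, rel 'I_n)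
    (hG : forall n, regular_graph (@G n) (d n))
    (theta : R)
    (A : forall n, 'M[R]_n)
    (hA : forall n, A n = (theta / (d n)%:R) *: adj_mx (@G n))
    (hF : \int[F]_x psi1 mu x = 0)
    (hd : (fun n => Num.sqrt n%:R : R) =o_\oo (fun n => (d n)%:R : R))
    (htheta : `|theta| < 1) :
  let v := \int[F]_x psi2 mu x in
  let w := \int[F]_x (psi1 mu x) ^+ 2 in
  let u n (c : n.-tuple R) := mf_optimizer mu (A n) (col_of_tuple c) in
  (cvg0_in_prob (iid_law F)
     (fun n c => ks_dist
        (pushforward (gibbs mu (A n) (col_of_tuple c))
           (fun s : n.-tuple R =>
              (Num.sqrt n%:R)^-1 * \sum_i (tnth s i - u n c i 0)))
        (centered_normal (v / (1 - theta * v)))) /\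
   cvg_in_law
     (fun n => pushforward (annealed_gibbs mu F (A n))
        (fun s : n.-tuple R => (Num.sqrt n%:R)^-1 * \sum_i tnth s i))
     (centered_normal (v / (1 - theta * v) + w / (1 - theta * v) ^+ 2))) /\
  (forall q : forall n, 'cV[R]_n,
     (forall n, (0 < n)%N -> norm2 (q n) = 1) ->
     (fun n => \sum_i q n i 0) =o_\oo (fun n => Num.sqrt (d n)%:R : R) ->
     `|q n| @[n --> \oo] --> 0 ->
     (fun n => opnorm (A n - (theta / n%:R) *: const_mx 1))
       =O_\oo (fun n => (Num.sqrt (d n)%:R)^-1 : R) ->
     cvg0_in_prob (iid_law F)
       (fun n c => ks_dist
          (pushforward (gibbs mu (A n) (col_of_tuple c))
             (fun s : n.-tuple R => \sum_i q n i 0 * (tnth s i - u n c i 0)))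
          (centered_normal v)) /\
     cvg_in_law
       (fun n => pushforward (annealed_gibbs mu F (A n))
          (fun s : n.-tuple R => \sum_i q n i 0 * tnth s i))
       (centered_normal (v + w))).
Proof.
move=> v w u.
have deg eps : 0 < eps -> \forall n \near \oo,
    [/\ (0 < n)%N, (0 < d n)%N, Num.sqrt n%:R / (d n)%:R <= eps :> R,
        (Num.sqrt n%:R)^-1 <= eps :> R & (d n)%:R <= n%:R :> R].
  move=> e0; move/eqoP: hd => /(_ _ e0) hd'; near=> n.
  have n0 : (0 < n)%N by near: n; exact: nbhs_infty_gt.
  have sn0 : 0 < Num.sqrt n%:R :> R by rewrite sqrtr_gt0 ltr0n.
  have h : Num.sqrt n%:R <= eps * (d n)%:R.
    have : `|Num.sqrt n%:R : R| <= eps * `|(d n)%:R : R| by near: n; exact: hd'.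
    by rewrite ger0_norm// normr_nat.
  have d0 : (0 < d n)%N.
    by move: (lt_le_trans sn0 h); rewrite pmulr_rgt0// ltr0n.
  have dn : (d n)%:R <= n%:R :> R by rewrite ler_nat (graph_deg_le (hG n)).
  split => //; first by rewrite ler_pdivrMr// ltr0n.
  (* The decay of 1 / sqrt n follows from that of sqrt n / d, since d <= n. *)
  rewrite -[leLHS]mulr1 ler_pdivrMl// mulrC -(@ler_pM2r _ (Num.sqrt n%:R))// mul1r.
  by rewrite -mulrA -expr2 sqr_sqrtr// (le_trans h)// ler_wpM2l// ltW.
split; [|move=> q q1 qs qsup qop].
- pose q n (_ : 'I_n) : R := (Num.sqrt n%:R)^-1.
  have reg zeta : 0 < zeta -> \forall n \near \oo, regime (fun i j => A n i j)
      (@q n) (fun=> 0) `|theta| (theta ^+ 2 / (d n)%:R) theta zeta.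
    move=> z0; near=> n.
    have [n0 d0 s1 s2 _] : [/\ (0 < n)%N, (0 < d n)%N,
        Num.sqrt n%:R / (d n)%:R <= zeta :> R,
        (Num.sqrt n%:R)^-1 <= zeta :> R & (d n)%:R <= n%:R :> R].
      by near: n; exact: deg.
    have nrm0 : @nrm R n (fun=> 0) = 0.
      by rewrite /nrm big1 ?sqrtr0// => i _; rewrite expr0n.
    rewrite hA; apply: (graph_regime (hG n)) => //.
    + by move=> i; rewrite (graph_mx_const theta (hG n))// addr0.
    + rewrite /nrm /q sumr_const card_ord exprVn sqr_sqrtr// -[X in Num.sqrt X]mulr_natl.
      by rewrite divff ?sqrtr1// pnatr_eq0 -lt0n.
    + by move=> i; rewrite ger0_norm// invr_ge0.
    + by rewrite nrm0 ltW.
    + by rewrite nrm0 expr0n/= mul0r ltW.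
  have qE n (m : 'I_n -> R) (s : n.-tuple R) :
      (Num.sqrt n%:R)^-1 * (\sum_i (tnth s i - m i)) = qstat (@q n) m s.
    by rewrite mulr_sumr.
  split.
    have := quenched_limit hmu hF (normr_ge0 _) htheta (lexx _) reg.
    congr cvg0_in_prob; apply: functional_extensionality_dep => n; apply/funext => c.
    by congr (ks_dist (pushforward _ _) _); apply/funext => s; rewrite qE.
  have := annealed_limit hmu hF (normr_ge0 _) htheta (lexx _) reg.
  congr cvg_in_law; apply/funext => n.
  congr pushforward; apply/funext => s; rewrite -qE; congr (_ * _).
  by apply: eq_bigr => i _; rewrite subr0.
- pose qf n (i : 'I_n) : R := q n i 0.
  pose err n := app (fun i j => A n i j) (@qf n).
  have k0 : `|0 : R| <= `|theta| by rewrite normr0.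
  have [k k_gt0 qop'] := (eqO_exP _ _ _).1 qop.
  have reg zeta : 0 < zeta -> \forall n \near \oo, regime (fun i j => A n i j)
      (@qf n) (@err n) `|theta| (theta ^+ 2 / (d n)%:R) 0 zeta.
    move=> z0; pose K := 2 * k ^+ 2 + 2.
    have K1 : 1 <= K by have := sqr_ge0 k; rewrite /K; lra.
    (* The squared norm of [err] will be at most [K * eps]. It is compared with [zeta ^+ 2] to bound
       the norm itself by [zeta]. *)
    have z'0 : 0 < Num.min zeta (zeta ^+ 2) by rewrite lt_min z0 exprn_gt0.
    have [eps /andP[e0 e1] He] := small_delta (le_trans ler01 K1) z'0.
    have Kz : K * eps <= zeta.
      by rewrite (le_trans (He _ (ltW e0) (lexx _)))// ge_min lexx.
    have Kz2 : K * eps <= zeta ^+ 2.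
      by rewrite (le_trans (He _ (ltW e0) (lexx _)))// ge_min lexx orbT.
    have ez : eps <= zeta by rewrite (le_trans _ Kz)// ler_peMl// ltW.
    have qs' := (eqoP _ _ _).1 qs _ e0.
    have qsup' := (cvgr0Pnorm_le _).1 qsup _ z0.
    near=> n.
    have [n0 d0 s1 s2 dn] : [/\ (0 < n)%N, (0 < d n)%N,
        Num.sqrt n%:R / (d n)%:R <= eps :> R,
        (Num.sqrt n%:R)^-1 <= eps :> R & (d n)%:R <= n%:R :> R].
      by near: n; exact: deg.
    have op : `|opnorm (A n - (theta / n%:R) *: const_mx 1)| <=
        k * `|(Num.sqrt (d n)%:R)^-1|.
      by near: n.
    have sm : `|\sum_i q n i 0| <= eps * `|Num.sqrt (d n)%:R| by near: n.
    have qz : `| `|q n| | <= zeta by near: n; exact: qsup'.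
    have dR : 0 < (d n)%:R :> R by rewrite ltr0n.
    have nR : 0 < n%:R :> R by rewrite ltr0n.
    have E := graph_contrast_error (d n) (G n) htheta (q1 n n0).
    rewrite -hA in E; set o := opnorm _ in op E; set s := \sum_i _ in sm E.
    have nR1 : 1 <= Num.sqrt n%:R :> R.
      by rewrite -[leLHS]sqrtr1 ler_wsqrtr// ler1n.
    have o2 : o ^+ 2 <= k ^+ 2 / (d n)%:R.
      rewrite -(real_normK (num_real o)).
      apply: (@le_trans _ _ ((k * `|(Num.sqrt (d n)%:R)^-1|) ^+ 2)).
        by rewrite lerXn2r// ?nnegrE// mulr_ge0// ltW.
      by rewrite exprMn real_normK ?num_real// exprVn sqr_sqrtr.
    have s2' : s ^+ 2 <= eps ^+ 2 * (d n)%:R.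
      rewrite -(real_normK (num_real s)).
      apply: (@le_trans _ _ ((eps * `|Num.sqrt (d n)%:R|) ^+ 2)).
        by rewrite lerXn2r// ?nnegrE// mulr_ge0// ltW.
      by rewrite exprMn real_normK ?num_real// sqr_sqrtr.
    have d1 : (d n)%:R^-1 <= eps.
      by rewrite (le_trans _ s1)// ler_peMl// invr_ge0 ltW.
    have ee : eps ^+ 2 <= eps by rewrite expr2 ler_piMl// ltW.
    have sn : s ^+ 2 / n%:R <= eps.
      rewrite ler_pdivrMr// (le_trans s2')// ler_pM// ?sqr_ge0//; exact: ltW.
    have sd : s ^+ 2 / (d n)%:R <= eps by rewrite ler_pdivrMr// (le_trans s2')// ler_wpM2r// ltW.
    have nd : n%:R / (d n)%:R ^+ 2 <= eps.
      apply: le_trans ee; rewrite (_ : _ / _ = (Num.sqrt n%:R / (d n)%:R) ^+ 2).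
        by rewrite lerXn2r ?nnegrE ?divr_ge0 ?sqrtr_ge0// ltW.
      by rewrite exprMn sqr_sqrtr// exprVn.
    have k2 : 0 <= k ^+ 2 by exact: sqr_ge0.
    have Ez : nrm (@err n) ^+ 2 <= K * eps.
      apply: (le_trans E).
      have -> : K * eps = 2 * (k ^+ 2 * eps) + 2 * eps by rewrite /K; ring.
      apply: lerD; rewrite ler_pM2l//.
      by apply: (le_trans o2); rewrite ler_wpM2l.
    rewrite hA; apply: (graph_regime (hG n)) => //.
    + by move=> i; rewrite mul0r add0r /err hA.
    + exact: q1.
    + exact: le_trans s1 ez.
    + by move=> i; apply: le_trans (le_mx_norm _ _ _) _; rewrite -(normr_id (q n)).
    + rewrite -(@ler_pXn2r _ 2)// ?nnegrE ?nrm_ge0 ?(ltW z0)//.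
      exact: le_trans Ez Kz2.
    + apply: (@le_trans _ _ (nrm (@err n) ^+ 2 * (n%:R / (d n)%:R))).
        rewrite ler_wpM2l ?sqr_ge0// ler_pM2l// ler_piMl ?invr_ge0 ?(ltW dR)//.
        exact: theta2_le1.
      apply: le_trans Kz.
      (* The two contributions to the norm of [err] stay separate here, as the factor n / d may
         diverge: the operator norm part becomes of order n / d^2, and the part from the sum of [q]
         becomes s^2 / d, small because that sum is o(sqrt d). *)
      apply: (@le_trans _ _ ((2 * (k ^+ 2 / (d n)%:R) + 2 * (s ^+ 2 / n%:R)) *
          (n%:R / (d n)%:R))).
        rewrite ler_wpM2r ?divr_ge0 ?(ltW nR) ?(ltW dR)// (le_trans E)//.
        by rewrite lerD2r ler_pM2l.
      rewrite (_ : _ * (_ / _) = 2 * k ^+ 2 * (n%:R / (d n)%:R ^+ 2) +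
        2 * (s ^+ 2 / (d n)%:R)); last by field; rewrite !gt_eqF.
      have -> : K * eps = 2 * k ^+ 2 * eps + 2 * eps by rewrite /K; ring.
      by apply: lerD; rewrite ler_wpM2l// mulr_ge0.
  have V0 : v / (1 - 0 * v) = v by rewrite mul0r subr0 divr1.
  have W0 : v + w / (1 - 0 * v) ^+ 2 = v + w by rewrite mul0r subr0 expr1n divr1.
  split.
    have := quenched_limit hmu hF (normr_ge0 _) htheta k0 reg.
    by rewrite V0.
  have := annealed_limit hmu hF (normr_ge0 _) htheta k0 reg.
  rewrite V0 W0; congr cvg_in_law; apply/funext => n.
  congr pushforward; apply/funext => s.
  by apply: eq_bigr => i _; rewrite subr0.
Unshelve. all: by end_near.
Qed.
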